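(* Let $X$ be a manifold with a distribution $\mathcal D\subset TX$ such that $(\operatorname{rank}\mathcal D,\operatorname{corank}\mathcal D)=(4m-4,3)$ (quaternionic case) or $(8,7)$ (octonionic case). Let $E\to X$ be the $L$-principal bundle of pairs of frames of $\mathcal D$ and $TX/\mathcal D$, and let $f_{\mathcal L}:E\to W$ be the $L$-equivariant map representing the Levi bracket $\mathcal L$ of $\mathcal D$. Then there is an open set $U\subset W$, containing the standard bracket $\kappa$, such that for all points $x\in X$ where $f_{\mathcal L}(E_x)$ intersects $U$, there exists a locally unique, continuously defined, choice of algebraic bracket $\mathcal K_x\in\Lambda^2\mathcal D_x^*\otimes(T_xX/\mathcal D_x)$ compatible with $\mathcal L_x$.
   Context: Notation. $V_1,V_2$ are real vector spaces of dimensions $4m-4,3$ (quaternionic case, $m\ge2$) or $8,7$ (octonionic case); $W=\Lambda^2V_1^*\otimes V_2$; $L=GL(V_1)\times GL(V_2)$. The standard bracket $\kappa\in W$ is $\kappa(x,y)=\operatorname{Im}\sum_a\bar x_ay_a$ with $V_1=\mathbb H^{m-1}$, $V_2=\operatorname{Im}\mathbb H$, resp. $\kappa(x,y)=\operatorname{Im}(\bar xy)$ with $V_1=\mathbb O$, $V_2=\operatorname{Im}\mathbb O$. $G_0\subset L$ is the stabiliser of $\kappa$: $\mathbb R_+^*Sp(1)Sp(m-1)$, resp. $\mathbb R_+^*Spin(7)$. Levi bracket: $\mathcal L(Y_1,Y_2)=[Y_1,Y_2]\bmod\mathcal D$ for sections $Y_1,Y_2$ of $\mathcal D$; it is a section of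 $\Lambda^2\mathcal D^*\otimes(TX/\mathcal D)$. A point of $E_x$ is a pair of isomorphisms $V_1\cong\mathcal D_x$, $V_2\cong T_xX/\mathcal D_x$, and $f_{\mathcal L}$ reads $\mathcal L_x$ in these frames. Brackets of quaternionic- (octonionic-)contact type: $\mathcal K_x\in\Lambda^2\mathcal D_x^*\otimes(T_xX/\mathcal D_x)$ is of this type if it is equal to $\kappa$ in some pair of frames in $E_x$. Transporting the standard inner products of $V_2$ and $V_1$ by such frames gives a pair of metrics $(\eta,\gamma)$ on $T_xX/\mathcal D_x$ and $\mathcal D_x$, determined by $\mathcal K_x$ up to $(\eta,\gamma)\mapsto(f^2\eta,f\gamma)$, $f>0$. Operators $\partial^*$: with $(\eta,\gamma)$ defined by $\mathcal K$, for sections $\mathcal M,\mathcal N$ of $\Lambda^2\mathcal D^*\otimes(TX/\mathcal D)$ set $\partial^*_{\mathcal N}\mathcal M=\alpha_{\mathcal N}\mathcal M\oplus\beta_{\mathcal N}\mathcal M\in\operatorname{End}(\mathcal D)\oplus\operatorname{End}(TX/\mathcal D)$, where, with summation over repeated indices, $$(\alpha_{\mathcal N}\mathcal M)^r_q=\gamma^{jr}\gamma^{ip}\eta_{ko}\,\mathcal M_{ij}^k\mathcal N_{pq}^o,\qquad(\beta_{\mathcal N}\mathcal M)_r^k=-\tfrac12\,\eta_{or}\gamma^{ip}\gamma^{jq}\,\mathcal M_{ij}^k\mathcal N_{pq}^o .$$ These are invariant under $(\eta,\gamma)\mapsto(f^2\eta,f\gamma)$. Compatibility: $\mathcal K$ is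 compatible with $\mathcal L$ if (1) $\mathcal K$ is of quaternionic-contact (resp. octonionic-contact) type; (2) $\partial^*_{\mathcal K}\mathcal K=\partial^*_{\mathcal L}\mathcal L$; (3) $\partial^*_{\mathcal K}\mathcal L$ is symmetric, i.e. $\alpha_{\mathcal K}\mathcal L$ is $\gamma$-symmetric and $\beta_{\mathcal K}\mathcal L$ is $\eta$-symmetric; all operators being formed with the $(\eta,\gamma)$ of $\mathcal K$. ''Locally unique'' means that $\mathcal K_x$ is the only compatible bracket in some neighbourhood of $\mathcal K_x$ in $\Lambda^2\mathcal D_x^*\otimes(T_xX/\mathcal D_x)$; ''continuously defined'' means that $\mathcal K_x$ depends continuously on $x$. *)

(* Defs.v *)
From HB Require Import structures.
From mathcomp Require Import all_boot all_order all_algebra.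
From mathcomp Require Import sesquilinear.
From mathcomp Require Import all_classical all_reals all_analysis.

Set Implicit Arguments.
Unset Strict Implicit.
Unset Printing Implicit Defensive.

Import Order.TTheory GRing.Theory Num.Theory.
Import numFieldNormedType.Exports.

Local Open Scope classical_set_scope.
Local Open Scope ring_scope.

(** ** Smooth manifolds *)

Fixpoint Ck_on (R : realType) (m n : nat) (k : nat) (A : set 'rV[R]_m)
    (f : 'rV[R]_m -> 'rV[R]_n) : Prop :=
  match k with
  | 0 => forall x, A x -> {for x, continuous f}
  | k'.+1 => (forall x, A x -> differentiable f x) /\
             (forall v, Ck_on k' A ('D_v f))
  end.

(* C^oo on A; only meaningful for open A. *)
Definition smooth_on (R : realType) (m n : nat) (A : set 'rV[R]_m)
    (f : 'rV[R]_m -> 'rV[R]_n) : Prop := forall k, Ck_on k A f.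

(* [mf_psi i] is the inverse of the chart [mf_phi i : mf_dom i -> R^n]; both
   maps are total, with irrelevant values outside their domains.
   [mf_at x] is a preferred chart around x, used to coordinatise T_x X. *)
Record manifold (R : realType) (n : nat) := Manifold {
  mf_carrier :> topologicalType;
  mf_index : Type;
  mf_dom : mf_index -> set mf_carrier;
  mf_phi : mf_index -> mf_carrier -> 'rV[R]_n;
  mf_psi : mf_index -> 'rV[R]_n -> mf_carrier;
  mf_at : mf_carrier -> mf_index;
  mf_hausdorff : hausdorff_space mf_carrier;
  mf_second_countable : @second_countable mf_carrier;
  mf_dom_open : forall i, open (mf_dom i);
  mf_img_open : forall i, open (mf_phi i @` mf_dom i);
  mf_phiK : forall i x, mf_dom i x -> mf_psi i (mf_phi i x) = x;
  mf_phi_cont : forall i x, mf_dom i x -> {for x, continuous (mf_phi i)};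
  mf_psi_cont : forall i x, mf_dom i x ->
    {for mf_phi i x, continuous (mf_psi i)};
  mf_atP : forall x, mf_dom (mf_at x) x;
  mf_smooth : forall i j,
    smooth_on (mf_phi i @` (mf_dom i `&` mf_dom j)) (mf_phi j \o mf_psi i)
}.

Section Manifold.
Variables (R : realType) (n : nat) (X : manifold R n).

(* A tangent vector at x is represented by its coordinates in the preferred
   chart at x, so T_x X is R^n for every x, and vectors at distinct points can
   only be compared after the change of charts [tchange]. *)
Definition tangent (x : X) : vectType R := 'rV[R]_n.

(* Converts at x the coordinates in chart i to those in chart j. *)
Definition tchange (i j : mf_index X) (x : X) (v : 'rV[R]_n) : 'rV[R]_n :=
  'd (mf_phi j \o mf_psi i) (mf_phi i x) v.

Definition vfield := forall x : X, tangent x.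

(* The expression of Y in chart i, as a map on the image of the chart. *)
Definition vf_coord (i : mf_index X) (Y : vfield) : 'rV[R]_n -> 'rV[R]_n :=
  fun u => let x := mf_psi i u in tchange (mf_at x) i x (Y x).

Definition smooth_vf (A : set X) (Y : vfield) : Prop :=
  forall i, smooth_on (mf_phi i @` (A `&` mf_dom i)) (vf_coord i Y).

Definition lie_bracket (Y Z : vfield) : vfield := fun x =>
  let i := mf_at x in let u := mf_phi i x in
  'd (vf_coord i Z) u (vf_coord i Y u) - 'd (vf_coord i Y) u (vf_coord i Z u).

Definition tangent_subspaces := forall x : X, {vspace (tangent x)}.

Definition is_distribution (p : nat) (D : tangent_subspaces) : Prop :=
  (forall x, \dim (D x) = p) /\
  (forall x0, exists2 A : set X, open_nbhs x0 A &
     exists Y : 'I_p -> vfield, (forall i, smooth_vf A (Y i)) /\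
       forall x, A x -> D x = <<[seq Y i x | i : 'I_p]>>%VS).

Definition vf_section (A : set X) (D : tangent_subspaces) (Y : vfield) : Prop :=
  smooth_vf A Y /\ forall x, A x -> Y x \in D x.

End Manifold.

(** ** Quotient spaces *)

(* V / U, realised on the supplement U^C: [qproj] is the canonical projection,
   being linear and onto with kernel U (see the three facts that follow). *)
Definition quotv (R : realType) (V : vectType R) (U : {vspace V}) :
  vectType R := subvs_of (U^C)%VS.

Definition qproj (R : realType) (V : vectType R) (U : {vspace V}) (v : V) :
  quotv U := vsproj (U^C)%VS (v - projv U v).

Lemma qproj_linear (R : realType) (V : vectType R) (U : {vspace V}) :
  linear (qproj U).
Proof. by move=> a u v; rewrite /qproj linearP opprD addrACA -scalerBr linearP. Qed.

Lemma qproj_eq0 (R : realType) (V : vectType R) (U : {vspace V}) (v : V) :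
  (qproj U v == 0) = (v \in U).
Proof.
apply/eqP/idP => [/(congr1 vsval)|vU]; last by rewrite /qproj projv_id ?subrr ?linear0.
rewrite vsprojK ?memv_projC // => /eqP; rewrite linear0 subr_eq0 => /eqP ->.
exact: memv_proj.
Qed.

Lemma qproj_surj (R : realType) (V : vectType R) (U : {vspace V}) (w : quotv U) :
  exists v, qproj U v = w.
Proof.
exists (vsval w); rewrite /qproj (_ : projv U _ = 0) ?subr0 ?vsvalK //.
by apply/eqP; rewrite -memv_ker lker_proj; apply: subvsP.
Qed.

(** ** Algebraic brackets and frames *)

Record alt_bracket (R : realType) (A B : vectType R) := AltBracket {
  br_fun :> {bilinear A -> A -> B};
  br_alt : forall u, br_fun u u = 0
}.

(* The structure constants M^k_ij of a bilinear map R^p x R^p -> R^q; row k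
   holds the p x p matrix of the k-th component. *)
Definition sconst (R : realType) (p q : nat) := 'M[R]_(q, p * p).

Section StructureConstants.
Variables (R : realType) (p q : nat).
Implicit Types M N : sconst R p q.

Definition sc (M : sconst R p q) (k : 'I_q) (i j : 'I_p) : R :=
  vec_mx (row k M) i j.

Definition mk_sc (c : 'I_q -> 'I_p -> 'I_p -> R) : sconst R p q :=
  \matrix_(k < q) mxvec (\matrix_(i < p, j < p) c k i j).

(* W = Lambda^2 V_1^* (x) V_2 *)
Definition Wspace : set (sconst R p q) :=
  [set M | (forall k i, sc M k i i = 0) /\
           (forall k i j, sc M k i j = - sc M k j i)].

Definition open_in_W (U : set (sconst R p q)) : Prop :=
  exists2 O : set (sconst R p q), open O & U = O `&` Wspace.

(* g and h are the components gamma_ij and eta_ko; the upper indices are those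
   of the inverse matrices. *)
Definition alphaop (g : 'M[R]_p) (h : 'M[R]_q) N M : 'M[R]_p :=
  \matrix_(r, c) \sum_(i < p) \sum_(j < p) \sum_(s < p) \sum_(k < q) \sum_(o < q)
     invmx g j r * invmx g i s * h k o * sc M k i j * sc N o s c.

Definition betaop (g : 'M[R]_p) (h : 'M[R]_q) N M : 'M[R]_q :=
  \matrix_(k, r) (- 2^-1 *
   \sum_(i < p) \sum_(j < p) \sum_(s < p) \sum_(c < p) \sum_(o < q)
     h o r * invmx g i s * invmx g j c * sc M k i j * sc N o s c).

Definition delstar g h N M : 'M[R]_p * 'M[R]_q :=
  (alphaop g h N M, betaop g h N M).

End StructureConstants.

(* The endomorphism with entries a r c (upper index r, lower index c) is
   symmetric for the metric g. *)
Definition metric_symmetric (R : realType) (n : nat) (g a : 'M[R]_n) : Prop :=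
  (g *m a)^T = g *m a.

(* A pair of isomorphisms R^p = A, R^q = B, given by the images of the
   standard bases. *)
Definition frame (R : realType) (p q : nat) (A B : vectType R) :=
  (p.-tuple A * q.-tuple B)%type.

Section Frames.
Variables (R : realType) (p q : nat) (A B : vectType R).
Implicit Types e : frame p q A B.

Definition is_frame e : Prop := basis_of fullv e.1 /\ basis_of fullv e.2.

Definition read_bracket e (K : A -> A -> B) : sconst R p q :=
  mk_sc (fun k i j => coord e.2 k (K (tnth e.1 i) (tnth e.1 j))).

End Frames.

(* The inner product for which the basis y is orthonormal (i.e. the standard
   inner product transported by y), and its components in a basis z. *)
Definition transported_metric (R : realType) (n : nat) (V : vectType R)
    (y : n.-tuple V) (u v : V) : R :=
  \sum_(i < n) coord y i u * coord y i v.

Definition gram (R : realType) (n : nat) (V : vectType R)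
    (y z : n.-tuple V) : 'M[R]_n :=
  \matrix_(i, j) transported_metric y (tnth z i) (tnth z j).

(** ** The standard brackets *)

(* Iterated Cayley-Dickson doubling of R: levels 2 and 3 are the quaternions
   and the octonions. *)
Fixpoint cd (R : realType) (d : nat) : zmodType :=
  if d is d'.+1 then (cd R d' * cd R d')%type : zmodType else R.

Fixpoint cdconj (R : realType) (d : nat) : cd R d -> cd R d :=
  match d return cd R d -> cd R d with
  | 0 => id
  | d'.+1 => fun x => (cdconj x.1, - x.2)
  end.

(* (a, b) (c, e) = (a c - e^* b, e a + b c^* ) *)
Fixpoint cdmul (R : realType) (d : nat) : cd R d -> cd R d -> cd R d :=
  match d return cd R d -> cd R d -> cd R d with
  | 0 => fun x y => (x : R) * (y : R)
  | d'.+1 => fun x y =>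
      (cdmul x.1 y.1 - cdmul (cdconj y.2) x.2,
       cdmul y.2 x.1 + cdmul x.2 (cdconj y.1))
  end.

(* Real coordinates, numbered from 0 to 2 ^ d - 1; number 0 is the real part. *)
Fixpoint cdvec (R : realType) (d : nat) (f : nat -> R) : cd R d :=
  match d return cd R d with
  | 0 => f 0%N
  | d'.+1 => (cdvec d' f, cdvec d' (fun s => f (2 ^ d' + s)%N))
  end.

Fixpoint cdcoord (R : realType) (d : nat) : cd R d -> nat -> R :=
  match d return cd R d -> nat -> R with
  | 0 => fun x _ => x
  | d'.+1 => fun x s =>
      if (s < 2 ^ d')%N then cdcoord x.1 s else cdcoord x.2 (s - 2 ^ d')%N
  end.

(* [quaternionic m] has V_1 = H^(m-1); the intended range is 2 <= m. *)
Variant contact_type := quaternionic of nat | octonionic.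

Definition admissible (t : contact_type) : Prop :=
  if t is quaternionic m then (2 <= m)%N else True.

Definition rank_of (t : contact_type) : nat :=
  if t is quaternionic m then (4 * m - 4)%N else 8%N.

Definition corank_of (t : contact_type) : nat :=
  if t is quaternionic _ then 3%N else 7%N.

Definition cd_level (t : contact_type) : nat :=
  if t is quaternionic _ then 2%N else 3%N.

Definition cd_blocks (t : contact_type) : nat :=
  if t is quaternionic m then (m - 1)%N else 1%N.

Section StandardBracket.
Variables (R : realType) (t : contact_type).
Let p := rank_of t.
Let q := corank_of t.

(* The a-th component of x in V_1 = H^(m-1) or O. *)
Definition cd_block (x : 'rV[R]_p) (a : nat) : cd R (cd_level t) :=
  cdvec (cd_level t)
    (fun s => oapp (x ord0) 0 (insub (a * 2 ^ cd_level t + s)%N)).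

(* Im (sum_a conj(x_a) y_a); coordinate k of the imaginary part is coordinate
   k + 1 of the algebra. *)
Definition std_bracket (x y : 'rV[R]_p) : 'rV[R]_q :=
  \row_(k < q)
    cdcoord (\sum_(a < cd_blocks t)
               cdmul (cdconj (cd_block x a)) (cd_block y a)) k.+1.

Definition kappa : sconst R p q :=
  mk_sc (fun k i j => std_bracket (delta_mx 0 i) (delta_mx 0 j) 0 k).

End StandardBracket.

(** ** Compatibility *)

Section Compatibility.
Variables (R : realType) (t : contact_type) (A B : vectType R).
Let p := rank_of t.
Let q := corank_of t.

(* The frame e exhibits K as being of quaternionic- or octonionic-contact type
   and defines the metrics (eta, gamma) of K; the index formulas for the
   operators are evaluated in an arbitrary frame e'. *)
Definition compatible (K L : A -> A -> B) : Prop :=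
  exists e : frame p q A B,
    [/\ is_frame e, read_bracket e K = kappa R t &
     forall e' : frame p q A B, is_frame e' ->
       let g := gram e.1 e'.1 in
       let h := gram e.2 e'.2 in
       let k := read_bracket e' K in
       let l := read_bracket e' L in
       [/\ delstar g h k k = delstar g h l l,
           metric_symmetric g (delstar g h k l).1 &
           metric_symmetric h (delstar g h k l).2]].

(* K is the only compatible bracket near K. The topology of the space of
   brackets is read in a frame; it does not depend on the frame. *)
Definition locally_unique (K : alt_bracket A B) (L : A -> A -> B) : Prop :=
  forall e : frame p q A B, is_frame e ->
    \forall w \near read_bracket e K,
      forall K' : alt_bracket A B, read_bracket e K' = w ->
        compatible K' L -> forall u v, K' u v = K u v.

End Compatibility.

(** ** The Levi bracket and frames of a distribution *)

Section Levi.
Variables (R : realType) (n : nat) (X : manifold R n) (D : tangent_subspaces X).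

Definition Dspace (x : X) : vectType R := subvs_of (D x).
Definition TDspace (x : X) : vectType R := quotv (D x).

(* [Y, Z]_x mod D_x for any local sections Y, Z of D with values u, v at x: by
   tensoriality, the set below is a singleton when D is a distribution. *)
Definition levi (x : X) (u v : Dspace x) : TDspace x :=
  xget 0 [set w | exists A Y Z,
    [/\ open_nbhs x A, vf_section A D Y /\ vf_section A D Z,
        Y x = vsval u /\ Z x = vsval v & w = qproj (D x) (lie_bracket Y Z x)]].

Variables p q : nat.

(* The bundle E, and its smooth sections over A. *)
Definition frame_at (x : X) := frame p q (Dspace x) (TDspace x).

Definition smooth_frame (A : set X) (e : forall x, frame_at x) : Prop :=
  [/\ forall x, A x -> is_frame (e x),
      forall i, smooth_vf A (fun x => vsval (tnth (e x).1 i)) &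
      forall k, exists2 Z : vfield X, smooth_vf A Z &
        forall x, A x -> qproj (D x) (Z x) = tnth (e x).2 k].

(* The points x such that f_L(E_x) meets U. *)
Definition levi_locus (U : set (sconst R p q)) : set X :=
  [set x | exists2 e : frame_at x, is_frame e & U (read_bracket e (@levi x))].

(* Continuity on S of a field of brackets, read in local smooth frames. *)
Definition continuous_bracket (S : set X)
    (K : forall x, alt_bracket (Dspace x) (TDspace x)) : Prop :=
  forall (A : set X) (e : forall x, frame_at x), open A -> smooth_frame A e ->
    {within A `&` S, continuous (fun x => read_bracket (e x) (K x))}.

End Levi.

Arguments levi {R n X} D x u v.

(* Main.v *)
(* In frames a bracket is a tensor M acted on by GL(V_1) x GL(V_2), and K is compatible
   with L if and only if some frame reads K as kappa and L as a tensor M that is balanced,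
   i.e. del^*_M M = del^*_kappa kappa, and such that del^*_kappa M is symmetric.

   Balanced tensors are minimal vectors in the sense of Kempf and Ness. The components of
   kappa form a Clifford system with scalar product J_1 ... J_q, so the only symmetric
   elements of the infinitesimal stabiliser of a tensor near kappa are multiples of the
   grading element: hence an orbit through a tensor near kappa contains a balanced tensor
   near kappa, and it is unique up to homotheties and O(V_1) x O(V_2). The symmetry of
   del^*_kappa M says that M is critical for the inner product with kappa along its
   O(V_1) x O(V_2)-orbit: such an M exists by compactness, and two nearby Clifford systems
   for which the same M is critical are equal. Continuity of the choice follows from its
   uniqueness, as nearly orthogonal changes of frame form a compact set.

   For the Levi bracket it remains to see that it is tensorial and that its components in
   smooth frames are continuous; the latter compares the Lie brackets computed in the
   preferred charts of distinct points, by the symmetry of second derivatives. *)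

From HB Require Import structures.
Require Import Defs.
From mathcomp Require Import all_boot all_order all_algebra.
From mathcomp Require Import all_classical all_reals all_analysis.
From mathcomp Require Import ring lra.

Set Implicit Arguments.
Unset Strict Implicit.
Unset Printing Implicit Defensive.

Import Order.TTheory GRing.Theory Num.Theory.
Import numFieldNormedType.Exports.

Local Open Scope classical_set_scope.
Local Open Scope ring_scope.

(** No slice or inverse function theorem is used: existence and continuity come from tube arguments
    over compact sets. The linear groups are not compact; they are replaced by the set [near_orth]
    of nearly orthogonal pairs, compact and stable under O(V_1) x O(V_2). On it one minimises
    [defect], the square norm of the moment map. If P is the value of the moment map at an interior
    minimum M, then rho(P) M = 0, since moving along -P would otherwise decrease the defect;
    rigidity makes P a multiple of the grading element, and P = 0 because its two components have
    equal traces. The homotheties (a, a^-2) fix every tensor; a penalty on the trace of A A^T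
    removes this freedom.

    No global uniqueness is claimed: K_x is singled out by |L - kappa| <= eps / 2 in a frame that
    reads K_x as kappa. Such a bracket is unique, and the condition is closed, hence passes to
    limits. Local uniqueness is a different matter, as a compatible bracket near K_x comes with a
    frame in which L is not known to be close to kappa; hence the two alternative hypotheses of
    [compat_unique]. *)

Section MatrixLimits.
Variables (R : realType).

(** * Limits, norms and compactness for matrices *)

Lemma cvg_mx T (F : set_system T) {FF : Filter F} m n
    (f : T -> 'M[R]_(m, n)) (a : 'M[R]_(m, n)) :
  (forall i j, f x i j @[x --> F] --> a i j) -> f @ F --> a.
Proof.
move=> h; apply/cvgrPdist_lt => e e0.
have : \forall x \near F, forall ij : 'I_m * 'I_n, `|a ij.1 ij.2 - f x ij.1 ij.2| < e.
  apply: filter_forall => -[i j].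
  by have /cvgrPdist_lt/(_ e e0) := h i j.
apply: filterS => x hx.
rewrite /Num.Def.normr /= mx_normrE; apply/bigmax_ltP; split => // -[i j] _.
by have := hx (i, j); rewrite !mxE.
Qed.

Lemma cvg_mxE T (F : set_system T) {FF : Filter F} m n
    (f : T -> 'M[R]_(m, n)) (a : 'M[R]_(m, n)) i j :
  f @ F --> a -> f x i j @[x --> F] --> a i j.
Proof.
move=> h; have /= := @cvg_comp _ _ _ f (fun M : 'M[R]_(m, n) => M i j) F (nbhs a) (nbhs (a i j)) h.
by apply; exact: coord_continuous.
Qed.

Lemma cvg_bigsum (T I : Type) (V : normedModType R) (F : set_system T) {FF : Filter F}
    (r : seq I) (P : pred I) (f : I -> T -> V) (a : I -> V) :
  (forall i, P i -> f i @ F --> a i) ->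
  (\sum_(i <- r | P i) f i x) @[x --> F] --> \sum_(i <- r | P i) a i.
Proof.
move=> h; elim: r => [|i r IH].
  by rewrite big_nil (_ : (fun _ => _) = cst 0); [exact: cvg_cst|
    apply/funext => x; rewrite big_nil].
have -> : (fun x => \sum_(j <- i :: r | P j) f j x) =
  (fun x => if P i then f i x + \sum_(j <- r | P j) f j x
            else \sum_(j <- r | P j) f j x).
  by apply/funext => x; rewrite big_cons.
rewrite big_cons; case: ifP => Pi //.
exact: (@cvgD _ _ _ _ FF _ _ _ _ (h i Pi) IH).
Qed.

Lemma cvg_bigprod (T I : Type) (F : set_system T) {FF : Filter F}
    (r : seq I) (P : pred I) (f : I -> T -> R) (a : I -> R) :
  (forall i, P i -> f i @ F --> a i) ->
  (\prod_(i <- r | P i) f i x) @[x --> F] --> \prod_(i <- r | P i) a i.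
Proof.
move=> h; elim: r => [|i r IH].
  by rewrite big_nil (_ : (fun _ => _) = cst 1); [exact: cvg_cst|
    apply/funext => x; rewrite big_nil].
have -> : (fun x => \prod_(j <- i :: r | P j) f j x) =
  (fun x => if P i then f i x * \prod_(j <- r | P j) f j x
            else \prod_(j <- r | P j) f j x).
  by apply/funext => x; rewrite big_cons.
rewrite big_cons; case: ifP => Pi //.
exact: (@cvgM _ _ _ FF _ _ _ _ (h i Pi) IH).
Qed.

Lemma cvg_mulmx T (F : set_system T) {FF : Filter F} m n k
    (f : T -> 'M[R]_(m, n)) (g : T -> 'M[R]_(n, k)) (a : 'M[R]_(m, n))
    (b : 'M[R]_(n, k)) :
  f @ F --> a -> g @ F --> b -> f x *m g x @[x --> F] --> a *m b.
Proof.
move=> fa gb; apply: cvg_mx => i j.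
under eq_fun do rewrite mxE.
rewrite mxE; apply: cvg_bigsum => l _.
by apply: cvgM; apply: cvg_mxE.
Qed.

Lemma cvg_trmx T (F : set_system T) {FF : Filter F} m n
    (f : T -> 'M[R]_(m, n)) (a : 'M[R]_(m, n)) :
  f @ F --> a -> (f x)^T @[x --> F] --> a^T.
Proof.
move=> fa; apply: cvg_mx => i j.
under eq_fun do rewrite mxE.
by rewrite mxE; apply: cvg_mxE.
Qed.

Lemma cvg_mxtrace T (F : set_system T) {FF : Filter F} n
    (f : T -> 'M[R]_n) (a : 'M[R]_n) :
  f @ F --> a -> \tr (f x) @[x --> F] --> \tr a.
Proof. by move=> fa; apply: cvg_bigsum => i _; apply: cvg_mxE. Qed.

Lemma cvg_det T (F : set_system T) {FF : Filter F} n
    (f : T -> 'M[R]_n) (a : 'M[R]_n) :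
  f @ F --> a -> \det (f x) @[x --> F] --> \det a.
Proof.
move=> fa; apply: cvg_bigsum => s _; apply: cvgM; first exact: cvg_cst.
by apply: cvg_bigprod => i _; apply: cvg_mxE.
Qed.

Lemma cvg_invmx T (F : set_system T) {FF : Filter F} n
    (f : T -> 'M[R]_n) (a : 'M[R]_n) :
  a \in unitmx -> f @ F --> a -> invmx (f x) @[x --> F] --> invmx a.
Proof.
move=> ua fa; have da : \det a != 0 by rewrite unitmxE unitfE in ua.
have hd : \det (f x) @[x --> F] --> \det a by exact: cvg_det fa.
have nz : \forall x \near F, \det (f x) != 0.
  exact: cvgr_neq0 hd da.
have h : (\det (f x))^-1 *: \adj (f x) @[x --> F] --> invmx a.
  rewrite /invmx ua; apply: cvg_mx => i j.
  under eq_fun do rewrite !mxE.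
  rewrite !mxE; apply: cvgM; first exact: cvgV.
  apply: cvgM; first exact: cvg_cst.
  apply: cvg_det; apply: cvg_mx => k l.
  under eq_fun do rewrite !mxE.
  by rewrite !mxE; apply: cvg_mxE.
apply: cvg_trans h; apply: near_eq_cvg; apply: filterS nz => x hx.
by rewrite /invmx unitmxE unitfE hx.
Qed.

Lemma compact_mx_box m n (c : R) :
  compact [set M : 'M[R]_(m, n) | forall i j, `|M i j| <= c].
Proof.
have hc : compact [set v : 'rV[R]_(m * n) | forall i, v ord0 i \in `[(- c), c]].
  apply: (@rV_compact _ _ (fun=> `[(- c), c]%classic)) => _.
  exact: segment_compact.
have -> : [set M : 'M[R]_(m, n) | forall i j, `|M i j| <= c] =
  vec_mx @` [set v : 'rV[R]_(m * n) | forall i, v ord0 i \in `[(- c), c]].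
  apply/seteqP; split => [M /= hM|M /= [v hv <-] i j].
    exists (mxvec M); last by rewrite mxvecK.
    move=> k /=; case/mxvec_indexP: k => i j.
    by rewrite mxvecE in_itv /= -ler_norml.
  by rewrite mxE ler_norml; have := hv (mxvec_index i j); rewrite in_itv /=.
apply: continuous_compact hc; apply: continuous_subspaceT => v.
apply: (@cvg_mx _ (nbhs v) (nbhs_filter v)) => i j; under eq_fun do rewrite mxE.
by rewrite mxE; apply: coord_continuous.
Qed.

Lemma norm_mx_le m n (M : 'M[R]_(m, n)) (c : R) : 0 <= c ->
  (`|M| <= c) <-> (forall i j, `|M i j| <= c).
Proof.
move=> c0; have -> : `|M| = \big[Num.max/0]_ij `|M ij.1 ij.2| by exact: mx_normrE.
split.
  by move=> /bigmax_leP[_ h] i j; exact: (h (i, j)).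
by move=> h; apply/bigmax_leP; split => // -[i j].
Qed.

Lemma norm_mx_ge m n (M : 'M[R]_(m, n)) i j : `|M i j| <= `|M|.
Proof. exact: ((norm_mx_le M (normr_ge0 M)).1 (lexx _)). Qed.

Lemma norm_mulmx m n k (A : 'M[R]_(m, n)) (B : 'M[R]_(n, k)) :
  `|A *m B| <= n%:R * `|A| * `|B|.
Proof.
apply/norm_mx_le; first by rewrite !mulr_ge0.
move=> i j; rewrite mxE; apply: le_trans (ler_norm_sum _ _ _) _.
rewrite -mulrA mulrC -[n in n%:R]card_ord -sumr_const mulr_sumr.
apply: ler_sum => l _; rewrite mulr1 normrM.
by apply: ler_pM => //; apply: norm_mx_ge.
Qed.

Lemma norm_trmx m n (A : 'M[R]_(m, n)) : `|A^T| = `|A|.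
Proof.
apply/eqP; rewrite eq_le; apply/andP; split; apply/norm_mx_le => // i j.
  by rewrite mxE; apply: norm_mx_ge.
by have := norm_mx_ge A^T j i; rewrite mxE.
Qed.

Lemma norm_mxtrace n (A : 'M[R]_n) : `|\tr A| <= n%:R * `|A|.
Proof.
apply: le_trans (ler_norm_sum _ _ _) _.
rewrite mulrC -[n in n%:R]card_ord -sumr_const mulr_sumr.
by apply: ler_sum => i _; rewrite mulr1; apply: norm_mx_ge.
Qed.

Lemma mxtrace_tr_mul m n (A B : 'M[R]_(m, n)) :
  \tr (A^T *m B) = \sum_i \sum_j A i j * B i j.
Proof.
rewrite /mxtrace exchange_big /=; apply: eq_bigr => j _; rewrite mxE.
by apply: eq_bigr => i _; rewrite mxE.
Qed.

Lemma mxtrace_sqr_ge0 m n (A : 'M[R]_(m, n)) : 0 <= \tr (A^T *m A).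
Proof.
rewrite mxtrace_tr_mul; apply: sumr_ge0 => i _; apply: sumr_ge0 => j _.
by rewrite -expr2 sqr_ge0.
Qed.

Lemma mxtrace_sqr_eq0 m n (A : 'M[R]_(m, n)) : \tr (A^T *m A) <= 0 -> A = 0.
Proof.
rewrite mxtrace_tr_mul => h; apply/matrixP => i j; rewrite mxE.
have h0 i' : 0 <= \sum_j' A i' j' * A i' j'.
  by apply: sumr_ge0 => j' _; rewrite -expr2 sqr_ge0.
have /eqP : \sum_i \sum_j A i j * A i j = 0.
  by apply/eqP; rewrite eq_le h sumr_ge0.
rewrite psumr_eq0 // => /allP /(_ i); rewrite mem_index_enum => /(_ isT) /=.
rewrite psumr_eq0; last by move=> j' _; rewrite -expr2 sqr_ge0.
move=> /allP /(_ j); rewrite mem_index_enum => /(_ isT) /=.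
by rewrite mulf_eq0 orbb => /eqP.
Qed.

End MatrixLimits.

(** * First-order expansions *)

Section Jets.
Variables (R : realType).

(** A derivative at 0 with an explicit quadratic remainder: this is stable under sums and products,
    so first variations of polynomial expressions in matrices need no differentiability proofs. *)
Definition jet (f : R -> R) (a b : R) : Prop :=
  exists C, forall t, `|t| <= 1 -> `|f t - a - t * b| <= C * t ^+ 2.

Lemma jet_cst a : jet (fun=> a) a 0.
Proof. by exists 0 => t _; rewrite mulr0 subr0 subrr normr0 mul0r. Qed.

Lemma jet_id : jet id 0 1.
Proof. by exists 0 => t _; rewrite mulr1 subr0 subrr normr0 mul0r. Qed.

Lemma jet_ext f g a b : f =1 g -> jet f a b -> jet g a b.
Proof. by move=> /funext ->. Qed.

Lemma jetD f g a b c d : jet f a b -> jet g c d ->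
  jet (fun t => f t + g t) (a + c) (b + d).
Proof.
move=> [C hC] [D hD]; exists (C + D) => t t1.
have -> : f t + g t - (a + c) - t * (b + d) =
  (f t - a - t * b) + (g t - c - t * d) by ring.
by apply: le_trans (ler_normD _ _) _; rewrite mulrDl lerD ?hC ?hD.
Qed.

Lemma jetM f g a b c d : jet f a b -> jet g c d ->
  jet (fun t => f t * g t) (a * c) (a * d + b * c).
Proof.
move=> [C hC] [D hD].
exists (C * (`|c| + `|d| + D) + (`|a| + `|b|) * D + `|b * d|) => t t1.
set x := f t - a - t * b; set y := g t - c - t * d.
have -> : f t * g t - a * c - t * (a * d + b * c) =
  x * (c + t * d + y) + (a + t * b) * y + (b * d) * t ^+ 2.
  by rewrite /x /y; ring.
have D0 : 0 <= D.
  have := hD 1; rewrite normr1 => /(_ (lexx _)) /(le_trans (normr_ge0 _)).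
  by rewrite expr1n mulr1.
have t2 : t ^+ 2 <= 1 by rewrite -real_normK ?num_real // expr_le1.
have hx : `|x| <= C * t ^+ 2 by exact: hC.
have hy : `|y| <= D * t ^+ 2 by exact: hD.
have hy1 : `|y| <= D by apply: le_trans hy _; rewrite ler_piMr.
have C0 : 0 <= C * t ^+ 2 by apply: le_trans hx.
have h u v : `|u + t * v| <= `|u| + `|v|.
  by apply: le_trans (ler_normD _ _) _; rewrite lerD2l normrM ler_piMl.
apply: le_trans (ler_normD _ _) _; rewrite [leRHS]mulrDl lerD //; last first.
  by rewrite normrM (ger0_norm (sqr_ge0 t)).
apply: le_trans (ler_normD _ _) _; rewrite [leRHS]mulrDl lerD // normrM.
  rewrite mulrAC; apply: ler_pM => //.
  by apply: le_trans (ler_normD _ _) _; rewrite lerD ?h.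
by rewrite -mulrA; apply: ler_pM.
Qed.

Lemma jet_sum (I : Type) (r : seq I) (P : pred I) (f : I -> R -> R) a b :
  (forall i, P i -> jet (f i) (a i) (b i)) ->
  jet (fun t => \sum_(i <- r | P i) f i t)
      (\sum_(i <- r | P i) a i) (\sum_(i <- r | P i) b i).
Proof.
move=> h; elim: r => [|i r IH].
  by rewrite !big_nil; apply: jet_ext (jet_cst 0) => t; rewrite big_nil.
rewrite !big_cons; case: ifP => Pi.
  by apply: jet_ext (jetD (h i Pi) IH) => t; rewrite big_cons Pi.
by apply: jet_ext IH => t; rewrite big_cons Pi.
Qed.

Lemma jet_cvg f a b : jet f a b -> f t @[t --> (0 : R)] --> a.
Proof.
move=> [C hC]; apply/cvgrPdist_le => e e0.
pose K : R := `|C| + `|b| + 1.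
have K0 : 0 < K by rewrite ltr_wpDl // addr_ge0.
have n1 : \forall t \near (0 : R), `|t| <= 1 by exact: nbhs0_le.
have n2 : \forall t \near (0 : R), `|t| <= e / K.
  by apply: nbhs0_le; rewrite divr_gt0.
apply: filterS2 n1 n2 => t t1 te.
rewrite distrC; have -> : f t - a = (f t - a - t * b) + t * b by ring.
apply: le_trans (ler_normD _ _) _.
apply: (@le_trans _ _ (K * `|t|)); last by rewrite mulrC -ler_pdivlMr.
have h1 : `|t * b| = `|b| * `|t| by rewrite normrM mulrC.
have h2 : C * t ^+ 2 <= `|C| * `|t|.
  rewrite -real_normK ?num_real // expr2 mulrA ler_wpM2r //.
  apply: (@le_trans _ _ (`|C| * `|t|)); first by rewrite ler_wpM2r // ler_norm.
  by rewrite ler_piMr.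
have := hC _ t1; rewrite h1 /K; have := normr_ge0 t; lra.
Qed.

Lemma jetN f a b : jet f a b -> jet (fun t => - f t) (- a) (- b).
Proof.
move=> [C hC]; exists C => t t1.
by have := hC t t1; rewrite -normrN; congr (`|_| <= _); ring.
Qed.

Lemma jet_decr f a b (d : R) : jet f a b -> b != 0 -> 0 < d ->
  exists2 t, `|t| <= d & f t < a.
Proof.
move=> [C hC] b0 d0.
(* The first two bounds keep the step admissible; the third makes the remainder, at most
   [C * s ^+ 2], smaller than the linear gain [|b| * s]. *)
pose s := Num.min (Num.min d 1) (`|b| / (2 * (`|C| + 1))).
have C1 : 0 < `|C| + 1 by rewrite ltr_wpDl.
have s0 : 0 < s by rewrite !lt_min d0 ltr01 /= divr_gt0 ?normr_gt0 // mulr_gt0.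
have [sd s1] : s <= d /\ s <= 1.
  by split; rewrite /s !ge_min lexx ?orbT.
have sb : (`|C| + 1) * s < `|b|.
  apply: (@le_lt_trans _ _ (`|b| / 2)); last by have := normr_gt0 b; rewrite b0; lra.
  have : s <= `|b| / (2 * (`|C| + 1)) by rewrite /s ge_min lexx orbT.
  by rewrite ler_pdivlMr ?mulr_gt0 // => h; rewrite ler_pdivlMr //; nra.
have ns : `|- (s * Num.sg b)| = s by rewrite normrN normrM normr_sg b0 mulr1 gtr0_norm.
exists (- (s * Num.sg b)); first by rewrite ns.
have := hC (- (s * Num.sg b)); rewrite ns => /(_ s1).
rewrite sqrrN exprMn sqr_sg b0 mulr1 => /(le_trans (ler_norm _)).
have -> : - (s * Num.sg b) * b = - (s * `|b|) by rewrite mulNr -mulrA -normrEsg.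
have : C * s ^+ 2 <= (`|C| + 1) * s * s.
  rewrite expr2 mulrA; do 2![apply: ler_wpM2r; first exact: ltW].
  by apply: le_trans (ler_norm C) _; rewrite lerDl.
have : (`|C| + 1) * s * s < `|b| * s by rewrite ltr_pM2r.
lra.
Qed.

Lemma jet_max f a b (d : R) : jet f a b -> 0 < d ->
  (forall t, `|t| <= d -> f t <= a) -> b = 0.
Proof.
move=> jf d0 h; apply/eqP/negP => /negP b0.
have nb0 : - b != 0 by rewrite oppr_eq0.
have [t td] := jet_decr (jetN jf) nb0 d0.
by rewrite ltrN2 ltNge h.
Qed.

Definition mjet m n (F : R -> 'M[R]_(m, n)) (A B : 'M[R]_(m, n)) : Prop :=
  forall i j, jet (fun t => F t i j) (A i j) (B i j).

Lemma mjet_cst m n (A : 'M[R]_(m, n)) : mjet (fun=> A) A 0.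
Proof. by move=> i j; rewrite mxE; apply: jet_cst. Qed.

Lemma mjetD m n (F G : R -> 'M[R]_(m, n)) A B C D :
  mjet F A B -> mjet G C D -> mjet (fun t => F t + G t) (A + C) (B + D).
Proof.
move=> hF hG i j; rewrite !mxE; apply: jet_ext (jetD (hF i j) (hG i j)) => t.
by rewrite mxE.
Qed.

Lemma mjet_sum m n (I : Type) (r : seq I) (P : pred I)
    (F : I -> R -> 'M[R]_(m, n)) A B :
  (forall i, P i -> mjet (F i) (A i) (B i)) ->
  mjet (fun t => \sum_(i <- r | P i) F i t)
      (\sum_(i <- r | P i) A i) (\sum_(i <- r | P i) B i).
Proof.
move=> h i j; rewrite !summxE.
have := @jet_sum _ r P (fun k t => F k t i j) _ _ (fun k Pk => h k Pk i j).
by apply: jet_ext => t; rewrite summxE.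
Qed.

Lemma mjetM m n k (F : R -> 'M[R]_(m, n)) (G : R -> 'M[R]_(n, k)) A B C D :
  mjet F A B -> mjet G C D ->
  mjet (fun t => F t *m G t) (A *m C) (A *m D + B *m C).
Proof.
move=> hF hG i j; rewrite !mxE -big_split /=.
have := @jet_sum _ (index_enum _) predT (fun l t => F t i l * G t l j) _ _
  (fun l _ => jetM (hF i l) (hG l j)).
by apply: jet_ext => t; rewrite mxE.
Qed.

Lemma mjetZ m n (f : R -> R) (G : R -> 'M[R]_(m, n)) a b C D :
  jet f a b -> mjet G C D ->
  mjet (fun t => f t *: G t) (a *: C) (a *: D + b *: C).
Proof.
move=> hf hG i j; rewrite !mxE.
by apply: jet_ext (jetM hf (hG i j)) => t; rewrite mxE.
Qed.

Lemma mjet_tr m n (F : R -> 'M[R]_(m, n)) A B :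
  mjet F A B -> mjet (fun t => (F t)^T) A^T B^T.
Proof.
by move=> hF i j; rewrite !mxE; apply: jet_ext (hF j i) => t; rewrite mxE.
Qed.

Lemma jet_mxtrace n (F : R -> 'M[R]_n) A B :
  mjet F A B -> jet (fun t => \tr (F t)) (\tr A) (\tr B).
Proof. by move=> hF; apply: jet_sum => i _; apply: hF. Qed.

Lemma mjet_cvg m n (F : R -> 'M[R]_(m, n)) A B :
  mjet F A B -> F t @[t --> (0 : R)] --> A.
Proof. by move=> hF; apply: cvg_mx => i j; apply: jet_cvg (hF i j). Qed.

Lemma mjet_line n (v : 'M[R]_n) : mjet (fun t => 1%:M + t *: v) 1%:M v.
Proof.
have := mjetD (mjet_cst 1%:M) (mjetZ jet_id (mjet_cst v)).
by rewrite add0r scaler0 add0r scale1r scale0r addr0.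
Qed.

Definition orthmx n (O : 'M[R]_n) : Prop := O *m O^T = 1%:M.

Lemma orthmxC n (O : 'M[R]_n) : orthmx O -> O^T *m O = 1%:M.
Proof. exact: mulmx1C. Qed.

Lemma orthmxT n (O : 'M[R]_n) : orthmx O -> orthmx O^T.
Proof. by rewrite /orthmx trmxK; apply: orthmxC. Qed.

Lemma orthmx1 n : orthmx (1%:M : 'M[R]_n).
Proof. by rewrite /orthmx trmx1 mulmx1. Qed.

Lemma orthmxM n (A B : 'M[R]_n) : orthmx A -> orthmx B -> orthmx (A *m B).
Proof.
rewrite /orthmx trmx_mul => hA hB.
by rewrite -mulmxA (mulmxA B) hB mul1mx.
Qed.

Lemma orthmx_unit n (O : 'M[R]_n) : orthmx O -> O \in unitmx.
Proof. by move=> /mulmx1_unit[]. Qed.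

Lemma orthmx_le1 n (O : 'M[R]_n) i j : orthmx O -> `|O i j| <= 1.
Proof.
move=> /matrixP /(_ i i); rewrite !mxE eqxx /= => h.
rewrite -(@expr_le1 _ 2) // real_normK ?num_real //.
rewrite -[leRHS]h (bigD1 j) //= mxE -expr2 lerDl.
by apply: sumr_ge0 => k _; rewrite mxE -expr2 sqr_ge0.
Qed.

Lemma unitmx_inj n (A : 'M[R]_n) :
  (forall v : 'rV_n, v *m A = 0 -> v = 0) -> A \in unitmx.
Proof.
move=> h; rewrite -row_free_unit -kermx_eq0; apply/rowV0P => v /sub_kermxP.
exact: h.
Qed.

(** The Cayley transform of t X / 2 is orthogonal for every t and has velocity X at 0. Being
    rational in t, it avoids the matrix exponential and has an explicit remainder. *)
Lemma cayley n (X : 'M[R]_n) : X^T = - X ->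
  exists2 C : R -> 'M[R]_n, forall t, orthmx (C t) & mjet C 1%:M X.
Proof.
move=> aX; pose Y := 2^-1 *: X.
have aY : Y^T = - Y by rewrite /Y linearZ /= aX scalerN.
(* If v = t v Y, then v v^T = t v Y v^T = 0, because Y is antisymmetric. *)
have u t : 1%:M - t *: Y \in unitmx.
  apply: unitmx_inj => v; rewrite mulmxBr mulmx1 => /eqP; rewrite subr_eq0 => /eqP ev.
  have h : v *m Y *m v^T = 0.
    have : (v *m Y *m v^T)^T = - (v *m Y *m v^T).
      by rewrite !trmx_mul trmxK aY mulNmx mulmxN mulmxA.
    move: (v *m Y *m v^T) => M e; apply/matrixP => i j; rewrite !ord1 [RHS]mxE.
    by have := congr1 (fun N : 'M[R]_1 => N 0 0) e; rewrite /= [LHS]mxE [RHS]mxE => ?; lra.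
  have vT0 : v^T = 0.
    apply: mxtrace_sqr_eq0.
    by rewrite trmxK {1}ev -scalemxAr -scalemxAl h scaler0 linear0.
  by rewrite -[v]trmxK vT0 trmx0.
have uT t : 1%:M + t *: Y \in unitmx.
  by rewrite -unitmx_tr linearD linearZ /= trmx1 aY scalerN.
pose C t := invmx (1%:M - t *: Y) *m (1%:M + t *: Y).
have eC t : (1%:M - t *: Y) *m C t = 1%:M + t *: Y by rewrite mulKVmx.
have cm t : (1%:M + t *: Y) *m (1%:M - t *: Y) = (1%:M - t *: Y) *m (1%:M + t *: Y).
  rewrite mulmxDl !mulmxBr mulmxDr mulmxBl !mul1mx !mulmx1 mulmxBl mul1mx.
  by rewrite addrACA [RHS]addrAC -!addrA; congr (_ + _); rewrite addrC -!addrA addrC -!addrA.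
have oC t : orthmx (C t).
  have PT : (1%:M - t *: Y)^T = 1%:M + t *: Y.
    by rewrite linearB linearZ /= trmx1 aY scalerN opprK.
  have QT : (1%:M + t *: Y)^T = 1%:M - t *: Y by rewrite -PT trmxK.
  rewrite /orthmx /C trmx_mul trmx_inv PT QT -mulmxA (mulmxA (1%:M + _)) cm.
  by rewrite -mulmxA mulmxV // mulmx1 mulVmx.
exists C => // i j.
exists (\sum_k 2 * `|(Y *m Y) k j|) => t _.
(* The exact remainder, checked after multiplication by 1 - t Y; orthogonality bounds the entries of
   1 + C t by 2. *)
have e : C t - 1%:M - t *: X = t ^+ 2 *: ((1%:M + C t) *m (Y *m Y)).
  have -> : X = 2 *: Y by rewrite /Y scalerA divff ?scale1r // pnatr_eq0.
  apply: (can_inj (mulKmx (u t))).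
  have hP : (1%:M - t *: Y) *m (1%:M + C t) = 2%:M.
    rewrite mulmxDr eC mulmx1 addrACA addNr addr0 -raddfD.
    by congr (_%:M); rewrite -mulr2n.
  rewrite -[in RHS]scalemxAr [in RHS]mulmxA hP mul_scalar_mx.
  rewrite 2!mulmxBr eC mulmx1 mulmxBl mul1mx -!scalemxAr -!scalemxAl.
  by move: (Y *m Y) => YY; apply/matrixP => a b; rewrite !mxE; ring.
have -> : C t i j - (1%:M : 'M[R]_n) i j - t * X i j =
   t ^+ 2 * ((1%:M + C t) *m (Y *m Y)) i j.
  by move: e => /matrixP /(_ i j); rewrite !mxE.
rewrite mulrC normrM (ger0_norm (sqr_ge0 t)); apply: ler_wpM2r; first exact: sqr_ge0.
rewrite mxE; apply: le_trans (ler_norm_sum _ _ _) _.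
apply: ler_sum => k _; rewrite normrM; apply: ler_wpM2r => //.
rewrite mxE; apply: le_trans (ler_normD _ _) _.
by rewrite -[2]/(1 + 1) lerD ?orthmx_le1 //; apply: orthmx1.
Qed.

End Jets.

(** * Orthogonal diagonalisation *)

Section Spectral.
Variables (R : realType).

Lemma compact_orthmx n : compact [set O : 'M[R]_n | orthmx O].
Proof.
apply: (subclosed_compact _ (@compact_mx_box R n n 1)); last first.
  by move=> O oO i j; apply: orthmx_le1.
have -> : [set O : 'M[R]_n | orthmx O] =
    (fun O : 'M[R]_n => `|O *m O^T - 1%:M|) @^-1` [set x | x <= 0].
  apply/seteqP; split => O /=; rewrite /orthmx; first by move=> ->; rewrite subrr normr0.
  by rewrite normr_le0 subr_eq0 => /eqP.
apply: (preimage_closed _ (@closed_le _ _)) => O _.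
have h T (F : set_system T) (FF : Filter F) (g : T -> 'M[R]_n) (a : 'M[R]_n) :
    g @ F --> a -> `|g x *m (g x)^T - 1%:M| @[x --> F] --> `|a *m a^T - 1%:M|.
  by move=> ga; apply: cvg_norm; apply: cvgB (cvg_cst _); apply: cvg_mulmx (cvg_trmx ga).
exact: (h _ (nbhs O) _ id O cvg_id).
Qed.

Lemma antisym_part n (Y : 'M[R]_n) : (Y - Y^T)^T = - (Y - Y^T).
Proof. by rewrite linearB /= trmxK opprB. Qed.

(** For the trace form the symmetric matrices are the orthogonal complement of the antisymmetric
    ones: testing against Z = Y - Y^T itself gives tr (Z^T Z) = 0. *)
Lemma mxtrace_antisym n (Y : 'M[R]_n) :
  (forall X : 'M[R]_n, X^T = - X -> \tr (X *m Y) = 0) -> Y^T = Y.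
Proof.
move=> h; pose Z := Y - Y^T.
have aZ : Z^T = - Z by exact: antisym_part.
have Z0 : \tr (Z *m Z) = 0.
  rewrite {2}/Z mulmxBr linearB /= h // sub0r -mxtrace_tr trmx_mul trmxK.
  by rewrite mxtrace_mulC aZ mulNmx linearN /= h // !oppr0.
have : Z = 0 by apply: mxtrace_sqr_eq0; rewrite aZ mulNmx linearN /= Z0 oppr0.
by move=> /eqP; rewrite subr_eq0 => /eqP.
Qed.

(* Brockett's argument: a maximiser over O(n) of the trace of diag(0, 1, ...) O S O^T
   makes O S O^T commute with diag(0, 1, ...). *)
Lemma spectral n (S : 'M[R]_n) : S^T = S ->
  exists2 O, orthmx O & exists d : 'rV[R]_n, O *m S *m O^T = diag_mx d.
Proof.
move=> symS; pose C : 'M[R]_n := diag_mx (\row_i (i : nat)%:R).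
pose f (O : 'M[R]_n) := \tr (C *m (O *m S *m O^T)).
have cf : {within [set O : 'M[R]_n | orthmx O], continuous f}.
  apply: continuous_subspaceT => O.
  have h T (F : set_system T) (FF : Filter F) (g : T -> 'M[R]_n) a :
      g @ F --> a -> f (g x) @[x --> F] --> f a.
    move=> ga; apply: cvg_mxtrace; apply: cvg_mulmx; first exact: cvg_cst.
    by apply: cvg_mulmx (cvg_trmx ga); apply: cvg_mulmx; last exact: cvg_cst.
  exact: (h _ (nbhs O) _ id O cvg_id).
have [] := compact_EVT_max _ (@compact_orthmx n) cf.
  by exists 1%:M; apply: orthmx1.
move=> O; rewrite inE /= => oO maxO; exists O => //.
pose S' := O *m S *m O^T.
have symS' : S'^T = S' by rewrite /S' !trmx_mul trmxK symS mulmxA.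
have symC : C^T = C by rewrite tr_diag_mx.
have h (X : 'M[R]_n) : X^T = - X -> \tr (X *m (S' *m C)) = 0.
  move=> aX; have [K oK jK] := cayley aX.
  have j := jet_mxtrace (mjetM (mjet_cst C) (mjetM (mjetM jK (mjet_cst S')) (mjet_tr jK))).
  have b0 := jet_max j ltr01.
  rewrite trmx1 !mulmx1 !mul1mx !mul0mx add0r addr0 in b0.
  have : \tr (C *m (S' *m X^T + X *m S')) = 0.
    apply: b0 => t _.
    have -> : C *m (K t *m S' *m (K t)^T) = C *m ((K t *m O) *m S *m (K t *m O)^T).
      by rewrite /S' trmx_mul !mulmxA.
    by apply: maxO; rewrite inE /=; apply: orthmxM.
  rewrite aX mulmxN mulmxDr mulmxN linearD linearN /=.
  have -> : \tr (C *m (S' *m X)) = \tr (X *m (C *m S')).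
    by rewrite mulmxA mxtrace_mulC.
  have -> : \tr (C *m (X *m S')) = \tr (X *m (S' *m C)).
    by rewrite mxtrace_mulC mulmxA.
  have -> : \tr (X *m (C *m S')) = - \tr (X *m (S' *m C)).
    by rewrite -[LHS]mxtrace_tr trmx_mul (trmx_mul C S') symC symS' aX mulmxN linearN /= mxtrace_mulC.
  by rewrite opprK => ?; lra.
have /matrixP cSC : (S' *m C)^T = S' *m C by exact: mxtrace_antisym.
exists (\row_i S' i i); apply/matrixP => i j; rewrite -/S' !mxE.
case: eqVneq => [->|ij]; first by rewrite mulr1n.
rewrite mulr0n; have := cSC i j; rewrite trmx_mul symS' symC.
rewrite mul_diag_mx mul_mx_diag !mxE mulrC => /eqP.
rewrite -subr_eq0 -mulrBr mulf_eq0 subr_eq0 eqr_nat => /orP[/eqP //|/eqP e].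
by rewrite (val_inj e) eqxx in ij.
Qed.

(** If Q diagonalises A^T A, the columns of A Q^T are orthogonal; dividing them by their lengths
    gives the first orthogonal factor. *)
Lemma svd n (A : 'M[R]_n) : A \in unitmx ->
  exists O1 O2 (d : 'rV[R]_n), [/\ orthmx O1, orthmx O2, forall i, 0 < d 0 i &
    A = O1 *m diag_mx d *m O2].
Proof.
move=> uA; have symS : (A^T *m A)^T = A^T *m A by rewrite trmx_mul trmxK.
have [Q oQ [d ed]] := spectral symS.
have eAO : (A *m Q^T)^T *m (A *m Q^T) = diag_mx d.
  by rewrite -ed trmx_mul trmxK !mulmxA.
have dpos i : 0 < d 0 i.
  have di : d 0 i = \sum_k (A *m Q^T) k i ^+ 2.
    have := congr1 (fun M : 'M[R]_n => M i i) eAO; rewrite /= mxE [RHS]mxE eqxx mulr1n => <-.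
    by apply: eq_bigr => k _; rewrite mxE expr2.
  rewrite lt_def; apply/andP; split; last by rewrite di; apply: sumr_ge0 => k _; rewrite sqr_ge0.
  apply/eqP => d0.
  have : diag_mx d \in unitmx.
    by rewrite -eAO !unitmx_mul unitmx_tr !unitmx_mul uA unitmx_tr (orthmx_unit oQ).
  rewrite unitmxE det_diag unitfE => /prodf_neq0 /(_ i isT).
  by rewrite d0 eqxx.
pose r : 'rV[R]_n := \row_i Num.sqrt (d 0 i).
pose ri : 'rV[R]_n := \row_i (Num.sqrt (d 0 i))^-1.
have rpos i : 0 < r 0 i by rewrite mxE sqrtr_gt0.
have rri : diag_mx ri *m diag_mx r = 1%:M.
  rewrite mulmx_diag; apply/matrixP => i j; rewrite !mxE mulVf //.
  by rewrite gt_eqF // sqrtr_gt0.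
exists (A *m Q^T *m diag_mx ri), Q, r; split => //; last first.
  by rewrite -!mulmxA (mulmxA (diag_mx ri)) rri mul1mx orthmxC // mulmx1.
have dri : diag_mx d *m diag_mx ri = diag_mx r.
  rewrite mulmx_diag; congr diag_mx; apply/rowP => i; rewrite !mxE.
  by rewrite -{1}(sqr_sqrtr (ltW (dpos i))) expr2 mulfK // gt_eqF // sqrtr_gt0.
rewrite -[X in orthmx X]trmxK; apply: orthmxT; rewrite /orthmx trmxK trmx_mul tr_diag_mx.
by rewrite -(mulmxA (diag_mx ri)) (mulmxA (A *m Q^T)^T) eAO dri.
Qed.

End Spectral.

(** * The action of GL(V_1) x GL(V_2) on structure constants *)

Section Slices.
Variables (R : realType) (p q : nat).
Implicit Types (M N : sconst R p q) (A s : 'M[R]_p) (B b : 'M[R]_q).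

Definition slice M k : 'M[R]_p := vec_mx (row k M).

Definition of_slices (F : 'I_q -> 'M[R]_p) : sconst R p q :=
  \matrix_(k < q) mxvec (F k).

Lemma slice_of F k : slice (of_slices F) k = F k.
Proof. by rewrite /slice rowK mxvecK. Qed.

Lemma sliceP M N : (forall k, slice M k = slice N k) -> M = N.
Proof.
by move=> h; apply/row_matrixP => k; apply: (can_inj vec_mxK); exact: h.
Qed.

Lemma sliceE M k i j : slice M k i j = M k (mxvec_index i j).
Proof. by rewrite /slice !mxE. Qed.

Lemma sliceD M N k : slice (M + N) k = slice M k + slice N k.
Proof. by rewrite /slice !linearD. Qed.

Lemma sliceB M N k : slice (M - N) k = slice M k - slice N k.
Proof. by rewrite /slice !linearB. Qed.

Lemma sliceN M k : slice (- M) k = - slice M k.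
Proof. by rewrite /slice !linearN. Qed.

Lemma slice0 k : slice 0 k = 0.
Proof. by rewrite /slice !linear0. Qed.

Lemma sliceZ a M k : slice (a *: M) k = a *: slice M k.
Proof. by rewrite /slice !linearZ. Qed.

Lemma sliceM B M k : slice (B *m M) k = \sum_l B k l *: slice M l.
Proof.
apply/matrixP => i j; rewrite sliceE mxE summxE; apply: eq_bigr => l _.
by rewrite mxE sliceE.
Qed.

Lemma WspaceE M : Wspace M <-> forall k, (slice M k)^T = - slice M k.
Proof.
split => [[_ h] k|h].
  by apply/matrixP => i j; rewrite mxE [RHS]mxE; apply: h.
have h' k i j : sc M k i j = - sc M k j i.
  by have /matrixP /(_ j i) := h k; rewrite mxE [RHS]mxE.
by split => // k i; have := h' k i i; lra.
Qed.

Definition conjsc A M := of_slices (fun k => A^T *m slice M k *m A).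

Lemma slice_conjsc A M k : slice (conjsc A M) k = A^T *m slice M k *m A.
Proof. exact: slice_of. Qed.

Lemma conjsc_mul A B M : conjsc A (B *m M) = B *m conjsc A M.
Proof.
apply: sliceP => k; rewrite slice_conjsc !sliceM mulmx_sumr mulmx_suml.
by apply: eq_bigr => l _; rewrite slice_conjsc -scalemxAr -scalemxAl.
Qed.

Lemma conjsc_comp A A' M : conjsc A (conjsc A' M) = conjsc (A' *m A) M.
Proof. by apply: sliceP => k; rewrite !slice_conjsc trmx_mul !mulmxA. Qed.

(** A right action in A and a left action in B: the effect on structure constants of changing the
    basis of V_1 by A and the coordinates of V_2 by B. *)
Definition act A B M := conjsc A (B *m M).

Lemma slice_act A B M k :
  slice (act A B M) k = A^T *m (\sum_l B k l *: slice M l) *m A.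
Proof. by rewrite /act slice_conjsc sliceM. Qed.

Lemma act_comp A A' B B' M :
  act A B (act A' B' M) = act (A' *m A) (B *m B') M.
Proof. by rewrite /act -conjsc_mul conjsc_comp mulmxA. Qed.

Lemma act1 M : act 1%:M 1%:M M = M.
Proof.
by rewrite /act mul1mx; apply: sliceP => k; rewrite slice_conjsc trmx1 mul1mx mulmx1.
Qed.

Lemma actK A B M : A \in unitmx -> B \in unitmx ->
  act (invmx A) (invmx B) (act A B M) = M.
Proof. by move=> uA uB; rewrite act_comp mulmxV // mulVmx // act1. Qed.

Lemma actVK A B M : A \in unitmx -> B \in unitmx ->
  act A B (act (invmx A) (invmx B) M) = M.
Proof. by move=> uA uB; rewrite act_comp mulVmx // mulmxV // act1. Qed.

Lemma conjscB A M N : conjsc A (M - N) = conjsc A M - conjsc A N.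
Proof.
apply: sliceP => k; rewrite sliceB !slice_conjsc sliceB.
by rewrite mulmxBr mulmxBl.
Qed.

Lemma conjscD A M N : conjsc A (M + N) = conjsc A M + conjsc A N.
Proof.
apply: sliceP => k; rewrite sliceD !slice_conjsc sliceD.
by rewrite mulmxDr mulmxDl.
Qed.

Lemma actB A B M N : act A B (M - N) = act A B M - act A B N.
Proof. by rewrite /act mulmxBr conjscB. Qed.

Lemma act0 A B : act A B 0 = 0.
Proof. by have := actB A B 0 0; rewrite !subrr. Qed.

(** The homotheties generated by the grading element are invisible on tensors, so frames can be
    determined only up to them. *)
Lemma act_homothety (a : R) A B M : a != 0 ->
  act (a *: A) (a ^- 2 *: B) M = act A B M.
Proof.
move=> a0; apply: sliceP => k; rewrite /act !slice_conjsc -scalemxAl sliceZ.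
have -> : (a *: A)^T = a *: A^T by rewrite linearZ.
rewrite -!scalemxAl -!scalemxAr -!scalemxAl !scalerA.
by rewrite (_ : _ * _ = 1) ?scale1r //; field.
Qed.

Lemma Wspace_act A B M : Wspace M -> Wspace (act A B M).
Proof.
rewrite !WspaceE => h k; rewrite slice_act !trmx_mul trmxK -mulNmx -mulmxN mulmxA.
congr (_ *m _ *m _); rewrite linear_sum -sumrN; apply: eq_bigr => l _.
by rewrite linearZ /= h scalerN.
Qed.

(* [alpha N M] and [-1/2 beta N M] are the components of the operator del^*_N M
   for the standard metrics. *)
Definition alpha N M : 'M[R]_p := \sum_k (slice M k)^T *m slice N k.
Definition beta N M : 'M[R]_q := M *m N^T.

Lemma alphaE N M r c : alpha N M r c =
  \sum_i (M^T *m N) (mxvec_index i r) (mxvec_index i c).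
Proof.
rewrite /alpha summxE; under [RHS]eq_bigr do rewrite mxE.
rewrite exchange_big; apply: eq_bigr => k _; rewrite mxE; apply: eq_bigr => i _.
by rewrite !mxE.
Qed.

Lemma betaE N M k r : beta N M k r = \tr ((slice M k)^T *m slice N r).
Proof.
rewrite /beta mxE mxtrace_tr_mul (reindex _ (curry_mxvec_bij _ _)) /=.
by rewrite pair_bigA; apply: eq_bigr => -[i j] _ /=; rewrite !sliceE mxE.
Qed.

Lemma alpha_act A B N M : orthmx A -> orthmx B ->
  alpha (act A B N) (act A B M) = A^T *m alpha N M *m A.
Proof.
move=> oA oB.
have -> : alpha N M = alpha (B *m N) (B *m M).
  apply/matrixP => r c; rewrite !alphaE trmx_mul -mulmxA (mulmxA B^T).
  by rewrite (orthmxC oB) mul1mx.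
rewrite /alpha mulmx_sumr mulmx_suml; apply: eq_bigr => k _.
rewrite /act !slice_conjsc !trmx_mul trmxK -!mulmxA; congr (_ *m (_ *m _)).
by rewrite !mulmxA oA mul1mx.
Qed.

Lemma beta_act A B N M : orthmx A -> orthmx B ->
  beta (act A B N) (act A B M) = B *m beta N M *m B^T.
Proof.
move=> oA oB; rewrite /beta /act !conjsc_mul trmx_mul -!mulmxA; congr (_ *m _).
rewrite !mulmxA; congr (_ *m _); apply/matrixP => k r.
have h N' M' := betaE N' M' k r; rewrite /beta in h; rewrite !h !slice_conjsc.
rewrite !trmx_mul trmxK -!mulmxA mxtrace_mulC -!mulmxA oA mulmx1 (mulmxA A A^T).
by rewrite oA mul1mx.
Qed.

Definition ip M N : R := \sum_k \tr ((slice M k)^T *m slice N k).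

Lemma ip_beta M N : ip M N = \tr (beta N M).
Proof. by apply: eq_bigr => k _; rewrite betaE. Qed.

Lemma ip_alpha M N : ip M N = \tr (alpha N M).
Proof. by rewrite /alpha linear_sum. Qed.

Lemma ip_act A B M N : orthmx A -> orthmx B ->
  ip (act A B M) (act A B N) = ip M N.
Proof.
move=> oA oB; rewrite !ip_beta beta_act // mxtrace_mulC mulmxA.
by rewrite (orthmxC oB) mul1mx.
Qed.

Lemma ipC M N : ip M N = ip N M.
Proof. by apply: eq_bigr => k _; rewrite -mxtrace_tr trmx_mul trmxK. Qed.

Lemma ipDl M M' N : ip (M + M') N = ip M N + ip M' N.
Proof.
rewrite /ip -big_split; apply: eq_bigr => k _ /=.
by rewrite sliceD linearD mulmxDl linearD.
Qed.

Lemma ipNl M N : ip (- M) N = - ip M N.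
Proof.
rewrite /ip -sumrN; apply: eq_bigr => k _.
by rewrite sliceN linearN mulNmx linearN.
Qed.

Lemma ipBl M M' N : ip (M - M') N = ip M N - ip M' N.
Proof. by rewrite ipDl ipNl. Qed.

Lemma ipBr M N N' : ip M (N - N') = ip M N - ip M N'.
Proof. by rewrite ipC ipBl !(ipC M). Qed.

Lemma ip_sqrE M : ip M M = \sum_k \sum_c M k c ^+ 2.
Proof.
rewrite ip_beta; apply: eq_bigr => k _; rewrite /beta mxE; apply: eq_bigr => c _.
by rewrite mxE expr2.
Qed.

Lemma ip_ge0 M : 0 <= ip M M.
Proof. by rewrite ip_sqrE; do 2![apply: sumr_ge0 => ? _]; apply: sqr_ge0. Qed.

Lemma norm_le_ip M : `|M| ^+ 2 <= ip M M.
Proof.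
have h k c : `|M k c| ^+ 2 <= ip M M.
  rewrite real_normK ?num_real // ip_sqrE (bigD1 k) //= (bigD1 c) //= -addrA lerDl.
  by rewrite addr_ge0 //; repeat apply: sumr_ge0 => ? _; rewrite ?sqr_ge0.
have h' k c : `|M k c| <= Num.sqrt (ip M M).
  by rewrite -(@ler_pXn2r _ 2) ?nnegrE ?sqrtr_ge0 // sqr_sqrtr ?ip_ge0.
have : `|M| <= Num.sqrt (ip M M) by apply/norm_mx_le; rewrite ?sqrtr_ge0.
rewrite -(@ler_pXn2r _ 2) ?nnegrE ?sqrtr_ge0 // => /le_trans; apply.
by rewrite sqr_sqrtr // ip_ge0.
Qed.

Lemma ip_le_norm M : ip M M <= (q * (p * p))%:R * `|M| ^+ 2.
Proof.
rewrite ip_sqrE natrM -mulrA -[q in q%:R]card_ord -sumr_const mulr_suml.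
apply: ler_sum => k _; rewrite mul1r -[X in X%:R]card_ord -sumr_const mulr_suml.
apply: ler_sum => c _; rewrite mul1r -real_normK ?num_real //.
by rewrite lerXn2r ?nnegrE // norm_mx_ge.
Qed.

Definition lie s M := of_slices (fun k => s^T *m slice M k + slice M k *m s).

(** The infinitesimal action: the derivative at t = 0 of [act (1 + t s) (1 + t b) M]. *)
Definition rho s b M : sconst R p q := b *m M + lie s M.

Lemma slice_rho s b M k : slice (rho s b M) k =
  \sum_l b k l *: slice M l + (s^T *m slice M k + slice M k *m s).
Proof. by rewrite /rho sliceD slice_of sliceM. Qed.

Lemma lie_mul s B M : lie s (B *m M) = B *m lie s M.
Proof.
apply: sliceP => k; rewrite slice_of !sliceM mulmx_sumr mulmx_suml -big_split.
by apply: eq_bigr => l _; rewrite slice_of -scalemxAr -scalemxAl scalerDr.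
Qed.

Lemma lie_conjsc s A M : orthmx A ->
  lie s (conjsc A M) = conjsc A (lie (A *m s *m A^T) M).
Proof.
move=> oA; apply: sliceP => k; rewrite slice_of !slice_conjsc slice_of.
rewrite mulmxDr mulmxDl !trmx_mul trmxK !mulmxA (orthmxC oA) mul1mx.
by rewrite -[_ *m A^T *m A]mulmxA (orthmxC oA) mulmx1.
Qed.

Lemma rho_act A B s b M : orthmx A -> orthmx B ->
  rho s b (act A B M) =
  act A B (rho (A *m s *m A^T) (B^T *m b *m B) M).
Proof.
move=> oA oB; rewrite /rho /act lie_conjsc // lie_mul -conjsc_mul -conjscD.
by rewrite mulmxDr !mulmxA oB mul1mx.
Qed.

Lemma Wspace_rho s b M : Wspace M -> Wspace (rho s b M).
Proof.
rewrite !WspaceE => h k; rewrite slice_rho linearD /= opprD; congr (_ + _).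
  rewrite linear_sum -sumrN; apply: eq_bigr => l _.
  by rewrite linearZ /= h scalerN.
by rewrite linearD /= !trmx_mul trmxK h mulNmx mulmxN opprD addrC.
Qed.

(** The right-hand sides are the values of [alpha] and [beta] on a Clifford system
    ([clifford_balanced]). *)
Definition balanced M : Prop := alpha M M = q%:R%:M /\ beta M M = p%:R%:M.

Lemma balanced_act A B M : orthmx A -> orthmx B ->
  balanced M -> balanced (act A B M).
Proof.
move=> oA oB [ha hb]; split.
  by rewrite alpha_act // ha mul_mx_scalar -scalemxAl (orthmxC oA) scalemx1.
by rewrite beta_act // hb mul_mx_scalar -scalemxAl oB scalemx1.
Qed.

Lemma act_orthKV A B M : orthmx A -> orthmx B -> act A^T B^T (act A B M) = M.
Proof. by move=> oA oB; rewrite act_comp oA (orthmxC oB) act1. Qed.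

Lemma act_orthK A B M : orthmx A -> orthmx B -> act A B (act A^T B^T M) = M.
Proof. by move=> oA oB; rewrite act_comp oB (orthmxC oA) act1. Qed.

Lemma balanced_actE A B M : orthmx A -> orthmx B ->
  balanced (act A B M) -> balanced M.
Proof.
move=> oA oB /(balanced_act (orthmxT oA) (orthmxT oB)).
by rewrite act_orthKV.
Qed.

(* The symmetric part of the stabiliser of M is spanned by the grading element. *)
Definition sym_rigid M : Prop := forall s b, s^T = s -> b^T = b ->
  rho s b M = 0 -> exists c : R, s = c%:M /\ b = (- 2 * c)%:M.

Lemma slice_act_diag (d : 'rV[R]_p) (e : 'rV[R]_q) M k i j :
  slice (act (diag_mx d) (diag_mx e) M) k i j =
  e 0 k * d 0 i * d 0 j * slice M k i j.
Proof.
rewrite slice_act (bigD1 k) //= big1 => [|l lk]; last first.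
  by rewrite mxE eq_sym (negbTE lk) mulr0n scale0r.
rewrite addr0 tr_diag_mx mul_mx_diag mxE mul_diag_mx !mxE eqxx mulr1n.
by rewrite -sliceE; ring.
Qed.

Lemma slice_rho_diag (d : 'rV[R]_p) (e : 'rV[R]_q) M k i j :
  slice (rho (diag_mx d) (diag_mx e) M) k i j =
  (e 0 k + d 0 i + d 0 j) * slice M k i j.
Proof.
rewrite slice_rho (bigD1 k) //= big1 => [|l lk]; last first.
  by rewrite mxE eq_sym (negbTE lk) mulr0n scale0r.
rewrite addr0 tr_diag_mx mul_mx_diag mul_diag_mx !mxE eqxx mulr1n.
by rewrite -sliceE; ring.
Qed.

Lemma balanced_sum M : Wspace M -> balanced M ->
  [/\ forall j, \sum_k \sum_i slice M k i j ^+ 2 = q%:R,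
      forall i, \sum_k \sum_j slice M k i j ^+ 2 = q%:R &
      forall k, \sum_i \sum_j slice M k i j ^+ 2 = p%:R].
Proof.
move=> /WspaceE hM [ha hb].
have h1 j : \sum_k \sum_i slice M k i j ^+ 2 = q%:R.
  have /matrixP /(_ j j) := ha; rewrite summxE [RHS]mxE eqxx mulr1n => <-.
  apply: eq_bigr => k _; rewrite mxE; apply: eq_bigr => i _.
  by rewrite [_^T _ _]mxE expr2.
split=> // [i|k].
  rewrite -(h1 i); apply: eq_bigr => k _; apply: eq_bigr => j _.
  have /matrixP /(_ i j) := hM k; rewrite mxE [RHS]mxE => ->.
  by rewrite sqrrN.
have /matrixP /(_ k k) := hb; rewrite betaE [RHS]mxE eqxx mulr1n => <-.
by rewrite mxtrace_tr_mul; do 2![apply: eq_bigr => ? _]; rewrite expr2.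
Qed.

(* Kempf-Ness uniqueness. In diagonal form the squared structure constants P and
   Q = x^2 P of the two brackets have the same marginals while ln x is a sum of
   functions of one index each, so that the sum of (Q - P) ln x vanishes; but all its
   terms are nonnegative. *)
Lemma balanced_unique A B M : Wspace M -> sym_rigid M ->
  A \in unitmx -> B \in unitmx -> balanced M -> balanced (act A B M) ->
  exists a U1 U2, [/\ 0 < a, orthmx U1, orthmx U2, A = a *: U1 & B = a ^- 2 *: U2].
Proof.
move=> wM rM uA uB bM bM'.
have [U1 [U2 [d [oU1 oU2 d0 eA]]]] := svd uA.
have [P1 [P2 [e [oP1 oP2 e0 eB]]]] := svd uB.
(* In the singular bases of A and B the two tensors differ only by diagonal matrices. *)
pose N := act U1 P2 M; pose N' := act (diag_mx d) (diag_mx e) N.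
have wN : Wspace N by exact: Wspace_act.
have wN' : Wspace N' by exact: Wspace_act.
have bN : balanced N by exact: balanced_act.
have bN' : balanced N'.
  apply: (balanced_actE oU2 oP1); rewrite /N' /N !act_comp.
  by rewrite !mulmxA -eA -eB.
pose l (k : 'I_q) (i j : 'I_p) : R := ln (e 0 k) + ln (d 0 i) + ln (d 0 j).
pose x k i j := e 0 k * d 0 i * d 0 j.
have x0 k i j : 0 < x k i j by rewrite !mulr_gt0.
have lE k i j : l k i j = ln (x k i j).
  by rewrite /x !lnM ?posrE ?mulr_gt0.
pose T k i j := (slice N' k i j ^+ 2 - slice N k i j ^+ 2) * l k i j.
have TE k i j : T k i j = (x k i j ^+ 2 - 1) * ln (x k i j) * slice N k i j ^+ 2.
  by rewrite /T slice_act_diag -/(x k i j) lE; ring.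
have T0 k i j : 0 <= T k i j.
  rewrite TE mulr_ge0 ?sqr_ge0 //.
  have [x1|x1] := leP 1 (x k i j).
    by rewrite mulr_ge0 ?ln_ge0 // subr_ge0 exprn_ege1.
  by rewrite mulr_le0 ?ln_le0 ?(ltW x1) // subr_le0 exprn_ile1 // ltW.
have sT : \sum_k \sum_i \sum_j T k i j = 0.
  have [a1 a2 a3] := balanced_sum wN bN.
  have [b1 b2 b3] := balanced_sum wN' bN'.
  have -> : \sum_k \sum_i \sum_j T k i j =
    \sum_k ln (e 0 k) * (\sum_i \sum_j slice N' k i j ^+ 2 - \sum_i \sum_j slice N k i j ^+ 2)
    + (\sum_i ln (d 0 i) * (\sum_k \sum_j slice N' k i j ^+ 2 - \sum_k \sum_j slice N k i j ^+ 2)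
    + \sum_j ln (d 0 j) * (\sum_k \sum_i slice N' k i j ^+ 2 - \sum_k \sum_i slice N k i j ^+ 2)).
    have e1 (c : 'I_q -> R) (f : 'I_q -> 'I_p -> 'I_p -> R) :
        \sum_k c k * (\sum_i \sum_j f k i j) = \sum_k \sum_i \sum_j c k * f k i j.
      by apply: eq_bigr => k _; rewrite mulr_sumr; apply: eq_bigr => i _; rewrite mulr_sumr.
    have e2 (c : 'I_p -> R) (f : 'I_q -> 'I_p -> 'I_p -> R) :
        \sum_i c i * (\sum_k \sum_j f k i j) = \sum_k \sum_i \sum_j c i * f k i j.
      rewrite exchange_big /=; apply: eq_bigr => i _; rewrite mulr_sumr.
      by apply: eq_bigr => k _; rewrite mulr_sumr.
    have e3 (c : 'I_p -> R) (f : 'I_q -> 'I_p -> 'I_p -> R) :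
        \sum_j c j * (\sum_k \sum_i f k i j) = \sum_k \sum_i \sum_j c j * f k i j.
      transitivity (\sum_j \sum_k \sum_i c j * f k i j).
        by apply: eq_bigr => j _; rewrite mulr_sumr; apply: eq_bigr => k _; rewrite mulr_sumr.
      by rewrite exchange_big /=; apply: eq_bigr => k _; rewrite exchange_big.
    pose f k i j := slice N' k i j ^+ 2 - slice N k i j ^+ 2.
    have f1 k : \sum_i \sum_j slice N' k i j ^+ 2 - \sum_i \sum_j slice N k i j ^+ 2 =
        \sum_i \sum_j f k i j.
      by rewrite -sumrB; apply: eq_bigr => i _; rewrite -sumrB.
    have f2 i : \sum_k \sum_j slice N' k i j ^+ 2 - \sum_k \sum_j slice N k i j ^+ 2 =
        \sum_k \sum_j f k i j.
      by rewrite -sumrB; apply: eq_bigr => k _; rewrite -sumrB.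
    have f3 j : \sum_k \sum_i slice N' k i j ^+ 2 - \sum_k \sum_i slice N k i j ^+ 2 =
        \sum_k \sum_i f k i j.
      by rewrite -sumrB; apply: eq_bigr => k _; rewrite -sumrB.
    under [X in _ = X + _]eq_bigr do rewrite f1.
    under [X in _ = _ + (X + _)]eq_bigr do rewrite f2.
    under [X in _ = _ + (_ + X)]eq_bigr do rewrite f3.
    rewrite e1 e2 e3 -!big_split; apply: eq_bigr => k _; rewrite -!big_split.
    apply: eq_bigr => i _; rewrite -!big_split; apply: eq_bigr => j _ /=.
    by rewrite /T /l -/(f k i j); ring.
  rewrite big1 ?add0r => [|k _]; last by rewrite a3 b3 subrr mulr0.
  rewrite big1 ?add0r => [|i _]; last by rewrite a2 b2 subrr mulr0.
  by rewrite big1 // => j _; rewrite a1 b1 subrr mulr0.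
have zT k i j : T k i j = 0.
  have /eqP := sT; rewrite psumr_eq0 => [|k' _]; last by do 2![apply: sumr_ge0 => ? _].
  move=> /allP /(_ k (mem_index_enum _)) /=.
  rewrite psumr_eq0 => [|i' _]; last by apply: sumr_ge0 => ? _.
  move=> /allP /(_ i (mem_index_enum _)) /=.
  rewrite psumr_eq0 => [|j' _] //.
  by move=> /allP /(_ j (mem_index_enum _)) /eqP.
(* A term (x^2 - 1) (ln x) N^2 with x > 0 vanishes only if x = 1 or N = 0, that is, if (ln x) N =
   0. *)
have z k i j : l k i j * slice N k i j = 0.
  have := zT k i j; rewrite TE lE => /eqP.
  rewrite !mulf_eq0 subr_eq0 sqrf_eq1 => /orP[/orP[/orP[]|]|/orP[]] /eqP h.
  - by rewrite h ln1 mul0r.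
  - by have := x0 k i j; rewrite h oppr_gt0 ltr10.
  - by rewrite h mul0r.
  - by rewrite h mulr0.
  - by rewrite h mulr0.
pose d' : 'rV[R]_p := \row_i ln (d 0 i); pose e' : 'rV[R]_q := \row_k ln (e 0 k).
(* The logarithms of the singular values thus form a symmetric element of the stabiliser of N;
   carried back to M, it falls under [sym_rigid]. *)
have rN : rho (diag_mx d') (diag_mx e') N = 0.
  apply: sliceP => k; apply/matrixP => i j.
  have d'E a : d' 0 a = ln (d 0 a) by rewrite mxE.
  have e'E a : e' 0 a = ln (e 0 a) by rewrite mxE.
  by rewrite slice_rho_diag slice0 [RHS]mxE e'E !d'E; apply: z.
have [||| c [hs hb]] := rM (U1 *m diag_mx d' *m U1^T) (P2^T *m diag_mx e' *m P2).
- by rewrite !trmx_mul trmxK tr_diag_mx mulmxA.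
- by rewrite !trmx_mul trmxK tr_diag_mx mulmxA.
- by rewrite -[LHS](act_orthKV _ oU1 oP2) -rho_act // -/N rN act0.
have hd : diag_mx d' = c%:M.
  have : U1^T *m (U1 *m diag_mx d' *m U1^T) *m U1 = diag_mx d'.
    by rewrite !mulmxA (orthmxC oU1) mul1mx -mulmxA (orthmxC oU1) mulmx1.
  by rewrite hs mul_mx_scalar -scalemxAl (orthmxC oU1) scalemx1 => <-.
have he : diag_mx e' = (- 2 * c)%:M.
  have : P2 *m (P2^T *m diag_mx e' *m P2) *m P2^T = diag_mx e'.
    by rewrite !mulmxA oP2 mul1mx -mulmxA oP2 mulmx1.
  by rewrite hb mul_mx_scalar -scalemxAl oP2 scalemx1 => <-.
have dE : diag_mx d = (expR c)%:M.
  apply/matrixP => i j; have /matrixP /(_ i i) := hd; rewrite !mxE eqxx !mulr1n => hi.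
  by rewrite -hi lnK ?posrE //; case: eqP => [->|].
have eE : diag_mx e = (expR c ^- 2)%:M.
  apply/matrixP => i j; have /matrixP /(_ i i) := he; rewrite !mxE eqxx !mulr1n => hi.
  have -> : expR c ^- 2 = expR (- 2 * c).
    by rewrite -exprVn -expRN -expRM_natl; congr expR; ring.
  by rewrite -hi lnK ?posrE //; case: eqP => [->|].
exists (expR c), (U1 *m U2), (P1 *m P2); split.
- exact: expR_gt0.
- exact: orthmxM.
- exact: orthmxM.
- by rewrite eA dE mul_mx_scalar scalemxAl.
- by rewrite eB eE mul_mx_scalar scalemxAl.
Qed.

End Slices.

Lemma continuous_at_pair (U V Z : topologicalType) (g : U * V -> Z) (a : U) (b : V) :
  (forall T (F : set_system T) (FF : Filter F) (f1 : T -> U) (f2 : T -> V),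
     f1 @ F --> a -> f2 @ F --> b -> g (f1 y, f2 y) @[y --> F] --> g (a, b)) ->
  continuous_at (a, b) g.
Proof.
move=> h; have e : (fun y => g (y.1, y.2)) = g by apply/funext => -[].
by rewrite -[X in continuous_at _ X]e; apply: (h _ (nbhs (a, b)) _ fst snd);
  [exact: cvg_fst|exact: cvg_snd].
Qed.

(** The tube lemma with a filter in place of the second factor: it makes properties that hold near
    each point of a compact set of group elements uniform over that set. *)
Lemma compact_tube (X : topologicalType) (I : Type) (F : set_system I) {FF : Filter F}
    (S : set X) (P : I -> X -> Prop) : compact S ->
  (forall x, S x -> \forall z \near (nbhs x, F), P z.2 z.1) ->
  \forall i \near F, forall x, S x -> P i x.
Proof.
move=> /compact_near_coveringP cS h.
exact: (cS I F P FF h).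
Qed.

Lemma cvg_mx_neq0 (R : realType) T (F : set_system T) {FF : Filter F} m n
    (f : T -> 'M[R]_(m, n)) (a : 'M[R]_(m, n)) :
  f @ F --> a -> a != 0 -> \forall x \near F, f x != 0.
Proof.
move=> fa a0; have h : `|f x| @[x --> F] --> `|a| by exact: cvg_norm.
have na0 : `|a| != 0 by rewrite normr_eq0.
have nz : \forall x \near F, `|f x| != 0 by exact: cvgr_neq0 h na0.
by apply: filterS nz => x; rewrite normr_eq0.
Qed.

(** * Clifford systems *)

Section Clifford.
Variables (R : realType) (p q : nat).
Implicit Types (K M N : sconst R p q).

Definition clifford K : Prop :=
  (forall k, (slice K k)^T = - slice K k) /\
  (forall k l, slice K k *m slice K l + slice K l *m slice K k = (- 2 *+ (k == l))%:M).

(** For q = 3 mod 4 this says that the Clifford module is isotypic; in a sum of both types, an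
    exchange of the two could anticommute with all generators. *)
Definition unit_volume K : Prop :=
  exists2 c : R, c != 0 & \big[mulmx/1%:M]_(k < q) slice K k = c%:M.

Lemma clifford_sqr K k : clifford K -> slice K k *m slice K k = - 1%:M.
Proof.
move=> [_ /(_ k k)]; rewrite eqxx mulr1n => h.
move: (slice K k *m slice K k) h => Y /matrixP h; apply/matrixP => i j.
have := h i j; rewrite mxE [RHS]mxE => h'; rewrite [RHS]mxE [X in - X]mxE.
by move: h'; case: (i == j); rewrite ?mulr1n ?mulr0n; lra.
Qed.

Lemma clifford_orth K k : clifford K -> orthmx (slice K k).
Proof. by move=> cK; rewrite /orthmx cK.1 mulmxN clifford_sqr // opprK. Qed.

Lemma clifford_mxtrace K k l : clifford K ->
  \tr (slice K k *m slice K l) = - p%:R *+ (k == l).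
Proof.
move=> [_ /(_ k l) /(congr1 mxtrace)]; rewrite linearD /= mxtrace_scalar.
rewrite (mxtrace_mulC (slice K l)) -mulr_natr.
by case: (k == l); rewrite ?mulr0n ?mulr1n ?mul0r; lra.
Qed.

Lemma clifford_balanced K : clifford K -> balanced K.
Proof.
move=> cK; split.
  rewrite /alpha (eq_bigr (fun=> 1%:M)) => [|k _].
    by rewrite sumr_const card_ord -raddfMn.
  by rewrite cK.1 mulNmx clifford_sqr // opprK.
apply/matrixP => k r; rewrite betaE cK.1 mulNmx linearN /= clifford_mxtrace //.
by rewrite mxE mulNrn opprK.
Qed.

Lemma anticomm_prod n (F : 'I_n -> 'M[R]_p) (s : 'M[R]_p) :
  (forall k, s *m F k = - (F k *m s)) ->
  s *m \big[mulmx/1%:M]_(k < n) F k = (-1) ^+ n *: (\big[mulmx/1%:M]_(k < n) F k *m s).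
Proof.
elim: n F => [|n IH] F h; first by rewrite !big_ord0 mulmx1 mul1mx expr0 scale1r.
rewrite big_ord_recl mulmxA h mulNmx -!mulmxA IH => [|k]; last exact: h.
by rewrite -scalemxAr exprS mulN1r scaleNr.
Qed.

Lemma rho_grading (c : R) M : rho c%:M (- 2 * c)%:M M = 0.
Proof.
apply: sliceP => k; rewrite /rho sliceD slice_of mul_scalar_mx sliceZ slice0.
rewrite tr_scalar_mx mul_scalar_mx mul_mx_scalar -!scalerDl.
by rewrite (_ : _ + _ = 0) ?scale0r //; ring.
Qed.

Lemma rhoD s b s' b' M : rho (s + s') (b + b') M = rho s b M + rho s' b' M.
Proof.
rewrite /rho mulmxDl addrACA; congr (_ + _); apply: sliceP => k.
by rewrite sliceD !slice_of linearD /= mulmxDl mulmxDr addrACA.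
Qed.

Lemma rhoZ (a : R) s b M : rho (a *: s) (a *: b) M = a *: rho s b M.
Proof.
apply: sliceP => k; rewrite sliceZ /rho !sliceD !slice_of -scalemxAl sliceZ scalerDr.
by rewrite linearZ /= -scalemxAl -scalemxAr scalerDr.
Qed.

(** Tracing the k-th equation against J_m gives b = -2c with c = tr s / p. Then s - c anticommutes
    with every J_k, hence, q being odd, with their product; as this product is a nonzero scalar, s =
    c. *)
Lemma clifford_rigid K : (0 < p)%N -> odd q -> clifford K -> unit_volume K ->
  sym_rigid K.
Proof.
move=> p0 oq cK [e e0 vol] s b sS bS h.
have pR : p%:R != 0 :> R by rewrite pnatr_eq0 -lt0n.
pose c : R := \tr s / p%:R.
have hk k : \sum_l b k l *: slice K l + (s *m slice K k + slice K k *m s) = 0.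
  by have := congr1 (fun M => slice M k) h; rewrite slice_rho slice0 sS.
have hb : b = (- 2 * c)%:M.
  apply/matrixP => k m; rewrite mxE.
  have := congr1 (fun Y => \tr (slice K m *m Y)) (hk k).
  rewrite /= mulmx0 linear0 !mulmxDr !linearD /= mulmx_sumr linear_sum /=.
  rewrite (bigD1 m) //= big1 => [|l lm]; last first.
    by rewrite -scalemxAr linearZ /= clifford_mxtrace // eq_sym (negbTE lm) mulr0n mulr0.
  rewrite -scalemxAr linearZ /= clifford_mxtrace // eqxx mulr1n addr0.
  have -> : \tr (slice K m *m (s *m slice K k)) = \tr (slice K k *m slice K m *m s).
    by rewrite mulmxA mxtrace_mulC mulmxA.
  rewrite mulmxA -linearD -mulmxDl cK.2 mul_scalar_mx linearZ /=.
  have -> : \tr s = c * p%:R by rewrite /c divfK.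
  case: (k == m); rewrite ?mulr1n ?mulr0n => /eqP.
    have -> : b k m * - p%:R + (- 2) * (c * p%:R) = p%:R * - (b k m + 2 * c) by ring.
    by rewrite mulf_eq0 (negbTE pR) /= oppr_eq0 addr_eq0 => /eqP ->; ring.
  by rewrite mul0r addr0 mulrN oppr_eq0 mulf_eq0 (negbTE pR) orbF => /eqP.
exists c; split => //.
pose s' := s - c%:M.
have anti k : s' *m slice K k = - (slice K k *m s').
  have := hk k; have -> : \sum_l b k l *: slice K l = (- 2 * c) *: slice K k.
    by rewrite -sliceM hb mul_scalar_mx sliceZ.
  rewrite /s' mulmxBl mulmxBr mul_scalar_mx mul_mx_scalar.
  move: (s *m slice K k) (slice K k *m s) (slice K k) => Y Z J.
  move=> /matrixP e1; apply/matrixP => i j; have := e1 i j; rewrite !mxE; lra.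
have := anticomm_prod anti; rewrite vol mul_mx_scalar mul_scalar_mx -signr_odd oq expr1.
rewrite scaleN1r => /eqP; rewrite -addr_eq0 -mulr2n -scaler_nat scalerA scaler_eq0.
by rewrite mulf_eq0 pnatr_eq0 (negbTE e0) /= subr_eq0 => /eqP.
Qed.

Lemma cvg_slice T (F : set_system T) {FF : Filter F} (f : T -> sconst R p q)
    (a : sconst R p q) k : f @ F --> a -> slice (f x) k @[x --> F] --> slice a k.
Proof.
move=> fa; apply: cvg_mx => i j; under eq_fun do rewrite sliceE.
by rewrite sliceE; apply: cvg_mxE.
Qed.

Lemma cvg_of_slices T (F : set_system T) {FF : Filter F}
    (f : T -> 'I_q -> 'M[R]_p) (a : 'I_q -> 'M[R]_p) :
  (forall k, f x k @[x --> F] --> a k) ->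
  of_slices (f x) @[x --> F] --> of_slices a.
Proof.
move=> fa; apply: cvg_mx => k c; case/mxvec_indexP: c => i j.
under eq_fun do rewrite -sliceE slice_of.
by rewrite -sliceE slice_of; apply: cvg_mxE.
Qed.

Lemma cvg_act T (F : set_system T) {FF : Filter F}
    (f : T -> 'M[R]_p) (g : T -> 'M[R]_q) (h : T -> sconst R p q)
    (A : 'M[R]_p) (B : 'M[R]_q) (M : sconst R p q) :
  f @ F --> A -> g @ F --> B -> h @ F --> M ->
  act (f x) (g x) (h x) @[x --> F] --> act A B M.
Proof.
move=> fA gB hM; apply: cvg_of_slices => k.
have h1 := cvg_trmx fA; have h2 : slice (g x *m h x) k @[x --> F] --> slice (B *m M) k.
  by apply: cvg_slice; apply: cvg_mulmx.
have h3 : (f x)^T *m slice (g x *m h x) k @[x --> F] --> A^T *m slice (B *m M) k.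
  by apply: cvg_mulmx h2; exact: cvg_trmx.
exact: cvg_mulmx h3 fA.
Qed.

Lemma cvg_rho T (F : set_system T) {FF : Filter F}
    (f : T -> 'M[R]_p) (g : T -> 'M[R]_q) (h : T -> sconst R p q)
    (A : 'M[R]_p) (B : 'M[R]_q) (M : sconst R p q) :
  f @ F --> A -> g @ F --> B -> h @ F --> M ->
  rho (f x) (g x) (h x) @[x --> F] --> rho A B M.
Proof.
move=> fA gB hM; apply: cvgD; first exact: cvg_mulmx.
apply: cvg_of_slices => k; apply: cvgD.
  by apply: cvg_mulmx; [exact: cvg_trmx|exact: cvg_slice].
by apply: cvg_mulmx => //; exact: cvg_slice.
Qed.

(** Modulo the grading element and up to scale, the symmetric pairs (s, b) form a compact set, on
    which rho(s, b) K does not vanish; by the tube lemma it does not vanish for M near K either. *)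
Lemma sym_rigid_near K : (0 < p)%N -> sym_rigid K -> \forall M \near K, sym_rigid M.
Proof.
move=> p0 rK.
have pR : p%:R != 0 :> R by rewrite pnatr_eq0 -lt0n.
pose box : set ('M[R]_p * 'M[R]_q) :=
  [set M : 'M[R]_p | forall i j, `|M i j| <= 1] `*`
  [set M : 'M[R]_q | forall i j, `|M i j| <= 1].
(* All the closed conditions (symmetry, zero trace, norm 1) are packed into one continuous function,
   so that the set is closed as a sublevel set. *)
pose g (x : 'M[R]_p * 'M[R]_q) : R := `|x.1 - x.1^T| + `|x.2 - x.2^T| + `|\tr x.1|
   + `| `|x.1| + `|x.2| - 1|.
pose S : set ('M[R]_p * 'M[R]_q) := g @^-1` [set y | y <= 0].
have gE x : S x -> [/\ x.1^T = x.1, x.2^T = x.2, \tr x.1 = 0 & `|x.1| + `|x.2| = 1].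
  rewrite /S /= /g => h.
  have := normr_ge0 (x.1 - x.1^T); have := normr_ge0 (x.2 - x.2^T).
  have := normr_ge0 (\tr x.1); have := normr_ge0 (`|x.1| + `|x.2| - 1) => h1 h2 h3 h4.
  have /eqP : `|x.1 - x.1^T| = 0 by lra.
  have /eqP : `|x.2 - x.2^T| = 0 by lra.
  have /eqP : `|\tr x.1| = 0 by lra.
  have /eqP : `| `|x.1| + `|x.2| - 1| = 0 by lra.
  rewrite !normr_eq0 !subr_eq0 => /eqP e1 /eqP e2 /eqP e3 /eqP e4.
  by rewrite -e3 -e4.
have cS : compact S.
  apply: (@subclosed_compact _ _ box).
  - apply: (preimage_closed _ (@closed_le _ _)) => x _.
    have h T (F : set_system T) (FF : Filter F) (f1 : T -> 'M[R]_p)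
        (f2 : T -> 'M[R]_q) (a : 'M[R]_p) (b : 'M[R]_q) :
        f1 @ F --> a -> f2 @ F --> b ->
        g (f1 y, f2 y) @[y --> F] --> g (a, b).
      move=> ha hb; apply: cvgD; first apply: cvgD; first apply: cvgD.
      - by apply: cvg_norm; apply: cvgB; [exact: ha|exact: cvg_trmx].
      - by apply: cvg_norm; apply: cvgB; [exact: hb|exact: cvg_trmx].
      - by apply: cvg_norm; apply: cvg_mxtrace.
      - apply: cvg_norm; apply: cvgB; last exact: cvg_cst.
        by apply: cvgD; apply: cvg_norm.
    by case: x => a b; apply: continuous_at_pair => T F FF f1 f2; exact: h.
  - by apply: compact_setX; apply: compact_mx_box.
  move=> x /gE [_ _ _ e]; split => i j.
    by apply: le_trans (norm_mx_ge _ _ _) _; rewrite -e lerDl.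
  by apply: le_trans (norm_mx_ge _ _ _) _; rewrite -e lerDr.
have key : \forall M \near K, forall x, S x -> rho x.1 x.2 M != 0.
  apply: (@compact_tube _ _ (nbhs K) _ S (fun M x => rho x.1 x.2 M != 0) cS) => x Sx.
  have n0 : rho x.1 x.2 K != 0.
    have [e1 e2 e3 e4] := gE _ Sx; apply/eqP => h.
    have [c [e5 e6]] := rK _ _ e1 e2 h.
    move: e3; rewrite e5 mxtrace_scalar => /eqP; rewrite mulrn_eq0 -[p == 0%N]negbK -lt0n p0 /=.
    move=> /eqP c0; move: e4; rewrite e5 e6 c0 mulr0 !raddf0 !normr0 addr0 => /eqP.
    by rewrite eq_sym oner_eq0.
  have h : rho y.1.1 y.1.2 y.2 @[y --> (nbhs x, nbhs K)] --> rho x.1 x.2 K.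
    apply: cvg_rho.
    - by apply: (@cvg_comp _ _ _ fst fst _ (nbhs x)); [exact: cvg_fst|case: x {Sx n0} => ? ?; exact: cvg_fst].
    - by apply: (@cvg_comp _ _ _ fst snd _ (nbhs x)); [exact: cvg_fst|case: x {Sx n0} => ? ?; exact: cvg_snd].
    - exact: cvg_snd.
  exact: cvg_mx_neq0 h n0.
apply: filterS key => M hM s b sS bS h.
pose c : R := \tr s / p%:R; exists c.
(* Subtracting a multiple of the grading element does not change [rho] and makes the first component
   trace-free. *)
pose s' := s - c%:M; pose b' := b + (2 * c)%:M.
have h' : rho s' b' M = 0.
  have -> : b' = b - (- 2 * c)%:M by rewrite /b' mulNr raddfN opprK.
  have := rhoD s' (b - (- 2 * c)%:M) c%:M (- 2 * c)%:M M.
  by rewrite !subrK h rho_grading addr0 => <-.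
have ts : \tr s' = 0.
  by rewrite /s' linearB /= mxtrace_scalar -[c *+ p]mulr_natr /c divfK // subrr.
pose r := `|s'| + `|b'|.
have [r0|r0] := eqVneq r 0.
  have hs : `|s'| = 0 by have := normr_ge0 s'; have := normr_ge0 b'; move: r0; rewrite /r; lra.
  have hb : `|b'| = 0 by have := normr_ge0 s'; have := normr_ge0 b'; move: r0; rewrite /r; lra.
  split; first by apply/eqP; rewrite -subr_eq0 -normr_eq0 hs.
  by rewrite mulNr raddfN /=; apply/eqP; rewrite -addr_eq0 -normr_eq0 hb.
have rp : 0 < r by rewrite lt_def r0 addr_ge0.
have Sr : S (r^-1 *: s', r^-1 *: b').
  rewrite /S /= /g /= !linearZ /= ts mulr0 normr0 addr0.
  have -> : s'^T = s' by rewrite /s' linearB /= tr_scalar_mx sS.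
  have -> : b'^T = b' by rewrite /b' linearD /= tr_scalar_mx bS.
  rewrite !scalerN !subrr !normr0 !add0r !normrZ -mulrDr -/r gtr0_norm ?invr_gt0 // mulVf //.
  by rewrite subrr normr0.
by have := hM _ Sr; rewrite /= rhoZ h' scaler0 eqxx.
Qed.

End Clifford.

(** * Rotations towards a Clifford system *)

Section Rotations.
Variables (R : realType) (p q : nat).
Implicit Types (K M N : sconst R p q).

Lemma trmxD m n (A B : 'M[R]_(m, n)) : (A + B)^T = A^T + B^T.
Proof. exact: linearD. Qed.

Lemma trmxB m n (A B : 'M[R]_(m, n)) : (A - B)^T = A^T - B^T.
Proof. exact: linearB. Qed.

Lemma mxtraceN n (A : 'M[R]_n) : \tr (- A) = - \tr A.
Proof. exact: linearN. Qed.

Lemma mxtraceD n (A B : 'M[R]_n) : \tr (A + B) = \tr A + \tr B.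
Proof. exact: linearD. Qed.

Lemma mxtrace_antisym3 n (A B C : 'M[R]_n) : A^T = - A -> B^T = - B -> C^T = - C ->
  \tr (A *m B *m C) = - \tr (C *m B *m A).
Proof.
move=> aA aB aC; rewrite -[LHS]mxtrace_tr !trmx_mul aA aB aC mulmxA mulmxN mulNmx mulmxN.
by rewrite opprK mxtraceN.
Qed.

Lemma norm_slice M k : `|slice M k| <= `|M|.
Proof. by apply/norm_mx_le => // i j; rewrite sliceE norm_mx_ge. Qed.

Lemma norm_orthmx n (Q : 'M[R]_n) : orthmx Q -> `|Q| <= 1.
Proof. by move=> oQ; apply/norm_mx_le => // i j; apply: orthmx_le1. Qed.

(* Two nearby Clifford systems are intertwined by an operator close to 1, obtained by
   averaging over the generators one at a time. *)
Lemma clifford_intertwiner : exists2 c : R, 0 <= c & forall K K',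
  clifford K -> clifford K' -> exists P : 'M[R]_p,
    (forall k, slice K' k *m P = P *m slice K k) /\ `|P - 1%:M| <= c * `|K' - K|.
Proof.
suff h m : (m <= q)%N -> exists2 c : R, 0 <= c & forall K K',
  clifford K -> clifford K' -> exists P : 'M[R]_p,
    (forall k : 'I_q, (k < m)%N -> slice K' k *m P = P *m slice K k) /\
    `|P - 1%:M| <= c * `|K' - K|.
  have [c c0 hc] := h q (leqnn q); exists c => // K K' cK cK'.
  have [P [hP nP]] := hc K K' cK cK'; exists P; split => // k; exact: hP.
elim: m => [_|m IH mq].
  by exists 0 => // K K' _ _; exists 1%:M; split => //; rewrite subrr normr0 mul0r.
have [c c0 hc] := IH (ltnW mq).
pose n : R := p%:R.
exists (2^-1 * (c + (n * n * c + n))).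
  by rewrite mulr_ge0 ?addr_ge0 // ?mulr_ge0.
move=> K K' cK cK'; have [P [hP nP]] := hc K K' cK cK'.
pose j := Ordinal mq; pose J := slice K j; pose J' := slice K' j.
have JJ : J *m J = - 1%:M by apply: clifford_sqr.
have JJ' : J' *m J' = - 1%:M by apply: clifford_sqr.
(* The average of P over the group generated by the new generator. It intertwines J with J', and it
   still intertwines the earlier generators because they anticommute with J and J'. *)
exists (2^-1 *: (P - J' *m P *m J)); split.
  move=> k; rewrite ltnS leq_eqVlt => /orP[/eqP kj|km].
    have -> : k = j by apply: val_inj.
    rewrite -/J -/J' -scalemxAr -scalemxAl; congr (_ *: _).
    rewrite mulmxBr mulmxBl !mulmxA JJ' -[_ *m J *m J]mulmxA JJ.
    by rewrite !mulNmx mulmxN !mul1mx !mulmx1 !opprK addrC.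
  have kj : (k == j) = false by apply/eqP => e; move: km; rewrite e ltnn.
  have a1 : slice K' k *m J' = - (J' *m slice K' k).
    by apply/eqP; rewrite -addr_eq0 cK'.2 kj mulr0n raddf0.
  have a2 : J *m slice K k = - (slice K k *m J).
    by apply/eqP; rewrite -addr_eq0 addrC cK.2 kj mulr0n raddf0.
  rewrite -scalemxAr -scalemxAl; congr (_ *: _).
  rewrite mulmxBr mulmxBl (hP _ km); congr (_ - _).
  rewrite !mulmxA a1 mulNmx mulNmx -[J' *m _ *m P]mulmxA (hP _ km).
  by rewrite -[_ *m J *m slice K k]mulmxA a2 mulmxN !mulmxA.
have -> : 2^-1 *: (P - J' *m P *m J) - 1%:M =
    2^-1 *: ((P - 1%:M) - (J' *m (P - 1%:M) *m J + (J' - J) *m J)).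
  rewrite mulmxBr mulmx1 mulmxBl addrAC mulmxBl JJ opprK.
  move: (J' *m P *m J) (J' *m J) => Y Z.
  by apply/matrixP => a b; rewrite !mxE; field.
rewrite normrZ (ger0_norm (x := 2^-1)) ?invr_ge0 //.
rewrite -[leRHS]mulrA; apply: ler_wpM2l; first by rewrite invr_ge0.
apply: le_trans (ler_normB _ _) _; rewrite [leRHS]mulrDl lerD //.
apply: le_trans (ler_normD _ _) _; rewrite [leRHS]mulrDl.
have nJ : `|J| <= 1 by apply: norm_orthmx; apply: clifford_orth.
have nJ' : `|J'| <= 1 by apply: norm_orthmx; apply: clifford_orth.
have n0 : 0 <= n by rewrite ler0n.
apply: lerD.
  apply: le_trans (norm_mulmx _ _) _; rewrite -/n.
  apply: (@le_trans _ _ (n * `|J' *m (P - 1%:M)|)).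
    by rewrite ler_piMr // mulr_ge0.
  rewrite -!mulrA ler_wpM2l //.
  apply: le_trans (norm_mulmx _ _) _; rewrite -/n -mulrA ler_wpM2l //.
  apply: le_trans nP; rewrite ler_piMl //.
apply: le_trans (norm_mulmx _ _) _; rewrite -/n.
apply: (@le_trans _ _ (n * `|J' - J|)); first by rewrite ler_piMr // mulr_ge0.
by rewrite ler_wpM2l // /J' /J -sliceB norm_slice.
Qed.

Lemma alphaBl K K' M : alpha (K - K') M = alpha K M - alpha K' M.
Proof.
rewrite /alpha -sumrB; apply: eq_bigr => k _.
by rewrite sliceB mulmxBr.
Qed.

(* With P the intertwiner, K' - K is to first order the infinitesimal rotation of K by
   the antisymmetric part X of P - 1. Symmetry of both alpha K M and alpha K' M makes
   K' - K orthogonal to the rotation of M by X, whence |K' - K|^2 <= small * |K' - K|^2. *)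
Lemma clifford_critical_unique K : clifford K -> exists2 eps : R, 0 < eps &
  forall K' M, clifford K' -> Wspace M -> `|K' - K| < eps -> `|M - K| < eps ->
    (alpha K M)^T = alpha K M -> (alpha K' M)^T = alpha K' M -> K' = K.
Proof.
move=> cK; have [c c0 hc] := clifford_intertwiner.
pose n : R := p%:R; have n0 : 0 <= n by rewrite ler0n.
pose C : R := q%:R * (n * (n * (n * c))).
have C0 : 0 <= C by rewrite /C !mulr_ge0.
(* With this value 3 C eps = 1 - eps < 1, so the final estimate |K' - K|^2 <= 3 C eps |K' - K|^2
   forces equality. *)
exists (3 * C + 1)^-1; first by rewrite invr_gt0 ltr_wpDl // mulr_ge0.
move=> K' M cK' /WspaceE wM; set eps := _^-1 => nK' nM sK sK'.
have [P [hP nP]] := hc K K' cK cK'.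
pose d k := slice (K' - K) k; pose dl := `|K' - K|.
have [u uE nu] : exists2 u, P = 1%:M + u & `|u| <= c * dl.
  by exists (P - 1%:M); rewrite // addrC subrK.
pose X := u - u^T.
have nX : `|X| <= 2 * (c * dl).
  by apply: le_trans (ler_normB _ _) _; rewrite norm_trmx mulrDl mul1r lerD.
have nd k : `|d k| <= dl by apply: norm_slice.
have aJ k : (slice K k)^T = - slice K k by apply: cK.1.
have ad k : (d k)^T = - d k.
  by rewrite /d sliceB linearB /= aJ cK'.1 opprB opprK addrC.
have e1 k : d k + d k *m u = u *m slice K k - slice K k *m u.
  have := hP k; rewrite uE mulmxDr mulmxDl mulmx1 mul1mx /d sliceB mulmxBl.
  move: (slice K' k *m u) (u *m slice K k) (slice K k *m u) => Y1 Y2 Y3 /matrixP e.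
  by apply/matrixP => a b; have := e a b; rewrite !mxE; lra.
have e2 k : d k + u^T *m d k = slice K k *m u^T - u^T *m slice K k.
  have := congr1 trmx (e1 k); rewrite trmxD trmxB !trmx_mul ad aJ.
  rewrite mulmxN !mulNmx mulmxN -opprD opprK => /(congr1 -%R); rewrite opprK => ->.
  by rewrite opprD opprK.
(* Adding the intertwining relation and its transpose leaves only the antisymmetric part X of u on
   the right. *)
have e3 k : d k + d k + (d k *m u + u^T *m d k) = X *m slice K k - slice K k *m X.
  have /matrixP h1 := e1 k; have /matrixP h2 := e2 k.
  rewrite /X mulmxBl mulmxBr; move: h1 h2.
  move: (d k *m u) (u^T *m d k) (u *m slice K k) (slice K k *m u) => Y1 Y2 Y3 Y4.
  move: (slice K k *m u^T) (u^T *m slice K k) (d k) => Y5 Y6 Y7 h1 h2.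
  by apply/matrixP => a b; have := h1 a b; have := h2 a b; rewrite !mxE; lra.
have aX : X^T = - X by exact: antisym_part.
clearbody X.
have t1 k : \tr (slice K k *m d k *m X) = \tr (d k *m d k) + \tr (d k *m d k *m u).
  have h1 : \tr (slice K k *m d k *m X) = \tr (d k *m (X *m slice K k)).
    by rewrite mulmxA mxtrace_mulC mulmxA mxtrace_mulC mulmxA.
  have h2 : \tr (slice K k *m d k *m X) = - \tr (d k *m (slice K k *m X)).
    by rewrite mxtrace_antisym3 // -mulmxA mxtrace_mulC mulmxA.
  have h3 : \tr (d k *m u^T *m d k) = \tr (d k *m d k *m u).
    rewrite -[LHS]mxtrace_tr !trmx_mul trmxK ad mulNmx !mulmxN opprK mulmxA.
    by rewrite mxtrace_mulC mulmxA.
  have := congr1 (fun Y => \tr (d k *m Y)) (e3 k).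
  rewrite /= !mulmxDr !mulmxN !mxtraceD mxtraceN !(mulmxA (d k)) h3.
  by move: h1 h2; rewrite !(mulmxA (d k)); lra.
have S0 : \sum_k \tr (slice M k *m d k *m X) = 0.
  have sym : (alpha (K' - K) M)^T = alpha (K' - K) M.
    by rewrite alphaBl linearB /= sK sK'.
  have : \tr (alpha (K' - K) M *m X) = 0.
    have := mxtrace_tr (alpha (K' - K) M *m X).
    by rewrite trmx_mul aX sym mulNmx linearN /= mxtrace_mulC; lra.
  rewrite /alpha mulmx_suml linear_sum /= => h; apply: oppr_inj.
  rewrite oppr0 -[RHS]h -sumrN; apply: eq_bigr => k _.
  by rewrite wM !mulNmx mxtraceN.
(* By [S0] the traces with M sum to 0. Writing M = K + (M - K) and using [t1] for the part with K
   leaves an identity whose right-hand side is of third order. *)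
have main : ip (K' - K) (K' - K) =
    \sum_k (\tr (d k *m d k *m u) + \tr ((slice (M - K) k) *m d k *m X)).
  have -> : \sum_k (\tr (d k *m d k *m u) + \tr (slice (M - K) k *m d k *m X)) =
     \sum_k (- \tr (d k *m d k) + \tr (slice M k *m d k *m X)).
    apply: eq_bigr => k _; rewrite sliceB !mulmxBl linearB /= t1; lra.
  rewrite big_split /= S0 addr0; apply: eq_bigr => k _.
  by rewrite -/(d k) ad mulNmx linearN.
have bound k : `|\tr (d k *m d k *m u) + \tr (slice (M - K) k *m d k *m X)| <=
    n * (n * (n * c)) * (dl ^+ 2 * 3 * eps).
  have b3 (Y Z V : 'M[R]_p) : `|\tr (Y *m Z *m V)| <= n * (n * (n * (`|Y| * `|Z| * `|V|))).
    apply: le_trans (norm_mxtrace _) _; rewrite -/n ler_wpM2l //.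
    apply: le_trans (norm_mulmx _ _) _; rewrite -/n -mulrA ler_wpM2l //.
    by rewrite mulrA ler_wpM2r // mulrA; apply: norm_mulmx.
  apply: le_trans (ler_normD _ _) _.
  apply: le_trans (lerD (b3 _ _ _) (b3 _ _ _)) _.
  rewrite -!mulrDr -!(mulrA n) !ler_wpM2l //.
  have le1 : `|d k| * `|d k| * `|u| <= dl * dl * (c * eps).
    apply: ler_pM => //; first by apply: ler_pM.
    by apply: le_trans nu _; rewrite ler_wpM2l // ltW.
  have le2 : `|slice (M - K) k| * `|d k| * `|X| <= eps * dl * (2 * (c * dl)).
    apply: ler_pM => //; apply: ler_pM => //.
    apply: le_trans (norm_slice _ _) _; exact: ltW.
  apply: le_trans (lerD le1 le2) _.
  by rewrite le_eqVlt; apply/orP; left; apply/eqP; ring.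
have fin : dl ^+ 2 <= 3 * C * eps * dl ^+ 2.
  apply: le_trans (norm_le_ip _) _; rewrite main.
  apply: le_trans (ler_norm _) _; apply: le_trans (ler_norm_sum _ _ _) _.
  apply: le_trans (ler_sum _ (fun k _ => bound k)) _.
  rewrite sumr_const card_ord -mulr_natl le_eqVlt; apply/orP; left; apply/eqP.
  by rewrite /C; ring.
have : dl ^+ 2 <= 0.
  have ep : 0 < 3 * C + 1 by rewrite ltr_wpDl // mulr_ge0.
  have : 3 * C * eps = 1 - eps by rewrite /eps; field; rewrite gt_eqF.
  move=> e; move: fin; rewrite e => fin.
  have e0 : 0 < eps by rewrite invr_gt0.
  have : eps * dl ^+ 2 <= 0 by lra.
  by rewrite pmulr_rle0.
rewrite real_exprn_even_le0 ?num_real //= normr_eq0 subr_eq0 => /eqP //.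
Qed.

Lemma cvg_ip T (F : set_system T) {FF : Filter F} (f g : T -> sconst R p q)
    (M N : sconst R p q) : f @ F --> M -> g @ F --> N -> ip (f x) (g x) @[x --> F] --> ip M N.
Proof.
move=> fM gN; apply: cvg_bigsum => k _; apply: cvg_mxtrace; apply: cvg_mulmx.
  by apply: cvg_trmx; apply: cvg_slice.
exact: cvg_slice.
Qed.

(** A maximiser exists by compactness. Its first variation along Cayley curves in each orthogonal
    group pairs [alpha], resp. [beta], to 0 with every antisymmetric matrix, which is symmetry. *)
Lemma nearest_rotation K M : Wspace K -> Wspace M ->
  exists A B, [/\ orthmx A, orthmx B,
    (alpha K (act A B M))^T = alpha K (act A B M),
    (beta K (act A B M))^T = beta K (act A B M) &
    forall A' B', orthmx A' -> orthmx B' -> ip K (act A' B' M) <= ip K (act A B M)].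
Proof.
move=> wK wM.
pose S : set ('M[R]_p * 'M[R]_q) := [set A | orthmx A] `*` [set B | orthmx B].
pose f (x : 'M[R]_p * 'M[R]_q) := ip K (act x.1 x.2 M).
have cf : {within S, continuous f}.
  apply: continuous_subspaceT => -[A B].
  apply: continuous_at_pair => T F FF f1 f2 h1 h2; apply: cvg_ip; first exact: cvg_cst.
  by apply: cvg_act => //; exact: cvg_cst.
have cS : compact S by apply: compact_setX; exact: compact_orthmx.
have [|[A B] + maxf] := compact_EVT_max _ cS cf.
  by exists (1%:M, 1%:M); split; apply: orthmx1.
rewrite inE => -[/= oA oB].
have maxf' A' B' : orthmx A' -> orthmx B' -> ip K (act A' B' M) <= ip K (act A B M).
  by move=> oA' oB'; apply: (maxf (A', B')); rewrite inE.
exists A, B; split => //.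
  have sym (Y : 'M[R]_p) : Y^T^T = Y^T -> Y^T = Y by rewrite trmxK => h; rewrite -h.
  apply/sym/mxtrace_antisym => X aX.
  have [C oC jC] := cayley aX.
  set N := act A B M.
  have wN : Wspace N by exact: Wspace_act.
  have jk k := jet_mxtrace (mjetM (mjet_cst (slice K k)^T)
     (mjetM (mjetM (mjet_tr jC) (mjet_cst (slice N k))) jC)).
  have j := jet_sum (index_enum 'I_q) (fun k (_ : predT k) => jk k).
  have := jet_max j ltr01; rewrite trmx1.
  under eq_bigr do rewrite !mul1mx !mulmx1.
  have -> : \sum_(k < q) \tr ((slice K k)^T *m slice N k) = ip K N by [].
  (* The variations in the two arguments of the bracket contribute equally, since all slices are
     antisymmetric. *)
  have eS : \sum_(i < q | predT i) \tr ((slice K i)^T *m (1%:M *m slice N i *m X +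
      (1%:M *m 0 + X^T *m slice N i) *m 1%:M) + 0 *m (1%:M *m slice N i *m 1%:M)) =
      2 * \tr (X *m (alpha K N)^T).
    rewrite /alpha linear_sum mulmx_sumr linear_sum /= mulr_sumr; apply: eq_big => // k _.
    have aK : (slice K k)^T = - slice K k by move/WspaceE: wK.
    have aN : (slice N k)^T = - slice N k by move/WspaceE: wN.
    rewrite mul1mx mulmx1 mulmx0 add0r mul0mx addr0 trmx_mul trmxK mulmxDr mxtraceD.
    have -> : \tr ((slice K k)^T *m (X^T *m slice N k)) = \tr ((slice K k)^T *m (slice N k *m X)).
      rewrite -[LHS]mxtrace_tr !trmx_mul !trmxK aN aK mulNmx [in RHS]mulNmx mulmxA.
      by rewrite !mulNmx !mxtraceN -[in RHS]mulmxA [in RHS]mxtrace_mulC.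
    have -> : \tr ((slice K k)^T *m (slice N k *m X)) = \tr (X *m ((slice K k)^T *m slice N k)).
      by rewrite mulmxA mxtrace_mulC.
    by ring.
  rewrite eS => h; suff : 2 * \tr (X *m (alpha K N)^T) = 0.
    by move=> /eqP; rewrite mulf_eq0 pnatr_eq0 /= => /eqP.
  apply: h => t _; rewrite (_ : \sum_(i < q) _ = ip K (act (A *m C t) B M)).
    by apply: maxf' => //; apply: orthmxM.
  apply: eq_bigr => k _; congr (\tr (_ *m _)).
  have -> : act (A *m C t) B M = act (C t) 1%:M N by rewrite act_comp mul1mx.
  by rewrite /act mul1mx slice_conjsc.
have sym (Y : 'M[R]_q) : Y^T^T = Y^T -> Y^T = Y by rewrite trmxK => h; rewrite -h.
apply/sym/mxtrace_antisym => X aX.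
have [C oC jC] := cayley aX.
set N := act A B M.
have j := jet_mxtrace (mjetM (mjet_cst K) (mjetM (mjet_cst N^T) (mjet_tr jC))).
have := jet_max j ltr01; rewrite trmx1 mulmx1 !mul0mx !addr0 => h.
rewrite /beta trmx_mul trmxK mxtrace_mulC -mulmxA -[X]opprK -aX !mulmxN linearN /= h ?oppr0 //.
move=> t _.
have eip N1 : \tr (K *m N1^T) = ip K N1 by rewrite ip_beta.
rewrite -trmx_mul !eip.
have -> : C t *m N = act A (C t *m B) M.
  by rewrite -[in RHS](mulmx1 A) -act_comp /act; apply: sliceP => k; rewrite slice_conjsc trmx1 mul1mx mulmx1.
by apply: maxf' => //; apply: orthmxM.
Qed.

End Rotations.

(** * Compatible tensors *)

Lemma near_lt (R : realType) T (F : set_system T) {FF : Filter F} (f : T -> R)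
    (a b : R) : f @ F --> a -> a < b -> \forall x \near F, f x < b.
Proof. by move=> fa ab; exact: cvgr_lt fa _ ab. Qed.

Lemma near_gt (R : realType) T (F : set_system T) {FF : Filter F} (f : T -> R)
    (a b : R) : f @ F --> a -> b < a -> \forall x \near F, b < f x.
Proof. by move=> fa ab; exact: cvgr_gt fa _ ab. Qed.

Lemma near_dist_lt (R : realType) T (F : set_system T) {FF : Filter F} m n
    (f : T -> 'M[R]_(m, n)) (a : 'M[R]_(m, n)) (e : R) :
  f @ F --> a -> 0 < e -> \forall x \near F, `|f x - a| < e.
Proof.
move=> fa e0; have h : `|f x - a| @[x --> F] --> `|a - a|.
  by apply: cvg_norm; apply: cvgB => //; exact: cvg_cst.
by apply: near_lt h _; rewrite subrr normr0.
Qed.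

Section Compatible.
Variables (R : realType) (p q : nat).
Implicit Types (K M N : sconst R p q).

Definition compat K M : Prop :=
  [/\ balanced M, (alpha K M)^T = alpha K M & (beta K M)^T = beta K M].

Lemma clifford_act K A B : orthmx A -> orthmx B -> clifford K -> clifford (act A B K).
Proof.
move=> oA oB [aK cK]; split.
  by move/WspaceE: (Wspace_act A B ((WspaceE K).2 aK)).
move=> k l; rewrite !slice_act.
have e (Y Z : 'M[R]_p) : A^T *m Y *m A *m (A^T *m Z *m A) = A^T *m (Y *m Z) *m A.
  by rewrite -!mulmxA (mulmxA A A^T) oA mul1mx.
rewrite !e -mulmxDl -mulmxDr.
have -> : (\sum_l0 B k l0 *: slice K l0) *m (\sum_l0 B l l0 *: slice K l0) +
   (\sum_l0 B l l0 *: slice K l0) *m (\sum_l0 B k l0 *: slice K l0) =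
   (- 2 *+ (k == l))%:M.
  rewrite !mulmx_suml.
  under eq_bigr do rewrite mulmx_sumr.
  under [X in _ + X]eq_bigr do rewrite mulmx_sumr.
  rewrite [X in _ + X]exchange_big -big_split /=.
  transitivity (\sum_i \sum_j (B k i * B l j) *: ((- 2 *+ (i == j))%:M : 'M[R]_p)).
    apply: eq_bigr => i _; rewrite -big_split; apply: eq_bigr => j _ /=.
    rewrite -cK -!scalemxAr -!scalemxAl !scalerA scalerDr; congr (_ + _).
    by rewrite mulrC.
  transitivity (\sum_i (B k i * B l i) *: ((- 2)%:M : 'M[R]_p)).
    apply: eq_bigr => i _; rewrite (bigD1 i) //= eqxx mulr1n big1 ?addr0 // => j ji.
    by rewrite eq_sym (negbTE ji) mulr0n raddf0 scaler0.
  rewrite -scaler_suml; have /matrixP /(_ k l) := oB; rewrite mxE => h.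
  have -> : \sum_i B k i * B l i = (k == l)%:R.
    by rewrite mxE in h; rewrite -h; apply: eq_bigr => i _; rewrite mxE.
  by rewrite scale_scalar_mx mulr_natl.
by rewrite mul_mx_scalar -scalemxAl (orthmxC oA) scalemx1.
Qed.

Lemma sym_rigid_act A B M : orthmx A -> orthmx B -> sym_rigid (act A B M) -> sym_rigid M.
Proof.
move=> oA oB h s b sS bS h0.
have [||| c [e1 e2]] := h (A^T *m s *m A) (B *m b *m B^T).
- by rewrite !trmx_mul trmxK sS mulmxA.
- by rewrite !trmx_mul trmxK bS mulmxA.
- rewrite rho_act // !mulmxA oA mul1mx (orthmxC oB) mul1mx -!mulmxA oA mulmx1.
  by rewrite (orthmxC oB) mulmx1 h0 act0.
exists c; split.
  have : A *m (A^T *m s *m A) *m A^T = s.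
    by rewrite !mulmxA oA mul1mx -mulmxA oA mulmx1.
  by rewrite e1 mul_mx_scalar -scalemxAl oA scalemx1 => <-.
have : B^T *m (B *m b *m B^T) *m B = b.
  by rewrite !mulmxA (orthmxC oB) mul1mx -mulmxA (orthmxC oB) mulmx1.
by rewrite e2 mul_mx_scalar -scalemxAl (orthmxC oB) scalemx1 => <-.
Qed.

Lemma alpha_act_sym A B K M : orthmx A -> orthmx B ->
  (alpha (act A B K) (act A B M))^T = alpha (act A B K) (act A B M) ->
  (alpha K M)^T = alpha K M.
Proof.
move=> oA oB; rewrite alpha_act // !trmx_mul trmxK => /(congr1 (fun Y => A *m Y *m A^T)).
by rewrite /= !mulmxA oA !mul1mx -!mulmxA oA !mulmx1.
Qed.

Lemma norm_ip_lt K M (e : R) : 0 < e -> ip (M - K) (M - K) < e ^+ 2 -> `|M - K| < e.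
Proof.
move=> e0 h; have := le_lt_trans (norm_le_ip (M - K)) h.
by rewrite ltr_pXn2r ?nnegrE // ltW.
Qed.

Lemma ip_sqrC M N : ip (M - N) (M - N) = ip (N - M) (N - M).
Proof. by rewrite -(opprB N M) ipNl ipC ipNl opprK. Qed.

Lemma ip_eq0 M : ip M M = 0 -> M = 0.
Proof.
move=> h; have := norm_le_ip M; rewrite h.
by rewrite real_exprn_even_le0 ?num_real //= normr_eq0 => /eqP.
Qed.

(** The topology is that of the largest-entry norm, whereas only the norm of [ip] is invariant under
    rotations; this lemma and [norm_ip_lt] pass from one to the other. *)
Lemma ip_norm_lt (e : R) : 0 < e -> exists2 d : R, 0 < d &
  forall K M, `|M - K| < d -> ip (M - K) (M - K) < e ^+ 2.
Proof.
move=> e0; pose n : R := (q * (p * p))%:R; pose d := e / (n + 1).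
have n0 : 0 <= n by rewrite ler0n.
have n1 : 0 < n + 1 by rewrite ltr_wpDl.
exists d => [|K M h]; first by rewrite divr_gt0.
apply: le_lt_trans (ip_le_norm _) _; rewrite -/n.
have : `|M - K| ^+ 2 <= d ^+ 2 by rewrite lerXn2r ?nnegrE // ltW // divr_gt0.
have -> : d ^+ 2 = e ^+ 2 / (n + 1) ^+ 2 by rewrite /d expr_div_n.
have e2 : 0 < e ^+ 2 by rewrite exprn_gt0.
have n2 : 0 < (n + 1) ^+ 2 by rewrite exprn_gt0.
rewrite ler_pdivlMr // => h2.
rewrite -(ltr_pM2r n2); apply: (@le_lt_trans _ _ (n * e ^+ 2)).
  by rewrite -mulrA ler_wpM2l.
by rewrite mulrC ltr_pM2l // expr2; nra.
Qed.

(** By [balanced_unique], (A, B) is orthogonal up to a homothety, so K' = (A, B)^-1 K is again a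
    Clifford system and M is critical for both K and K'. They coincide once K' is near K, which
    either alternative ensures: the first serves the uniqueness of the selected bracket, the second
    local uniqueness. *)
Lemma compat_unique K : (0 < p)%N -> odd q -> clifford K -> unit_volume K ->
  exists2 eps : R, 0 < eps & forall M A B,
    A \in unitmx -> B \in unitmx -> Wspace M -> compat K M -> compat K (act A B M) ->
    `|M - K| < eps ->
    `|act A B M - K| < eps \/ `|act (invmx A) (invmx B) K - K| < eps ->
    act A B K = K.
Proof.
move=> p0 oq cK vK.
have [e1 e10 uniq] := clifford_critical_unique cK.
have rK := sym_rigid_near p0 (clifford_rigid p0 oq cK vK).
have [e2 e20 rig] : exists2 e2 : R, 0 < e2 & forall M, `|M - K| < e2 -> sym_rigid M.
  have /nbhs_normP [e2 /= e20 h] := rK.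
  by exists e2 => // M hM; apply: h; rewrite /= distrC.
have e1h : 0 < e1 / 2 by rewrite divr_gt0.
have [e3 e30 hip] := ip_norm_lt e1h.
exists (Num.min (Num.min e1 e2) (Num.min (e1 / 2) e3)).
  by rewrite !lt_min e10 e20 e1h e30.
move=> M A B uA uB wM cM cM'; rewrite lt_min => /andP[]; rewrite !lt_min.
move=> /andP[nM1 nM2] /andP[nM3 nM4] nor.
have [bM aM _] := cM; have [bM' aM' _] := cM'.
have [a [U1 [U2 [a0 oU1 oU2 eA eB]]]] :=
  balanced_unique wM (rig _ nM2) uA uB bM bM'.
have an0 : a != 0 by rewrite gt_eqF.
have eact N : act A B N = act U1 U2 N by rewrite eA eB act_homothety.
pose K' := act U1^T U2^T K.
have K'E : act (invmx A) (invmx B) K = K'.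
  rewrite -[LHS](act_orthKV _ oU1 oU2); congr act.
  by rewrite -eact actVK.
have actK' : act U1 U2 K' = K by rewrite /K' act_orthK.
have nK' : `|K' - K| < e1.
  case: nor; rewrite ?K'E; last by move=> /andP[/andP[]].
  move=> /andP[_ /andP[_ h]].
  (* A rotation carries (K', M) to (K, [act A B M]), so the [ip]-distance of the first pair is that
     of the second. *)
  have h1 : `|K' - M| < e1 / 2.
    apply: norm_ip_lt => //; rewrite -(ip_act _ _ oU1 oU2) actB actK' -eact.
    by rewrite ip_sqrC; exact: hip.
  have -> : K' - K = (K' - M) + (M - K) by rewrite addrA subrK.
  apply: le_lt_trans (ler_normD _ _) _.
  by have := ltrD h1 nM3; rewrite -splitr.
have : K' = K.
  apply: (uniq K' M) => //; first exact: clifford_act (orthmxT oU1) (orthmxT oU2) cK.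
  by apply: (alpha_act_sym oU1 oU2); rewrite actK' -eact.
by move=> KK; rewrite eact -[in LHS]KK actK'.
Qed.

(** * Existence of balanced frames *)

(** The square norm of the moment map. The weight 1/2 balances the two components, so that the
    gradient is a multiple of [rho] applied to the moment map ([jet_defect]). *)
Definition defect M : R :=
  \tr ((alpha M M - q%:R%:M)^T *m (alpha M M - q%:R%:M)) +
  2^-1 * \tr ((beta M M - p%:R%:M)^T *m (beta M M - p%:R%:M)).

(** The defect does not see the homotheties (a, a^-2); the second term fixes a. *)
Definition objective M (x : 'M[R]_p * 'M[R]_q) : R :=
  defect (act x.1 x.2 M) + (\tr (x.1 *m x.1^T) - p%:R) ^+ 2.

Lemma alphaT M : (alpha M M)^T = alpha M M.
Proof.
by rewrite /alpha linear_sum; apply: eq_bigr => k _; rewrite /= trmx_mul trmxK.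
Qed.

Lemma betaT M : (beta M M)^T = beta M M.
Proof. by rewrite /beta trmx_mul trmxK. Qed.

Lemma defect_ge0 M : 0 <= defect M.
Proof. by rewrite addr_ge0 ?mulr_ge0 ?mxtrace_sqr_ge0 ?invr_ge0. Qed.

Lemma defect_eq0 M : defect M <= 0 -> balanced M.
Proof.
move=> h; have h1 := mxtrace_sqr_ge0 (alpha M M - q%:R%:M).
have h2 := mxtrace_sqr_ge0 (beta M M - p%:R%:M); move: h; rewrite /defect => h.
split; apply/eqP; rewrite -subr_eq0; apply/eqP; apply: mxtrace_sqr_eq0; lra.
Qed.

Lemma balanced_defect M : balanced M -> defect M = 0.
Proof. by move=> [h1 h2]; rewrite /defect h1 h2 !subrr !mulmx0 !linear0 mulr0 addr0. Qed.

Lemma ip_lie (P : 'M[R]_p) M N : P^T = P -> Wspace M -> Wspace N ->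
  ip (lie P M) N =
  \tr (P *m (\sum_k ((slice M k)^T *m slice N k + (slice N k)^T *m slice M k))).
Proof.
move=> sP /WspaceE aM /WspaceE aN.
rewrite mulmx_sumr linear_sum; apply: eq_bigr => k _ /=.
rewrite slice_of trmxD !trmx_mul trmxK mulmxDr mulmxDl !mxtraceD aM aN sP.
rewrite !mulNmx !mulmxN mulNmx !mxtraceN addrC; congr (- _ + - _).
  by rewrite mulmxA.
have cyc (X Y Z : 'M[R]_p) : \tr (X *m Y *m Z) = \tr (Y *m (Z *m X)).
  by rewrite -mulmxA mxtrace_mulC mulmxA.
exact: cyc.
Qed.

(** The derivative of the moment map is, up to a factor, the adjoint of the infinitesimal action;
    hence the pairing of two values of [rho]. *)
Lemma jet_defect M (v : 'M[R]_p) (w : 'M[R]_q) : Wspace M ->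
  jet (fun t => defect (act (1%:M + t *: v) (1%:M + t *: w) M)) (defect M)
    (2 * ip (rho (alpha M M - q%:R%:M) (beta M M - p%:R%:M) M) (rho v w M)).
Proof.
move=> wM; have aM k : (slice M k)^T = - slice M k by move/WspaceE: wM.
pose N := rho v w M.
have aN k : (slice N k)^T = - slice N k by move/WspaceE: (Wspace_rho v w wM).
pose S t := act (1%:M + t *: v) (1%:M + t *: w) M.
have jS k : mjet (fun t => slice (S t) k) (slice M k) (slice N k).
  have j1 : mjet (fun t => slice ((1%:M + t *: w) *m M) k) (slice M k) (slice (w *m M) k).
    have j0 := mjetM (mjet_line w) (mjet_cst M).
    rewrite mul1mx mulmx0 add0r in j0.
    move=> i j; rewrite !sliceE; apply: jet_ext (j0 k (mxvec_index i j)) => t.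
    by rewrite sliceE.
  have := mjetM (mjetM (mjet_tr (mjet_line v)) j1) (mjet_line v).
  rewrite trmx1 !mul1mx !mulmx1 => h.
  have -> : slice N k = slice M k *m v + (slice (w *m M) k + v^T *m slice M k).
    by rewrite /N /rho sliceD slice_of addrA [LHS]addrC.
  by move=> i j; apply: jet_ext (h i j) => t; rewrite /S /act slice_conjsc.
pose P1 := alpha M M - q%:R%:M; pose P2 := beta M M - p%:R%:M.
have sP1 : P1^T = P1 by rewrite /P1 trmxB alphaT tr_scalar_mx.
have sP2 : P2^T = P2 by rewrite /P2 trmxB betaT tr_scalar_mx.
have jA : mjet (fun t => alpha (S t) (S t) - q%:R%:M) P1
    (\sum_k ((slice M k)^T *m slice N k + (slice N k)^T *m slice M k)).
  have h := @mjet_sum R p p _ (index_enum 'I_q) predT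
    (fun k t => (slice (S t) k)^T *m slice (S t) k) _ _
    (fun k _ => mjetM (mjet_tr (jS k)) (jS k)).
  have := mjetD h (mjet_cst (- q%:R%:M)); rewrite addr0; apply.
have jSm : mjet S M N.
  move=> k c; case/mxvec_indexP: c => i j.
  by rewrite -!sliceE; apply: jet_ext (jS k i j) => t; rewrite sliceE.
have jB : mjet (fun t => beta (S t) (S t) - p%:R%:M) P2 (M *m N^T + N *m M^T).
  have := mjetD (mjetM jSm (mjet_tr jSm)) (mjet_cst (- p%:R%:M)).
  by rewrite addr0; apply.
have j := jetD (jet_mxtrace (mjetM (mjet_tr jA) jA))
   (jetM (jet_cst 2^-1) (jet_mxtrace (mjetM (mjet_tr jB) jB))).
set D := (X in jet _ _ X) in j; suff e : D = 2 * ip (rho P1 P2 M) N by rewrite -e; exact: j.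
rewrite /D mul0r addr0 sP1 sP2.
have trs n (Y Z : 'M[R]_n) : Y^T = Y -> \tr (Z^T *m Y) = \tr (Y *m Z).
  by move=> sY; rewrite -[LHS]mxtrace_tr trmx_mul trmxK sY.
rewrite !mxtraceD !trs //.
have -> : ip (rho P1 P2 M) N = \tr (P2 *m (M *m N^T)) + ip (lie P1 M) N.
  rewrite /rho ipDl; congr (_ + _).
  by rewrite ip_beta /beta mulmxA.
have -> : \tr (P2 *m (M *m N^T + N *m M^T)) = 2 * \tr (P2 *m (M *m N^T)).
  rewrite mulmxDr mxtraceD.
  have -> : \tr (P2 *m (N *m M^T)) = \tr (P2 *m (M *m N^T)).
    by rewrite -(trs _ P2 _ sP2) trmx_mul trmxK mxtrace_mulC.
  by ring.
rewrite -ip_lie //; last exact: Wspace_rho.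
by field.
Qed.

(** In the direction opposite to the moment map (P1, P2) the slope is -2 |rho(P1, P2) N|^2, so
    minimality makes (P1, P2) an element of the stabiliser of N, and rigidity applies. *)
Lemma balanced_of_minimum M (x : 'M[R]_p * 'M[R]_q) :
  (0 < p)%N -> x.1 \in unitmx -> Wspace M -> sym_rigid (act x.1 x.2 M) ->
  (forall v w, exists2 d : R, 0 < d & forall t, `|t| <= d ->
     objective M x <= objective M (x.1 *m (1%:M + t *: v), (1%:M + t *: w) *m x.2)) ->
  balanced (act x.1 x.2 M).
Proof.
case: x => A B /= p0 uA wM rig minx.
have pq : q%:R *+ p = p%:R *+ q :> R by rewrite -!mulrnA mulnC.
set N := act A B M in rig *.
have wN : Wspace N by exact: Wspace_act.
pose P1 := alpha N N - q%:R%:M; pose P2 := beta N N - p%:R%:M.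
have sP1 : P1^T = P1 by rewrite /P1 trmxB alphaT tr_scalar_mx.
have sP2 : P2^T = P2 by rewrite /P2 trmxB betaT tr_scalar_mx.
have trA : \tr (A *m A^T) != 0.
  apply/eqP => h; have : A^T = 0 by apply: mxtrace_sqr_eq0; rewrite trmxK h.
  move=> /(congr1 trmx); rewrite trmxK trmx0 => A0.
  have := mulmxV uA; rewrite A0 mul0mx => /matrixP /(_ (Ordinal p0) (Ordinal p0)).
  by rewrite !mxE eqxx => /eqP; rewrite eq_sym oner_eq0.
(* Adding c times the grading element leaves [rho] unchanged; this c makes the trace penalty
   stationary along (v, w). *)
pose c := \tr (A *m P1 *m A^T) / \tr (A *m A^T).
pose v := c%:M - P1; pose w := (- 2 * c)%:M - P2.
have [d d0 hd] := minx v w.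
have jdef := jet_defect v w wN.
have jtr : jet (fun t => \tr ((A *m (1%:M + t *: v)) *m (A *m (1%:M + t *: v))^T))
    (\tr (A *m A^T)) 0.
  have j0 := mjetM (mjet_cst A) (mjet_line v).
  have := jet_mxtrace (mjetM j0 (mjet_tr j0)); rewrite mulmx1 mul0mx addr0.
  have -> : \tr (A *m (A *m v)^T + A *m v *m A^T) = 0 => //.
  have e : \tr (A *m v *m A^T) = 0.
    rewrite /v mulmxBr mulmxBl linearB /= mul_mx_scalar -scalemxAl linearZ /= /c.
    by rewrite divfK // subrr.
  rewrite mxtraceD e addr0 -[LHS]mxtrace_tr trmx_mul trmxK.
  exact: e.
have jpen := jetD jtr (jet_cst (- p%:R)).
have j := jetD jdef (jetM jpen jpen).
rewrite !addr0 mulr0 mul0r !addr0 in j.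
have slope : 2 * ip (rho P1 P2 N) (rho v w N) = - 2 * ip (rho P1 P2 N) (rho P1 P2 N).
  have -> : rho v w N = - rho P1 P2 N.
    have := rhoD v w P1 P2 N; rewrite /v /w !subrK rho_grading => /esym/eqP.
    by rewrite addr_eq0 => /eqP.
  by rewrite -[- rho _ _ _]sub0r ipBr -(subrr N) ; rewrite ipBr subrr sub0r; ring.
have r0 : rho P1 P2 N = 0.
  have /eqP b0 : 2 * ip (rho P1 P2 N) (rho v w N) = 0.
    apply/eqP/negP => /negP b0; have [t td] := jet_decr j b0 d0.
    apply/negP; rewrite -leNgt; have := hd t td; rewrite /objective /= -/N.
    rewrite -expr2 -act_comp -/N -expr2; apply.
  apply: ip_eq0; apply/eqP; move/eqP: slope; rewrite (eqP b0) eq_sym mulf_eq0.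
  by rewrite oppr_eq0 pnatr_eq0.
have [c' [e1 e2]] := rig _ _ sP1 sP2 r0.
(* Both [alpha N N] and [beta N N] have trace |N|^2, and both normalising scalars have trace pq; a
   multiple c' of the grading element has traces c' p and -2 c' q, so c' = 0. *)
have tt : \tr P1 = \tr P2.
  rewrite /P1 /P2 !linearB /= -ip_alpha -ip_beta !mxtrace_scalar.
  by rewrite pq.
have c0 : c' = 0.
  move: tt; rewrite e1 e2 !mxtrace_scalar -(mulr_natr _ p) -(mulr_natr _ q) => /eqP.
  have -> : (c' * p%:R == - 2 * c' * q%:R) = (c' * (p + 2 * q)%:R == 0).
    by rewrite -subr_eq0 natrD natrM; congr (_ == _); ring.
  by rewrite mulf_eq0 pnatr_eq0 addn_eq0 -[p == 0%N]negbK -lt0n p0 orbF => /eqP.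
split; apply/eqP; rewrite -subr_eq0; [rewrite -/P1 e1|rewrite -/P2 e2];
  by rewrite c0 ?mulr0 raddf0.
Qed.

Lemma cvg_alpha T (F : set_system T) {FF : Filter F} (f g : T -> sconst R p q)
    (M N : sconst R p q) :
  f @ F --> M -> g @ F --> N -> alpha (f x) (g x) @[x --> F] --> alpha M N.
Proof.
move=> fM gN; apply: cvg_bigsum => k _; apply: cvg_mulmx.
  by apply: cvg_trmx; apply: cvg_slice.
exact: cvg_slice.
Qed.

Lemma cvg_beta T (F : set_system T) {FF : Filter F} (f g : T -> sconst R p q)
    (M N : sconst R p q) :
  f @ F --> M -> g @ F --> N -> beta (f x) (g x) @[x --> F] --> beta M N.
Proof. by move=> fM gN; apply: cvg_mulmx => //; exact: cvg_trmx. Qed.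

Lemma cvg_objective T (F : set_system T) {FF : Filter F}
    (h : T -> sconst R p q) (f : T -> 'M[R]_p) (g : T -> 'M[R]_q)
    (M : sconst R p q) (A : 'M[R]_p) (B : 'M[R]_q) :
  h @ F --> M -> f @ F --> A -> g @ F --> B ->
  objective (h x) (f x, g x) @[x --> F] --> objective M (A, B).
Proof.
move=> hM fA gB.
have ha : act (f x) (g x) (h x) @[x --> F] --> act A B M by apply: cvg_act.
have sq n (Y : T -> 'M[R]_n) (Z : 'M[R]_n) : Y @ F --> Z ->
    \tr ((Y x)^T *m Y x) @[x --> F] --> \tr (Z^T *m Z).
  by move=> YZ; apply: cvg_mxtrace; apply: cvg_mulmx => //; apply: cvg_trmx.
have h1 : alpha (act (f x) (g x) (h x)) (act (f x) (g x) (h x)) - q%:R%:M @[x --> F] -->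
    alpha (act A B M) (act A B M) - q%:R%:M.
  by apply: cvgB; [exact: cvg_alpha|exact: cvg_cst].
have h2 : beta (act (f x) (g x) (h x)) (act (f x) (g x) (h x)) - p%:R%:M @[x --> F] -->
    beta (act A B M) (act A B M) - p%:R%:M.
  by apply: cvgB; [exact: cvg_beta|exact: cvg_cst].
have h3 : \tr (f x *m (f x)^T) - p%:R @[x --> F] --> \tr (A *m A^T) - p%:R.
  apply: cvgB; last exact: cvg_cst.
  by apply: cvg_mxtrace; apply: cvg_mulmx => //; apply: cvg_trmx.
apply: cvgD; last by apply: cvgM.
apply: cvgD; first exact: sq.
by apply: cvgM; [exact: cvg_cst|exact: sq].
Qed.

(** For the largest-entry norm |v (1 - S)| <= n |v| |1 - S|; this radius is below 1 / n for both n =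
    p and n = q, so S is invertible. *)
Definition radius : R := (p + q).+1%:R^-1.

(** The order of the factors, A A^T but B^T B, makes the set invariant under (A, B) -> (A U, V B)
    with U, V orthogonal. *)
Definition near_orth : set ('M[R]_p * 'M[R]_q) :=
  [set x | `|x.1 *m x.1^T - 1%:M| <= radius /\ `|x.2^T *m x.2 - 1%:M| <= radius].

Lemma radius_gt0 : 0 < radius.
Proof. by rewrite invr_gt0 ltr0n. Qed.

Lemma near_id_unit n (S : 'M[R]_n) : (n <= p + q)%N -> `|S - 1%:M| <= radius -> S \in unitmx.
Proof.
move=> npq hS; apply: unitmx_inj => v vS.
have e : v = v *m (1%:M - S) by rewrite mulmxBr mulmx1 vS subr0.
have h : `|v| <= n%:R * radius * `|v|.
  rewrite {1}e; apply: le_trans (norm_mulmx _ _) _.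
  by rewrite mulrAC ler_wpM2r // ler_wpM2l // distrC.
have n1 : n%:R * radius < 1.
  by rewrite /radius -ltr_pdivlMr ?invr_gt0 ?ltr0n // invrK mul1r ltr_nat ltnS.
apply/eqP; rewrite -normr_eq0; apply/eqP.
have := normr_ge0 v; nra.
Qed.

Lemma near_orth_unit x : near_orth x -> x.1 \in unitmx /\ x.2 \in unitmx.
Proof.
move=> [h1 h2]; split.
  by have := near_id_unit (leq_addr _ _) h1; rewrite unitmx_mul => /andP[].
by have := near_id_unit (leq_addl _ _) h2; rewrite unitmx_mul => /andP[].
Qed.

Lemma near_orth_mul x U V : orthmx U -> orthmx V -> near_orth x ->
  near_orth (x.1 *m U, V *m x.2).
Proof.
move=> oU oV [h1 h2]; split => /=.
  by rewrite trmx_mul -mulmxA (mulmxA U) oU mul1mx.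
by rewrite trmx_mul -mulmxA (mulmxA V^T) (orthmxC oV) mul1mx.
Qed.

Lemma cvg_defect1 T (F : set_system T) {FF : Filter F}
    (f : T -> 'M[R]_p) (A : 'M[R]_p) : f @ F --> A ->
  `|f x *m (f x)^T - 1%:M| @[x --> F] --> `|A *m A^T - 1%:M|.
Proof.
move=> fA; apply: cvg_norm; apply: cvgB; last exact: cvg_cst.
by apply: cvg_mulmx => //; apply: cvg_trmx.
Qed.

Lemma cvg_defect2 T (F : set_system T) {FF : Filter F}
    (f : T -> 'M[R]_q) (A : 'M[R]_q) : f @ F --> A ->
  `|(f x)^T *m f x - 1%:M| @[x --> F] --> `|A^T *m A - 1%:M|.
Proof.
move=> fA; apply: cvg_norm; apply: cvgB; last exact: cvg_cst.
by apply: cvg_mulmx => //; apply: cvg_trmx.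
Qed.

Lemma compact_near_orth : compact near_orth.
Proof.
have r1 : radius <= 1 by rewrite invf_le1 ?ltr0n // ler1n.
have ent n (A : 'M[R]_n) i j : `|A *m A^T - 1%:M| <= radius -> `|A i j| <= 2.
  move=> h; have := le_trans (norm_mx_ge _ i i) (le_trans h r1).
  rewrite !mxE eqxx ler_norml => /andP[_]; rewrite lerBlDr => h2.
  have : A i j ^+ 2 <= 2.
    rewrite -[2]/(1 + 1); apply: le_trans h2; rewrite (bigD1 j) //= mxE -expr2 lerDl.
    by apply: sumr_ge0 => l _; rewrite mxE -expr2 sqr_ge0.
  rewrite ler_norml => h3; apply/andP; split; nra.
apply: (@subclosed_compact _ _ ([set M : 'M[R]_p | forall i j, `|M i j| <= 2] `*`
    [set M : 'M[R]_q | forall i j, `|M i j| <= 2])).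
- have -> : near_orth = (fun x : 'M[R]_p * 'M[R]_q => `|x.1 *m x.1^T - 1%:M|) @^-1` [set y | y <= radius]
      `&` (fun x : 'M[R]_p * 'M[R]_q => `|x.2^T *m x.2 - 1%:M|) @^-1` [set y | y <= radius] by [].
  apply: closedI; apply: (preimage_closed _ (@closed_le _ _)) => -[A B] _.
    by apply: continuous_at_pair => T F FF f1 f2 h1 h2; exact: cvg_defect1.
  by apply: continuous_at_pair => T F FF f1 f2 h1 h2; exact: cvg_defect2.
- by apply: compact_setX; apply: compact_mx_box.
move=> [A B] [/= h1 h2]; split => i j /=; first exact: ent.
by rewrite -[B]trmxK mxE; apply: ent; rewrite trmxK.
Qed.

Lemma near_orth1 : near_orth (1%:M, 1%:M).
Proof.
by split; rewrite /= trmx1 mulmx1 subrr normr0 ltW // radius_gt0.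
Qed.

(** A minimiser over [near_orth] is useful only in the interior. The tube statement ensures this:
    for M near K, every point that does at least as well as the identity satisfies the defining
    inequalities strictly. *)
Lemma balanced_exists K (e : R) : (0 < p)%N -> odd q -> clifford K -> unit_volume K ->
  0 < e -> \forall M \near K, Wspace M -> exists2 x, near_orth x &
    balanced (act x.1 x.2 M) /\
    exists U V, [/\ orthmx U, orthmx V & `|act U V (act x.1 x.2 M) - K| < e].
Proof.
move=> p0 oq cK vK e0.
have rK := clifford_rigid p0 oq cK vK.
have wK : Wspace K by apply/WspaceE; exact: cK.1.
have bK := clifford_balanced cK.
pose good (M : sconst R p q) (x : 'M[R]_p * 'M[R]_q) :=
  [/\ `|x.1 *m x.1^T - 1%:M| < radius, `|x.2^T *m x.2 - 1%:M| < radius,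
    sym_rigid (act x.1 x.2 M) &
    exists U V, [/\ orthmx U, orthmx V & `|act U V (act x.1 x.2 M) - K| < e]].
have tube : \forall M \near K, forall x, near_orth x ->
    objective M x <= objective M (1%:M, 1%:M) -> good M x.
  apply: (@compact_tube _ _ (nbhs K) _ near_orth
    (fun M x => objective M x <= objective M (1%:M, 1%:M) -> good M x) compact_near_orth).
  case=> A B xG; have [/= uA uB] := near_orth_unit xG.
  have c1 : z.1.1 @[z --> (nbhs (A, B), nbhs K)] --> A.
    by apply: (@cvg_comp _ _ _ fst fst _ (nbhs (A, B))); exact: cvg_fst.
  have c2 : z.1.2 @[z --> (nbhs (A, B), nbhs K)] --> B.
    by apply: (@cvg_comp _ _ _ fst snd _ (nbhs (A, B))); [exact: cvg_fst|exact: cvg_snd].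
  have c3 : z.2 @[z --> (nbhs (A, B), nbhs K)] --> K by exact: cvg_snd.
  (* Where the objective of K vanishes, uniqueness of balanced tensors and the trace penalty make A
     and B orthogonal, so the conditions of [good] persist near (A, B). Where it is positive, (A, B)
     loses against the identity for M near K. *)
  have [F0|F0] := leP (objective K (A, B)) 0.
    have d0 := defect_ge0 (act A B K); have s0 := sqr_ge0 (\tr (A *m A^T) - p%:R).
    have bA : balanced (act A B K).
      by apply: defect_eq0; move: F0; rewrite /objective /=; lra.
    have tA : \tr (A *m A^T) = p%:R.
      have : (\tr (A *m A^T) - p%:R) ^+ 2 <= 0 by move: F0; rewrite /objective /=; lra.
      by rewrite real_exprn_even_le0 ?num_real //= subr_eq0 => /eqP.
    have [a [U1 [U2 [a0 oU1 oU2 eA eB]]]] := balanced_unique wK rK uA uB bK bA.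
    have a1 : a = 1.
      move: tA; rewrite eA linearZ /= -scalemxAl -scalemxAr scalerA oU1 linearZ /= mxtrace1.
      move=> h; have pR : p%:R != 0 :> R by rewrite pnatr_eq0 -lt0n.
      have : a * a = 1 by apply: (mulIf pR); rewrite h mul1r.
      by nra.
    have oA : orthmx A by rewrite eA a1 scale1r.
    have oB : orthmx B by rewrite eB a1 expr1n invr1 scale1r.
    have n1 : \forall z \near (nbhs (A, B), nbhs K), `|z.1.1 *m z.1.1^T - 1%:M| < radius.
      have h : `|z.1.1 *m z.1.1^T - 1%:M| @[z --> (nbhs (A, B), nbhs K)] --> (0 : R).
        have -> : 0 = `|A *m A^T - 1%:M| by rewrite oA subrr normr0.
        exact: cvg_defect1.
      exact: near_lt h radius_gt0.
    have n2 : \forall z \near (nbhs (A, B), nbhs K), `|z.1.2^T *m z.1.2 - 1%:M| < radius.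
      have h : `|z.1.2^T *m z.1.2 - 1%:M| @[z --> (nbhs (A, B), nbhs K)] --> (0 : R).
        have -> : 0 = `|B^T *m B - 1%:M| by rewrite orthmxC // subrr normr0.
        exact: cvg_defect2.
      exact: near_lt h radius_gt0.
    have cU : act A^T B^T (act z.1.1 z.1.2 z.2) @[z --> (nbhs (A, B), nbhs K)] --> K.
      rewrite -[X in _ --> X](act_orthKV K oA oB).
      by apply: cvg_act; [exact: cvg_cst|exact: cvg_cst|exact: cvg_act].
    have n3 : \forall z \near (nbhs (A, B), nbhs K),
        sym_rigid (act A^T B^T (act z.1.1 z.1.2 z.2)).
      exact: (cU _ (sym_rigid_near p0 rK)).
    have n4 : \forall z \near (nbhs (A, B), nbhs K),
        `|act A^T B^T (act z.1.1 z.1.2 z.2) - K| < e.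
      exact: near_dist_lt cU e0.
    have oAT := orthmxT oA; have oBT := orthmxT oB.
    apply: filterS3 n1 n2 (filterI n3 n4) => z h1 h2 [h3 h4] _; split => //.
      exact: sym_rigid_act h3.
    by exists A^T, B^T.
  have lim : objective z.2 (z.1.1, z.1.2) - objective z.2 (1%:M, 1%:M)
      @[z --> (nbhs (A, B), nbhs K)] --> objective K (A, B) - objective K (1%:M, 1%:M).
    apply: cvgB; first exact: cvg_objective.
    by apply: cvg_objective => //; exact: cvg_cst.
  have K1 : objective K (1%:M, 1%:M) = 0.
    by rewrite /objective /= act1 balanced_defect // trmx1 mulmx1 mxtrace1 subrr expr0n addr0.
  rewrite K1 subr0 in lim.
  have pos : \forall z \near (nbhs (A, B), nbhs K),
      0 < objective z.2 (z.1.1, z.1.2) - objective z.2 (1%:M, 1%:M).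
    by exact: near_gt lim F0.
  apply: filterS pos => -[[a b] m] /=; rewrite subr_gt0 => h1 h2.
  by have := lt_le_trans h1 h2; rewrite ltxx.
apply: filterS tube => M tube wM.
have cF : {within near_orth, continuous (objective M)}.
  apply: continuous_subspaceT => -[A B]; apply: continuous_at_pair => T F FF f1 f2 h1 h2.
  by apply: cvg_objective => //; exact: cvg_cst.
have [|x + minx] := compact_EVT_min _ compact_near_orth cF.
  by exists (1%:M, 1%:M); exact: near_orth1.
rewrite inE => xG.
have [g1 g2 g3 g4] : good M x.
  by apply: tube => //; apply: minx; rewrite inE; exact: near_orth1.
exists x => //; split => //.
have [ux _] := near_orth_unit xG.
apply: balanced_of_minimum => // v w.
have cA : x.1 *m (1%:M + t *: v) @[t --> (0 : R)] --> x.1.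
  have j := mjetM (mjet_cst x.1) (mjet_line v).
  by have := mjet_cvg j; rewrite mulmx1.
have cB : (1%:M + t *: w) *m x.2 @[t --> (0 : R)] --> x.2.
  have j := mjetM (mjet_line w) (mjet_cst x.2).
  by have := mjet_cvg j; rewrite mul1mx.
have n1 : \forall t \near (0 : R),
    `|(x.1 *m (1%:M + t *: v)) *m (x.1 *m (1%:M + t *: v))^T - 1%:M| < radius.
  have h : `|(x.1 *m (1%:M + t *: v)) *m (x.1 *m (1%:M + t *: v))^T - 1%:M|
      @[t --> (0 : R)] --> `|x.1 *m x.1^T - 1%:M| by exact: (@cvg_defect1 _ (nbhs (0 : R)) _ _ _ cA).
  exact: (@near_lt R _ (nbhs (0 : R)) _ _ _ _ h g1).
have n2 : \forall t \near (0 : R),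
    `|((1%:M + t *: w) *m x.2)^T *m ((1%:M + t *: w) *m x.2) - 1%:M| < radius.
  have h : `|((1%:M + t *: w) *m x.2)^T *m ((1%:M + t *: w) *m x.2) - 1%:M|
      @[t --> (0 : R)] --> `|x.2^T *m x.2 - 1%:M| by exact: (@cvg_defect2 _ (nbhs (0 : R)) _ _ _ cB).
  exact: (@near_lt R _ (nbhs (0 : R)) _ _ _ _ h g2).
have n3 : \forall t \near (0 : R),
    near_orth (x.1 *m (1%:M + t *: v), (1%:M + t *: w) *m x.2).
  by apply: filterS2 n1 n2 => t h1 h2; split; exact: ltW.
have /nbhs_norm0P [d /= d0 hd] := n3.
exists (d / 2) => [|t td]; first by rewrite divr_gt0.
apply: minx; rewrite inE.
apply: hd; rewrite /=; apply: le_lt_trans td _.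
by rewrite ltr_pdivrMr // ltr_pMr // ltr1n.
Qed.

(** U and V only witness that the rotations of the balanced tensor come close to K; the rotation
    maximising the inner product with K comes at least as close in the norm of [ip]. *)
Lemma compat_exists K (e : R) : (0 < p)%N -> odd q -> clifford K -> unit_volume K ->
  0 < e -> \forall M \near K, Wspace M -> exists2 x, near_orth x &
    compat K (act x.1 x.2 M) /\ `|act x.1 x.2 M - K| < e.
Proof.
move=> p0 oq cK vK e0; have [d d0 hip] := ip_norm_lt e0.
have wK : Wspace K by apply/WspaceE; exact: cK.1.
have := balanced_exists p0 oq cK vK d0; apply: filterS => M h wM.
have [x xG [bx [U [V [oU oV nUV]]]]] := h wM.
have wx : Wspace (act x.1 x.2 M) by exact: Wspace_act.
have [A [B [oA oB sa sb mx]]] := nearest_rotation wK wx.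
exists (x.1 *m A, B *m x.2); first exact: near_orth_mul.
rewrite /= -act_comp; split.
  by split => //; apply: balanced_act.
apply: norm_ip_lt => //; apply: le_lt_trans (hip _ _ nUV).
have ex A' B' : orthmx A' -> orthmx B' ->
    ip (act A' B' (act x.1 x.2 M) - K) (act A' B' (act x.1 x.2 M) - K) =
    ip (act x.1 x.2 M) (act x.1 x.2 M) + ip K K - 2 * ip K (act A' B' (act x.1 x.2 M)).
  move=> oA' oB'; rewrite ipBl !ipBr ip_act // (ipC _ K); ring.
rewrite !ex // lerD2l lerN2 ler_pM2l ?ltr0n //; exact: mx.
Qed.

End Compatible.

(** * Frames *)

Section Bases.
Variables (R : realType) (n : nat) (V : vectType R).
Implicit Types e : n.-tuple V.

Lemma basis_expand e v : basis_of fullv e -> v = \sum_i coord e i v *: tnth e i.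
Proof.
move=> be; rewrite {1}(coord_basis be (memvf v)).
by apply: eq_bigr => i _; rewrite (tnth_nth 0).
Qed.

Lemma coord_expand e (c : 'I_n -> R) i : basis_of fullv e ->
  coord e i (\sum_j c j *: tnth e j) = c i.
Proof.
move=> be; rewrite -(coord_sum_free c i (basis_free be)).
by congr coord; apply: eq_bigr => j _; rewrite (tnth_nth 0).
Qed.

Lemma coord_tnth e i j : basis_of fullv e -> coord e i (tnth e j) = (i == j)%:R.
Proof.
by move=> be; rewrite (tnth_nth 0) coord_free ?(basis_free be) // eq_sym.
Qed.

Definition change_basis e (A : 'M[R]_n) : n.-tuple V :=
  [tuple \sum_j A j i *: tnth e j | i < n].

Lemma tnth_change_basis e A i : tnth (change_basis e A) i = \sum_j A j i *: tnth e j.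
Proof. by rewrite tnth_mktuple. Qed.

Lemma sum_change_basis e A (c : 'I_n -> R) :
  \sum_i c i *: tnth (change_basis e A) i =
  \sum_j (A *m \col_i c i) j 0 *: tnth e j.
Proof.
transitivity (\sum_j \sum_i (c i * A j i) *: tnth e j).
  rewrite exchange_big; apply: eq_bigr => i _ /=.
  rewrite tnth_change_basis scaler_sumr; apply: eq_bigr => j _.
  by rewrite scalerA.
apply: eq_bigr => j _; rewrite -scaler_suml; congr (_ *: _).
by rewrite mxE; apply: eq_bigr => i _; rewrite mxE mulrC.
Qed.

Lemma change_basisP e A : basis_of fullv e -> A \in unitmx ->
  basis_of fullv (change_basis e A).
Proof.
move=> be uA; rewrite basisEfree subvf size_tuple (size_basis be) leqnn !andbT.
apply/freeP => k hk.
have h : A *m \col_i k i = 0.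
  apply/matrixP => i j; rewrite ord1 [RHS]mxE.
  rewrite -(coord_expand (fun i => (A *m \col_i k i) i 0) i be) -sum_change_basis.
  rewrite (_ : \sum_i _ = 0) ?linear0 // -[RHS]hk.
  by apply: eq_bigr => l _; rewrite (tnth_nth 0).
move=> i; have -> : k i = (\col_i k i) i 0 by rewrite mxE.
by rewrite -[\col_i k i](mulKmx uA) h mulmx0 mxE.
Qed.

Definition coordv e v : 'cV[R]_n := \col_i coord e i v.

Lemma coordv_change_basis e A v : basis_of fullv e -> A \in unitmx ->
  coordv e v = A *m coordv (change_basis e A) v.
Proof.
move=> be uA; have be' := change_basisP be uA.
apply/matrixP => i j; rewrite ord1 mxE {1}(basis_expand v be') sum_change_basis.
by rewrite coord_expand.
Qed.

Definition transition e e' : 'M[R]_n := \matrix_(j, i) coord e j (tnth e' i).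

Lemma change_transition e e' : basis_of fullv e -> change_basis e (transition e e') = e'.
Proof.
move=> be; apply: eq_from_tnth => i; rewrite tnth_change_basis.
by rewrite [RHS](basis_expand _ be); apply: eq_bigr => j _; rewrite mxE.
Qed.

Lemma transition_unit e e' : basis_of fullv e -> basis_of fullv e' ->
  transition e e' \in unitmx.
Proof.
move=> be be'.
suff : transition e e' *m transition e' e = 1%:M by case/mulmx1_unit.
apply/matrixP => i j; rewrite mxE [RHS]mxE -(coord_tnth _ _ be).
rewrite [X in coord e i X](basis_expand (tnth e j) be') linear_sum.
by apply: eq_bigr => k _; rewrite linearZ /= !mxE mulrC.
Qed.

Lemma gram_change_basis e A : basis_of fullv e -> gram e (change_basis e A) = A^T *m A.
Proof.
move=> be; apply/matrixP => i j; rewrite /gram /transported_metric !mxE.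
by apply: eq_bigr => k _; rewrite !tnth_change_basis !coord_expand // mxE.
Qed.

End Bases.

(** * Brackets and their components in frames *)

Section Brackets.
Variables (R : realType) (p q : nat) (A B : vectType R).
Implicit Types (e : frame p q A B).

Definition is_bilinear (K : A -> A -> B) : Prop :=
  (forall v, linear (K^~ v)) /\ (forall u, linear (K u)).

Lemma alt_bracket_bilinear (K : alt_bracket A B) : is_bilinear K.
Proof. by split => [v|u] a x y; rewrite ?linearPl ?linearPr. Qed.

Lemma bilinear_sum (K : A -> A -> B) m (c d : 'I_m -> R) (x y : 'I_m -> A) :
  is_bilinear K -> K (\sum_i c i *: x i) (\sum_j d j *: y j) =
  \sum_i \sum_j (c i * d j) *: K (x i) (y j).
Proof.
move=> [kl kr].
have z0 v : K 0 v = 0 by have := kl v (- 1) 0 0; rewrite scaler0 addr0 scaleN1r addNr.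
have z0' v : K v 0 = 0 by have := kr v (- 1) 0 0; rewrite scaler0 addr0 scaleN1r addNr.
have dl v : {morph K^~ v : a b / a + b}.
  by move=> a b; have := kl v 1 a b; rewrite !scale1r.
have dr v : {morph K v : a b / a + b}.
  by move=> a b; have := kr v 1 a b; rewrite !scale1r.
have sl a u v : K (a *: u) v = a *: K u v by have := kl v a u 0; rewrite !addr0 z0 addr0.
have sr a u v : K u (a *: v) = a *: K u v by have := kr u a v 0; rewrite !addr0 z0' addr0.
rewrite (big_morph (K^~ _) (dl _) (z0 _)); apply: eq_bigr => i _.
rewrite sl (big_morph (K _) (dr _) (z0' _)) scaler_sumr; apply: eq_bigr => j _.
by rewrite sr scalerA.
Qed.

Lemma slice_read e (K : A -> A -> B) k i j :
  slice (read_bracket e K) k i j = coord e.2 k (K (tnth e.1 i) (tnth e.1 j)).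
Proof. by rewrite /slice /read_bracket /mk_sc rowK mxvecK mxE. Qed.

Lemma read_inj e (K K' : A -> A -> B) : is_frame e -> is_bilinear K -> is_bilinear K' ->
  read_bracket e K = read_bracket e K' -> forall u v, K u v = K' u v.
Proof.
move=> [b1 b2] bK bK' h u v.
rewrite (basis_expand u b1) (basis_expand v b1) !bilinear_sum //.
apply: eq_bigr => i _; apply: eq_bigr => j _; congr (_ *: _).
rewrite (basis_expand (K _ _) b2) (basis_expand (K' _ _) b2).
by apply: eq_bigr => k _; rewrite -!slice_read h.
Qed.

(** The inverse on the second factor makes the coordinates, rather than the basis, transform by Q,
    in agreement with [act]. *)
Definition change_frame e (P : 'M[R]_p) (Q : 'M[R]_q) : frame p q A B :=
  (change_basis e.1 P, change_basis e.2 (invmx Q)).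

Lemma change_frameP e P Q : is_frame e -> P \in unitmx -> Q \in unitmx ->
  is_frame (change_frame e P Q).
Proof.
move=> [b1 b2] uP uQ; split; apply: change_basisP => //.
by rewrite unitmx_inv.
Qed.

Lemma read_change_frame e P Q (K : A -> A -> B) : is_frame e -> is_bilinear K ->
  P \in unitmx -> Q \in unitmx ->
  read_bracket (change_frame e P Q) K = act P Q (read_bracket e K).
Proof.
move=> [b1 b2] bK uP uQ; apply: sliceP => k; apply/matrixP => i j.
have uQ' : invmx Q \in unitmx by rewrite unitmx_inv.
rewrite slice_read /= !tnth_change_basis bilinear_sum //.
set w := \sum_a _.
have -> : coord (change_basis e.2 (invmx Q)) k w = (Q *m coordv e.2 w) k 0.
  by rewrite (coordv_change_basis w b2 uQ') mulKVmx // mxE.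
rewrite slice_act mxE [RHS]mxE.
transitivity (\sum_l \sum_a \sum_b Q k l * (P a i * P b j * slice (read_bracket e K) l a b)).
  apply: eq_bigr => l _; rewrite mxE /w linear_sum mulr_sumr; apply: eq_bigr => a _.
  rewrite linear_sum mulr_sumr; apply: eq_bigr => b _.
  by rewrite linearZ /= slice_read.
transitivity (\sum_b \sum_a \sum_l Q k l * (P a i * P b j * slice (read_bracket e K) l a b)).
  rewrite exchange_big /=; under eq_bigr do rewrite exchange_big /=.
  by rewrite exchange_big.
apply: eq_bigr => b _; rewrite mxE mulr_suml; apply: eq_bigr => a _.
rewrite summxE mulr_sumr mulr_suml; apply: eq_bigr => l _.
by rewrite !mxE; ring.
Qed.

Lemma frame_change e e' : is_frame e -> is_frame e' ->
  exists P Q, [/\ P \in unitmx, Q \in unitmx & e' = change_frame e P Q].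
Proof.
move=> [b1 b2] [b1' b2'].
exists (transition e.1 e'.1), (invmx (transition e.2 e'.2)); split.
- exact: transition_unit.
- by rewrite unitmx_inv transition_unit.
by rewrite /change_frame invmxK !change_transition // -surjective_pairing.
Qed.

Definition bracket_of e (M : sconst R p q) (u v : A) : B :=
  \sum_k ((coordv e.1 u)^T *m slice M k *m coordv e.1 v) 0 0 *: tnth e.2 k.

Lemma coordvP n (V : vectType R) (b : n.-tuple V) : linear (coordv b).
Proof. by move=> a x y; apply/matrixP => i j; rewrite !mxE linearP. Qed.

Lemma bracket_of_bilinear e M : is_bilinear (bracket_of e M).
Proof.
split=> [v|u] a x y; rewrite /bracket_of scaler_sumr -big_split /=;
  apply: eq_bigr => k _; rewrite coordvP scalerA -scalerDl; congr (_ *: _).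
  by rewrite linearP /= !mulmxDl -!scalemxAl mxE [X in X + _]mxE.
by rewrite mulmxDr -scalemxAr mxE [X in X + _]mxE.
Qed.

HB.instance Definition _ e M := bilinear_isBilinear.Build R A A B _ _ (bracket_of e M)
  (conj (bracket_of_bilinear e M).1 (bracket_of_bilinear e M).2).

Lemma read_bracket_of e M : is_frame e -> read_bracket e (bracket_of e M) = M.
Proof.
move=> [b1 b2]; apply: sliceP => k; apply/matrixP => i j.
have dl l : coordv e.1 (tnth e.1 l) = delta_mx l 0.
  by apply/matrixP => a b; rewrite ord1 !mxE coord_tnth // eqxx andbT.
by rewrite slice_read coord_expand // !dl trmx_delta -rowE -colE !mxE.
Qed.

Lemma bracket_of_alt e M u : Wspace M -> bracket_of e M u u = 0.
Proof.
move=> /WspaceE wM; rewrite /bracket_of big1 // => k _.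
set x := _ *m _; have : x^T = - x.
  by rewrite /x !trmx_mul trmxK wM mulNmx mulmxN mulmxA.
move=> /(congr1 (fun Y : 'M[R]_1 => Y 0 0)); rewrite mxE [RHS]mxE => h.
by rewrite (_ : x 0 0 = 0) ?scale0r //; lra.
Qed.

Definition alt_bracket_of e M (wM : Wspace M) : alt_bracket A B :=
  @AltBracket R A B (bracket_of e M) (fun u => bracket_of_alt e u wM).

Lemma read_Wspace e (K : A -> A -> B) : is_bilinear K -> (forall u, K u u = 0) ->
  Wspace (read_bracket e K).
Proof.
move=> [kl kr] alt.
have dl v : {morph K^~ v : a b / a + b}.
  by move=> a b; have := kl v 1 a b; rewrite !scale1r.
have dr v : {morph K v : a b / a + b}.
  by move=> a b; have := kr v 1 a b; rewrite !scale1r.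
apply/WspaceE => k; apply/matrixP => i j; rewrite mxE [RHS]mxE !slice_read.
rewrite -linearN /=; congr coord; apply/eqP; rewrite -addr_eq0.
have := alt (tnth e.1 i + tnth e.1 j); rewrite dl !dr !alt add0r addr0 addrC.
by move=> ->.
Qed.

End Brackets.

(** * Compatibility as a condition on tensors *)

Section CompatibleFrames.
Variables (R : realType) (p q : nat).
Implicit Types (M N : sconst R p q).

Lemma alphaopE (g : 'M[R]_p) (h : 'M[R]_q) N M :
  alphaop g h N M =
  \sum_k \sum_o h k o *: ((invmx g)^T *m (slice M k)^T *m invmx g *m slice N o).
Proof.
apply/matrixP => r c; rewrite mxE summxE.
transitivity (\sum_(k < q) \sum_(o < q) \sum_(i < p) \sum_(j < p) \sum_(s < p)
    invmx g j r * invmx g i s * h k o * sc M k i j * sc N o s c).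
  transitivity (\sum_(i < p) \sum_(k < q) \sum_(o < q) \sum_(j < p) \sum_(s < p)
      invmx g j r * invmx g i s * h k o * sc M k i j * sc N o s c).
    apply: eq_bigr => i _.
    transitivity (\sum_(j < p) \sum_(k < q) \sum_(o < q) \sum_(s < p)
        invmx g j r * invmx g i s * h k o * sc M k i j * sc N o s c).
      apply: eq_bigr => j _; rewrite exchange_big; apply: eq_bigr => k _ /=.
      by rewrite exchange_big.
    by rewrite exchange_big; apply: eq_bigr => k _ /=; rewrite exchange_big.
  by rewrite exchange_big; apply: eq_bigr => k _ /=; rewrite exchange_big.
apply: eq_bigr => k _; rewrite summxE; apply: eq_bigr => o _; rewrite !mxE.
rewrite mulr_sumr; under [RHS]eq_bigr do rewrite mxE mulr_suml mulr_sumr.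
rewrite [RHS]exchange_big [LHS](eq_bigr (fun i => \sum_(s < p) \sum_(j < p)
  invmx g j r * invmx g i s * h k o * sc M k i j * sc N o s c)) => [|i _]; last first.
  by rewrite exchange_big.
apply: eq_bigr => i _; apply: eq_bigr => s _; rewrite mxE !mulr_suml mulr_sumr.
by apply: eq_bigr => j _; rewrite !mxE /sc /slice !mxE; ring.
Qed.

Lemma betaopE (g : 'M[R]_p) (h : 'M[R]_q) N M :
  betaop g h N M =
  - 2^-1 *: ((\matrix_(k, o) \tr ((slice M k)^T *m (invmx g *m slice N o *m (invmx g)^T))) *m h).
Proof.
apply/matrixP => k r; rewrite !mxE; congr (_ * _).
transitivity (\sum_(o < q) \sum_(i < p) \sum_(j < p) \sum_(s < p) \sum_(c < p)
     h o r * invmx g i s * invmx g j c * sc M k i j * sc N o s c).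
  rewrite [RHS]exchange_big; apply: eq_bigr => i _.
  rewrite [RHS]exchange_big; apply: eq_bigr => j _.
  rewrite [RHS]exchange_big; apply: eq_bigr => s _.
  by rewrite [RHS]exchange_big.
apply: eq_bigr => o _; rewrite !mxE mxtrace_tr_mul mulr_suml; apply: eq_bigr => i _.
rewrite mulr_suml; apply: eq_bigr => j _.
have -> : (invmx g *m slice N o *m (invmx g)^T) i j =
    \sum_s \sum_c invmx g i s * sc N o s c * invmx g j c.
  rewrite mxE exchange_big; apply: eq_bigr => c _ /=.
  by rewrite mxE mulr_suml; apply: eq_bigr => s _; rewrite [(invmx g)^T _ _]mxE.
rewrite mulr_sumr mulr_suml; apply: eq_bigr => s _.
rewrite mulr_sumr mulr_suml; apply: eq_bigr => c _.
by rewrite -/(sc M k i j); ring.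
Qed.

Lemma invmx_mul n (A B : 'M[R]_n) : A \in unitmx -> B \in unitmx ->
  invmx (A *m B) = invmx B *m invmx A.
Proof.
move=> uA uB; have uAB : A *m B \in unitmx by rewrite unitmx_mul uA.
rewrite -[RHS]mul1mx -(mulVmx uAB) -!mulmxA (mulmxA B) mulmxV // mul1mx.
by rewrite mulmxV // mulmx1.
Qed.

(** The metrics are the Gram matrices of the frame changed by (P, Q); they absorb one copy of each
    transformation, and what remains is the conjugation rule of an endomorphism. *)
Lemma alphaop_act (P : 'M[R]_p) (Q : 'M[R]_q) N M : P \in unitmx -> Q \in unitmx ->
  alphaop (P^T *m P) ((invmx Q)^T *m invmx Q) (act P Q N) (act P Q M) =
  invmx P *m alpha N M *m P.
Proof.
move=> uP uQ; have uPT : P^T \in unitmx by rewrite unitmx_tr.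
rewrite alphaopE; set h := (invmx Q)^T *m invmx Q.
have ig : invmx (P^T *m P) = invmx P *m invmx P^T.
  by rewrite invmx_mul.
have term k o : (invmx (P^T *m P))^T *m (slice (act P Q M) k)^T *m invmx (P^T *m P)
    *m slice (act P Q N) o =
    invmx P *m ((slice (Q *m M) k)^T *m slice (Q *m N) o) *m P.
  rewrite /act !slice_conjsc ig trmx_mul !trmx_inv trmxK !trmx_mul trmxK.
  rewrite -!mulmxA (mulmxA (invmx P^T) P^T) mulVmx // mul1mx; congr (_ *m _).
  rewrite (mulmxA P (invmx P)) mulmxV // mul1mx; congr (_ *m _).
  by rewrite (mulmxA (invmx P^T)) mulVmx // mul1mx.
under eq_bigr do under eq_bigr do rewrite term.
have -> : \sum_(i < q) \sum_(o < q) h i o *: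
    (invmx P *m ((slice (Q *m M) i)^T *m slice (Q *m N) o) *m P) =
    invmx P *m (\sum_i (slice (Q *m M) i)^T *m slice (h *m (Q *m N)) i) *m P.
  rewrite mulmx_sumr mulmx_suml; apply: eq_bigr => i _.
  rewrite (sliceM h) !mulmx_sumr mulmx_suml; apply: eq_bigr => o _.
  by rewrite -!scalemxAr -scalemxAl.
congr (_ *m _ *m _).
have -> : \sum_i (slice (Q *m M) i)^T *m slice (h *m (Q *m N)) i =
    alpha (h *m (Q *m N)) (Q *m M) by [].
apply/matrixP => r c; rewrite !alphaE; apply: eq_bigr => i _; congr (_ _ _).
rewrite trmx_mul /h !mulmxA -(mulmxA _ (invmx Q) Q) mulVmx // mulmx1.
by rewrite -(mulmxA M^T) -trmx_mul mulVmx // trmx1 mulmx1.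
Qed.

Lemma betaop_act (P : 'M[R]_p) (Q : 'M[R]_q) N M : P \in unitmx -> Q \in unitmx ->
  betaop (P^T *m P) ((invmx Q)^T *m invmx Q) (act P Q N) (act P Q M) =
  - 2^-1 *: (Q *m beta N M *m invmx Q).
Proof.
move=> uP uQ; have uPT : P^T \in unitmx by rewrite unitmx_tr.
rewrite betaopE; congr (_ *: _).
have ig : invmx (P^T *m P) = invmx P *m invmx P^T.
  by rewrite invmx_mul.
have -> : \matrix_(k, o) \tr ((slice (act P Q M) k)^T *m
    (invmx (P^T *m P) *m slice (act P Q N) o *m (invmx (P^T *m P))^T)) =
    beta (Q *m N) (Q *m M).
  apply/matrixP => k o; rewrite mxE betaE /act !slice_conjsc ig !trmx_mul !trmx_inv !trmxK.
  rewrite -!mulmxA mxtrace_mulC -!mulmxA.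
  rewrite (mulmxA P (invmx P)) mulmxV // mul1mx (mulmxA (invmx P^T) P^T) mulVmx // mul1mx.
  by rewrite mulmx1 mulmxV // mulmx1.
rewrite /beta trmx_mul !mulmxA; congr (_ *m _).
by rewrite -!mulmxA -trmx_mul mulVmx // trmx1 mulmx1.
Qed.

(* The conditions of the definition of compatibility in a frame that differs by (P, Q)
   from an orthonormal one. *)
Definition compat_in (P : 'M[R]_p) (Q : 'M[R]_q) M N : Prop :=
  let g := P^T *m P in let h := (invmx Q)^T *m invmx Q in
  let k := act P Q M in let l := act P Q N in
  [/\ delstar g h k k = delstar g h l l, metric_symmetric g (delstar g h k l).1 &
     metric_symmetric h (delstar g h k l).2].

Lemma compat_inE (P : 'M[R]_p) (Q : 'M[R]_q) M N : balanced M ->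
  P \in unitmx -> Q \in unitmx -> compat M N <-> compat_in P Q M N.
Proof.
move=> [bM1 bM2] uP uQ.
have m2 : - 2^-1 != 0 :> R by rewrite oppr_eq0 invr_eq0 pnatr_eq0.
have uPT : P^T \in unitmx by rewrite unitmx_tr.
have uQ' : invmx Q \in unitmx by rewrite unitmx_inv.
have uQT : (invmx Q)^T \in unitmx by rewrite unitmx_tr.
rewrite /compat_in /delstar !alphaop_act // !betaop_act //= bM1 bM2 /metric_symmetric.
have e1 : P^T *m P *m (invmx P *m alpha M N *m P) = P^T *m alpha M N *m P.
  by rewrite !mulmxA mulmxK.
have e2 : (invmx Q)^T *m invmx Q *m (- 2^-1 *: (Q *m beta M N *m invmx Q)) =
    - 2^-1 *: ((invmx Q)^T *m beta M N *m invmx Q).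
  by rewrite -scalemxAr !mulmxA mulmxKV.
rewrite e1 e2.
have trZ n (c : R) (Y : 'M[R]_n) : (c *: Y)^T = c *: Y^T by apply: linearZ.
rewrite /compat /balanced trZ; move: (alpha M N) (beta M N) (alpha N N) (beta N N).
clear e1 e2 => a1 b1 a2 b2; rewrite !trmx_mul !trmxK !mulmxA; split.
  by move=> [[-> ->] -> ->].
move=> [[h1 h2] h3 h4]; split.
- split.
    have := congr1 (fun Y => P *m Y *m invmx P) h1; rewrite /= !mulmxA !mulmxV // !mul1mx.
    by rewrite !mulmxK // => <-; rewrite mul_mx_scalar -scalemxAl mulmxV // scalemx1.
  have := congr1 (fun Y => invmx Q *m Y *m Q) (scalerI m2 h2).
  by rewrite /= !mulmxA !mulVmx // !mul1mx !mulmxKV // => <-.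
- have := congr1 (fun Y => invmx P^T *m Y *m invmx P) h3.
  by rewrite /= !mulmxA !mulVmx // !mul1mx !mulmxK.
have := congr1 (fun Y => invmx (invmx Q)^T *m Y *m Q) (scalerI m2 h4).
by rewrite /= !mulmxA !mulVmx // !mul1mx !mulmxKV.
Qed.

End CompatibleFrames.

(** The conditions in an arbitrary frame are conjugates of those in the frame e, so the
    quantification over all frames reduces to e itself, where both Gram matrices are 1. *)
Lemma compatibleP (R : realType) (t : contact_type) (A B : vectType R) (K L : A -> A -> B) :
  is_bilinear K -> is_bilinear L -> clifford (kappa R t) ->
  compatible t K L <-> exists e : frame (rank_of t) (corank_of t) A B,
    [/\ is_frame e, read_bracket e K = kappa R t & compat (kappa R t) (read_bracket e L)].
Proof.
move=> bK bL /clifford_balanced balK.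
have gramE (e : frame (rank_of t) (corank_of t) A B) P Q : is_frame e ->
    gram e.1 (change_frame e P Q).1 = P^T *m P /\
    gram e.2 (change_frame e P Q).2 = (invmx Q)^T *m invmx Q.
  by move=> [f1 f2]; split; apply: gram_change_basis.
have key (e : frame (rank_of t) (corank_of t) A B) P Q : is_frame e ->
    read_bracket e K = kappa R t -> P \in unitmx -> Q \in unitmx ->
    let e' := change_frame e P Q in
    (let g := gram e.1 e'.1 in let h := gram e.2 e'.2 in
     let k := read_bracket e' K in let l := read_bracket e' L in
     [/\ delstar g h k k = delstar g h l l, metric_symmetric g (delstar g h k l).1 &
         metric_symmetric h (delstar g h k l).2]) =
    compat_in P Q (kappa R t) (read_bracket e L).
  move=> fe eK uP uQ /=; have [-> ->] := gramE e P Q fe.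
  by rewrite (read_change_frame fe bK uP uQ) (read_change_frame fe bL uP uQ) eK.
split => -[e [fe eK h]]; exists e; split => //.
  have u1 := unitmx1 R (rank_of t); have u2 := unitmx1 R (corank_of t).
  apply/(compat_inE _ balK u1 u2); rewrite -(key e _ _ fe eK u1 u2).
  by apply: h; apply: change_frameP.
move=> e' fe'; have [P [Q [uP uQ ->]]] := frame_change fe fe'.
rewrite (key e P Q fe eK uP uQ); exact: (compat_inE _ balK uP uQ).1 h.
Qed.

(** * The standard brackets are Clifford systems *)

(* The Cayley-Dickson algebras over the integers, in which the multiplication tables
   are computed. *)
Fixpoint cdz (d : nat) : zmodType :=
  if d is d'.+1 then (cdz d' * cdz d')%type : zmodType else int.

Fixpoint cdz_conj (d : nat) : cdz d -> cdz d :=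
  match d return cdz d -> cdz d with
  | 0 => id
  | d'.+1 => fun x => (cdz_conj x.1, - x.2)
  end.

Fixpoint cdz_mul (d : nat) : cdz d -> cdz d -> cdz d :=
  match d return cdz d -> cdz d -> cdz d with
  | 0 => fun x y => (x : int) * (y : int)
  | d'.+1 => fun x y =>
      (cdz_mul x.1 y.1 - cdz_mul (cdz_conj y.2) x.2,
       cdz_mul y.2 x.1 + cdz_mul x.2 (cdz_conj y.1))
  end.

Fixpoint cdz_vec (d : nat) (f : nat -> int) : cdz d :=
  match d return cdz d with
  | 0 => f 0%N
  | d'.+1 => (cdz_vec d' f, cdz_vec d' (fun s => f (2 ^ d' + s)%N))
  end.

Fixpoint cdz_coord (d : nat) : cdz d -> nat -> int :=
  match d return cdz d -> nat -> int with
  | 0 => fun x _ => x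
  | d'.+1 => fun x s =>
      if (s < 2 ^ d')%N then cdz_coord x.1 s else cdz_coord x.2 (s - 2 ^ d')%N
  end.

Section CayleyDickson.
Variable R : realType.

Fixpoint cdz_to (d : nat) : cdz d -> cd R d :=
  match d return cdz d -> cd R d with
  | 0 => fun x => (x : int)%:~R
  | d'.+1 => fun x => (cdz_to x.1, cdz_to x.2)
  end.

Lemma cdz_toB d (x y : cdz d) : cdz_to (x - y) = cdz_to x - cdz_to y.
Proof.
elim: d x y => [|d IH] x y /=; first by rewrite rmorphB.
by rewrite !IH.
Qed.

Lemma cdz_to0 d : cdz_to (0 : cdz d) = 0.
Proof. by rewrite -(subrr (0 : cdz d)) cdz_toB subrr. Qed.

Lemma cdz_toN d (x : cdz d) : cdz_to (- x) = - cdz_to x.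
Proof. by rewrite -sub0r cdz_toB cdz_to0 sub0r. Qed.

Lemma cdz_toD d (x y : cdz d) : cdz_to (x + y) = cdz_to x + cdz_to y.
Proof. by rewrite -{1}[y]opprK cdz_toB cdz_toN opprK. Qed.

Lemma cdz_to_sum d n (f : 'I_n -> cdz d) :
  cdz_to (\sum_i f i) = \sum_i cdz_to (f i).
Proof. exact: (big_morph _ (@cdz_toD d) (cdz_to0 d)). Qed.

Lemma cdz_to_conj d (x : cdz d) : cdz_to (cdz_conj x) = cdconj (cdz_to x).
Proof. by elim: d x => [//|d IH] x /=; rewrite IH cdz_toN. Qed.

Lemma cdz_to_mul d (x y : cdz d) : cdz_to (cdz_mul x y) = cdmul (cdz_to x) (cdz_to y).
Proof.
elim: d x y => [|d IH] x y /=; first by rewrite rmorphM.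
by rewrite cdz_toB cdz_toD !IH !cdz_to_conj.
Qed.

Lemma cdz_to_vec d f : cdz_to (cdz_vec d f) = cdvec d (fun s => (f s)%:~R).
Proof. by elim: d f => [//|d IH] f /=; rewrite !IH. Qed.

Lemma cdz_to_coord d (x : cdz d) s : cdcoord (cdz_to x) s = (cdz_coord x s)%:~R.
Proof. by elim: d x s => [//|d IH] x s /=; case: ifP => _; rewrite IH. Qed.

Lemma cdz_vec_ext d f g : (forall s, (s < 2 ^ d)%N -> f s = g s) -> cdz_vec d f = cdz_vec d g.
Proof.
elim: d f g => [|d IH] f g h /=; first exact: h.
by congr pair; apply: IH => s sd; apply: h; rewrite expnS mul2n -addnn ?ltn_add2l // ltn_addr.
Qed.

Lemma cdz_vec0 d : cdz_vec d (fun=> 0) = 0.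
Proof. by elim: d => [//|d IH] /=; rewrite IH. Qed.

Lemma cdz_conj0 d : cdz_conj (0 : cdz d) = 0.
Proof. by elim: d => [//|d IH] /=; rewrite IH oppr0. Qed.

Lemma cdz_mul0 d (x : cdz d) : cdz_mul 0 x = 0 /\ cdz_mul x 0 = 0.
Proof.
elim: d x => [|d IH] x /=; first by rewrite mul0r mulr0.
by rewrite cdz_conj0 !(IH _).1 !(IH _).2 subrr addr0.
Qed.

Lemma cdvec_ext d (f g : nat -> R) : (forall s, f s = g s) -> cdvec d f = cdvec d g.
Proof. by move=> /funext ->. Qed.

Definition cdz_unit d s : cdz d := cdz_vec d (fun r => (r == s)%:R).

Definition cdz_table d k s r : int :=
  cdz_coord (cdz_mul (cdz_conj (cdz_unit d s)) (cdz_unit d r)) k.+1.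

(** One block repeated along the diagonal: the generators on H^(m-1) have this form, which reduces
    their identities for all m to a single finite check. *)
Definition block_diag (p D : nat) (F : nat -> nat -> int) : 'M[R]_p :=
  \matrix_(i, j) if (i %/ D == j %/ D)%N then (F (i %% D)%N (j %% D)%N)%:~R else 0.

Definition mulz (D : nat) (F G : nat -> nat -> int) s u : int :=
  foldr (fun r acc => F s r * G r u + acc) 0 (iota 0 D).

Lemma block_diag_mul p D F G : (0 < D)%N -> (D %| p)%N ->
  block_diag p D F *m block_diag p D G = block_diag p D (mulz D F G).
Proof.
move=> D0 /dvdnP[n pE]; apply/matrixP => i j; rewrite !mxE.
pose a := (i %/ D)%N.
pose f (m : nat) : R := (if a == (m %/ D)%N then (F (i %% D)%N (m %% D)%N)%:~R else 0) *
   (if (m %/ D == j %/ D)%N then (G (m %% D)%N (j %% D)%N)%:~R else 0).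
have -> : \sum_(m < p) block_diag p D F i m * block_diag p D G m j = \sum_(0 <= m < p) f m.
  by rewrite big_mkord; apply: eq_bigr => m _; rewrite !mxE.
have aD : (a * D + D <= p)%N.
  have : (a < n)%N by rewrite ltn_divLR // -pE.
  by rewrite pE -mulSnr leq_mul2r => ->; rewrite orbT.
have f0 m : (m %/ D)%N != a -> f m = 0 by rewrite /f eq_sym => /negbTE ->; rewrite mul0r.
rewrite (big_cat_nat _ (n := a * D)) //=; last by rewrite (leq_trans _ aD) // leq_addr.
rewrite big_nat big1 ?add0r => [|m /andP[_ ma]]; last first.
  by apply: f0; rewrite neq_ltn ltn_divLR // ma.
rewrite (big_cat_nat _ (n := a * D + D)) //=; last by rewrite leq_addr.
rewrite [X in _ + X]big_nat [X in _ + X]big1 ?addr0 => [|m /andP[ma _]]; last first.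
  have am : (a < m %/ D)%N by rewrite leq_divRL // mulSnr.
  by apply: f0; rewrite neq_ltn am orbT.
rewrite -{1}[(a * D)%N]add0n [(a * D + D)%N]addnC big_addn addnK.
have fr r : (r < D)%N -> f (r + a * D)%N =
    if (i %/ D == j %/ D)%N then (F (i %% D)%N r * G r (j %% D)%N)%:~R else 0.
  move=> rD; rewrite /f addnC divnMDl // (divn_small rD) addn0 eqxx modnMDl (modn_small rD).
  by rewrite -/a; case: ifP => _; rewrite ?mulr0 // rmorphM.
rewrite /mulz /index_iota subn0; case: ifP => hij; last first.
  by rewrite big_seq big1 // => r; rewrite mem_iota add0n => /fr ->; rewrite hij.
have: all (fun r => r < D)%N (iota 0 D) by apply/allP => r; rewrite mem_iota add0n.
elim: (iota 0 D) => [|r l IH] /=; first by rewrite big_nil.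
by move=> /andP[rD lD]; rewrite big_cons IH // fr // hij rmorphD.
Qed.

Lemma block_diag_ext p D F G : (0 < D)%N ->
  (forall s u, (s < D)%N -> (u < D)%N -> F s u = G s u) ->
  block_diag p D F = block_diag p D G.
Proof. by move=> D0 h; apply/matrixP => i j; rewrite !mxE h // ltn_mod. Qed.

Lemma block_diag_scalar p D (c : int) : (0 < D)%N ->
  block_diag p D (fun s u => c * (s == u)%:R) = (c%:~R)%:M.
Proof.
move=> D0; apply/matrixP => i j; rewrite !mxE.
have -> : (i == j) = (i %/ D == j %/ D)%N && (i %% D == j %% D)%N.
  apply/idP/andP => [/eqP -> //|[/eqP h1 /eqP h2]]; apply/eqP/val_inj => /=.
  by rewrite (divn_eq i D) (divn_eq j D) h1 h2.
case: eqP => _ //=; case: eqP => _ /=; by rewrite ?mulr1 ?mulr0 ?mulr1n ?mulr0n.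
Qed.

Lemma block_diagD p D F G : block_diag p D F + block_diag p D G =
  block_diag p D (fun s u => F s u + G s u).
Proof. by apply/matrixP => i j; rewrite !mxE; case: ifP; rewrite ?addr0 // rmorphD. Qed.

Lemma block_diagN p D F : - block_diag p D F = block_diag p D (fun s u => - F s u).
Proof. by apply/matrixP => i j; rewrite !mxE; case: ifP; rewrite ?oppr0 // rmorphN. Qed.

Lemma block_diagT p D F : (block_diag p D F)^T = block_diag p D (fun s u => F u s).
Proof. by apply/matrixP => i j; rewrite !mxE eq_sym. Qed.

Definition to_table D (F : nat -> nat -> int) : seq (seq int) :=
  [seq [seq F s u | u <- iota 0 D] | s <- iota 0 D].

Definition of_table (L : seq (seq int)) s u : int := nth 0 (nth [::] L s) u.

Lemma of_tableK D F s u : (s < D)%N -> (u < D)%N -> of_table (to_table D F) s u = F s u.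
Proof.
move=> sD uD; rewrite /of_table /to_table (nth_map 0%N) ?size_iota //.
by rewrite (nth_map 0%N) ?size_iota // !nth_iota.
Qed.

(** Each partial product is stored as a table before the next multiplication; kept as a function, it
    would be recomputed at every entry. *)
Definition prod_table D (T : nat -> nat -> nat -> int) (l : seq nat) : seq (seq int) :=
  foldr (fun k L => to_table D (mulz D (T k) (of_table L)))
    (to_table D (fun s u => 1 * (s == u)%:R)) l.

Lemma block_diag_prod p D T l : (0 < D)%N -> (D %| p)%N ->
  \big[mulmx/1%:M]_(k <- l) block_diag p D (T k) = block_diag p D (of_table (prod_table D T l)).
Proof.
move=> D0 Dp; elim: l => [|k l IH] /=.
  rewrite big_nil -[1%:M]/(((1 : int)%:~R)%:M) -(block_diag_scalar p 1 D0).
  by apply: block_diag_ext => // s u sD uD; rewrite of_tableK.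
rewrite big_cons IH block_diag_mul //.
by apply: block_diag_ext => // s u sD uD; rewrite of_tableK.
Qed.

Definition range_forall n (P : nat -> bool) := all P (iota 0 n).

Lemma range_forallP n P : range_forall n P -> forall k, (k < n)%N -> P k.
Proof. by move=> /allP h k kn; apply: h; rewrite mem_iota. Qed.

(** On one block: antisymmetry of the generators, the Clifford relations, and the scalar value of
    the volume element. *)
Definition check_table (q D : nat) (T : nat -> nat -> nat -> int) (c : int) : bool :=
  [&& range_forall q (fun k => range_forall D (fun s => range_forall D (fun u =>
        T k u s == - T k s u))),
      range_forall q (fun k => range_forall q (fun l =>
        range_forall D (fun s => range_forall D (fun u =>
        mulz D (T k) (T l) s u + mulz D (T l) (T k) s u
        == (- 2 *+ (k == l)) * (s == u)%:R)))) &
      prod_table D T (iota 0 q) == to_table D (fun s u => c * (s == u)%:R)].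

Definition cdz_tables d q : seq (seq (seq int)) :=
  [seq to_table (2 ^ d) (cdz_table d k) | k <- iota 0 q].

Definition lookup (tables : seq (seq (seq int))) k := of_table (nth [::] tables k).

Lemma lookupE d q k s u : (k < q)%N -> (s < 2 ^ d)%N -> (u < 2 ^ d)%N ->
  lookup (cdz_tables d q) k s u = cdz_table d k s u.
Proof.
move=> kq sD uD; rewrite /lookup /cdz_tables (nth_map 0%N) ?size_iota // nth_iota //.
by rewrite of_tableK.
Qed.

(* The [let] makes the virtual machine compute the tables only once. *)
Definition check_cdz d q c :=
  let tables := cdz_tables d q in check_table q (2 ^ d) (lookup tables) c.

Lemma check_quaternions : check_cdz 2 3 (- 1).
Proof. by vm_cast_no_check (erefl true). Qed.

Lemma check_octonions : check_cdz 3 7 (- 1).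
Proof. by vm_cast_no_check (erefl true). Qed.

Lemma check_kappa t : exists2 c : int, c != 0 & check_cdz (cd_level t) (corank_of t) c.
Proof.
by case: t => [m|]; [exists (- 1); last exact: check_quaternions|
  exists (- 1); last exact: check_octonions].
Qed.

(** The i-th basis vector has a single nonzero component, with index [i %/ D] and equal to the unit
    numbered [i %% D], so two basis vectors pair nontrivially only within a block. *)
Lemma slice_kappa t (k : 'I_(corank_of t)) : admissible t ->
  slice (kappa R t) k = block_diag (rank_of t) (2 ^ cd_level t)
    (lookup (cdz_tables (cd_level t) (corank_of t)) k).
Proof.
move=> ht; transitivity (block_diag (rank_of t) (2 ^ cd_level t) (cdz_table (cd_level t) k)); last first.
  by apply: block_diag_ext => [|s u sD uD]; rewrite ?expn_gt0 // lookupE.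
set d := cd_level t; set D := (2 ^ d)%N.
have D0 : (0 < D)%N by rewrite expn_gt0.
have pE : (cd_blocks t * D = rank_of t)%N.
  by rewrite /D /d; case: (t) ht => [m|] //= m2; rewrite mulnBl mul1n mulnC.
pose v (i a : nat) : cdz d := cdz_vec d (fun s => ((a * D + s)%N == i)%:R).
have vE (i : 'I_(rank_of t)) a : cd_block (delta_mx 0 i : 'rV[R]__) a = cdz_to (v i a).
  rewrite /cd_block cdz_to_vec; apply: cdvec_ext => s; rewrite -/D.
  case: insubP => [u _ uE|] /=; first by rewrite mxE eqxx /= -uE -val_eqE /=; case: eqP.
  rewrite -leqNgt => h; case: eqP => // e.
  by have := leq_trans (ltn_ord i) h; rewrite e ltnn.
have v0 (i a : nat) : a != (i %/ D)%N -> v i a = 0.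
  move=> ai; rewrite -(cdz_vec0 d); apply: cdz_vec_ext => s sD.
  case: eqP => // e; move: ai; rewrite -e divnMDl // divn_small // addn0 eqxx.
  by [].
have v1 (i : nat) : v i (i %/ D)%N = cdz_unit d (i %% D)%N.
  apply: cdz_vec_ext => s sD; rewrite {2}(divn_eq i D) eqn_add2l //.
apply/matrixP => i j; rewrite /slice /kappa /mk_sc rowK mxvecK !mxE.
under eq_bigr do rewrite !vE -cdz_to_conj -cdz_to_mul.
rewrite -cdz_to_sum cdz_to_coord.
have ib : (i %/ D < cd_blocks t)%N by rewrite ltn_divLR // pE.
rewrite (bigD1 (Ordinal ib)) //= big1 => [|a ai]; last first.
  by rewrite v0 ?cdz_conj0 ?(cdz_mul0 _).1 //; apply: contraNneq ai => e; apply/eqP/val_inj.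
rewrite addr0 v1; case: eqP => [->|/eqP ij]; first by rewrite v1.
rewrite v0 // (cdz_mul0 _).2.
have c0 d' s : cdz_coord (0 : cdz d') s = 0.
  by elim: d' s => [//|d' IH] s /=; rewrite !IH if_same.
by rewrite c0.
Qed.

Lemma dvd_rank t : (2 ^ cd_level t %| rank_of t)%N.
Proof. by case: t => [m|] //=; rewrite -[X in (_ - X)%N]muln1 -mulnBr dvdn_mulr. Qed.

Lemma clifford_kappa t : admissible t -> clifford (kappa R t).
Proof.
move=> ht; have [c c0 /and3P[h1 h2 _]] := check_kappa t.
have D0 : (0 < 2 ^ cd_level t)%N by rewrite expn_gt0.
have dp := dvd_rank t.
split=> [k|k l]; rewrite !slice_kappa //.
  rewrite block_diagT block_diagN; apply: block_diag_ext => // s u sD uD.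
  by have /eqP := range_forallP (range_forallP (range_forallP h1 (ltn_ord k)) sD) uD.
rewrite !block_diag_mul // block_diagD.
have -> : - 2 *+ (k == l) = (- 2 *+ (k == l) : int)%:~R :> R.
  by case: (k == l); rewrite ?mulr0n ?mulr1n // rmorphN.
rewrite -(block_diag_scalar _ _ D0); apply: block_diag_ext => // s u sD uD.
by have /eqP := range_forallP (range_forallP (range_forallP (range_forallP h2 (ltn_ord k)) (ltn_ord l)) sD) uD.
Qed.

Lemma unit_volume_kappa t : admissible t -> unit_volume (kappa R t).
Proof.
move=> ht; have [c c0 /and3P[_ _ /eqP h3]] := check_kappa t.
have D0 : (0 < 2 ^ cd_level t)%N by rewrite expn_gt0.
exists (c%:~R); first by rewrite intr_eq0.
under eq_bigr do rewrite slice_kappa //.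
rewrite -(big_mkord xpredT (fun k => block_diag _ _
  (lookup (cdz_tables (cd_level t) (corank_of t)) k))).
rewrite block_diag_prod ?dvd_rank // -(block_diag_scalar _ _ D0).
by apply: block_diag_ext => // s u sD uD; rewrite /index_iota subn0 h3 of_tableK.
Qed.

End CayleyDickson.

Lemma rank_gt0 t : admissible t -> (0 < rank_of t)%N.
Proof. by case: t => [m|] //= m2; rewrite subn_gt0 -[X in (X < _)%N]muln1 ltn_pmul2l. Qed.

Lemma odd_corank t : odd (corank_of t).
Proof. by case: t. Qed.

(** * Smooth maps *)

Section Calculus.
Variable R : realType.
Implicit Types V W : normedModType R.

Lemma diff_near V W (f : V -> W) x eps : differentiable f x -> 0 < eps ->
  \forall k \near (0 : V), `|f (k + x) - f x - 'd f x k| <= eps * `|k|.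
Proof.
move=> /diff_locally/eqaddoP h e0; have := h _ e0; apply: filterS => k.
by rewrite /= !fctE /= opprD addrA.
Qed.

Lemma near_translate V (x : V) (P : set V) : nbhs x P -> \forall k \near (0 : V), P (k + x).
Proof.
have h : (fun k : V => k + x) @ 0 --> x.
  by rewrite -{2}[x]add0r; apply: cvgD; [exact: cvg_id|exact: cvg_cst].
by move=> xP; exact: (h P xP).
Qed.

Lemma near_eq_diff V W (f g : V -> W) x : {near x, f =1 g} -> differentiable f x ->
  differentiable g x /\ 'd g x = 'd f x :> (V -> W).
Proof.
move=> fg df; have [fc fo] := (diff_locallyP _ _).1 df.
have go : g \o shift x = cst (g x) + 'd f x +o_ 0 id.
  apply/eqaddoP => e e0; move/eqaddoP : fo => /(_ e e0).
  have fgx : \forall k \near (0 : V), f (k + x) = g (k + x).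
    exact: near_translate fg.
  apply: filterS2 fgx => k /= h; rewrite !fctE /= h; congr (`|_ - (_ + _)| <= _).
  exact: nbhs_singleton fg.
have gE : 'd g x = 'd f x :> (V -> W) by exact: diff_unique fc go.
split; last exact: gE.
by apply/diff_locallyP; rewrite gE; split; [exact: fc|exact: go].
Qed.

Lemma derive_lin V W (c : R) (f g : V -> W) x v : differentiable f x -> differentiable g x ->
  'D_v (c \*: f + g) x = c *: 'D_v f x + 'D_v g x.
Proof.
move=> /(@diff_derivable _ _ _ f x v) df /(@diff_derivable _ _ _ g x v) dg.
by rewrite deriveD ?deriveZ //; exact: derivableZ.
Qed.

Lemma cvg_near_eq (T : Type) (U : topologicalType) (F : set_system T) {FF : Filter F}
    (f g : T -> U) (l : U) : {near F, f =1 g} -> f @ F --> l -> g @ F --> l.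
Proof. by move=> fg; apply: cvg_trans; exact: near_eq_cvg. Qed.

Lemma near_scaled V (a b : V) (P : set V) : nbhs (0 : V) P ->
  \forall h \near (0 : R), forall c, 0 <= c <= h -> P (c *: a + h *: b) /\ P (c *: a).
Proof.
move=> /nbhs_ballP[d /= d0 dP].
have [C C0 CP] : exists2 C, 0 < C & `|a| + `|b| <= C.
  by exists (`|a| + `|b| + 1); rewrite ?lerDl // ltr_wpDl // addr_ge0.
have : \forall h \near (0 : R), `|h| < d / C by apply: nbhs0_lt; rewrite divr_gt0.
apply: filterS => h hd c /andP[c0 ch].
have h0 : 0 <= h by exact: le_trans ch.
have hC : h * (`|a| + `|b|) < d.
  apply: (le_lt_trans (ler_wpM2l h0 CP)); rewrite -ltr_pdivlMr //.
  by rewrite -(ger0_norm h0).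
have ca : `|c *: a| <= h * `|a| by rewrite normrZ (ger0_norm c0) ler_wpM2r.
split; apply: dP; rewrite -ball_normE /= sub0r normrN.
  apply: le_lt_trans hC; rewrite mulrDr; apply: le_trans (ler_normD _ _) _.
  by rewrite lerD // normrZ (ger0_norm h0).
by apply: le_lt_trans hC; apply: (le_trans ca); rewrite mulrDr lerDl mulr_ge0.
Qed.

Lemma derive_line V W (f : V -> W) (a y : V) (s : R) : derivable f (s *: a + y) a ->
  is_derive s 1 (fun r => f (r *: a + y)) ('D_a f (s *: a + y)).
Proof.
have e : (fun h : R => h^-1 *: (((fun r => f (r *: a + y)) \o shift s) (h *: 1) - f (s *: a + y))) =
    (fun h => h^-1 *: ((f \o shift (s *: a + y)) (h *: a) - f (s *: a + y))).
  by apply/funext => h /=; rewrite [h *: 1]mulr1 scalerDl addrA.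
by split; rewrite /derivable /derive e.
Qed.

(** The mean value theorem in the direction a turns the second difference into an increment of
    ['D_a f], which is then expanded at x. The second difference is symmetric in a and b, whence
    [schwarz]. *)
Lemma second_difference V (f : V -> R) x a b :
  (\forall y \near x, differentiable f y) -> differentiable ('D_a f) x ->
  (f (h *: a + (h *: b + x)) - f (h *: a + x) - f (h *: b + x) + f x) / h ^+ 2
    @[h --> 0^'+] --> 'D_b ('D_a f) x.
Proof.
move=> df dfa; apply/cvgrPdist_le => e e0.
(* The increments of ['D_a f] are taken at c a and c a + h b with c <= h; their norms add up to at
   most h (2 |a| + |b|). *)
set C := 2 * `|a| + `|b| + 1.
have C0 : 0 < C by rewrite /C ltr_wpDl // addr_ge0 ?mulr_ge0.
have eC : 0 < e / C by rewrite divr_gt0.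
have df0 : \forall k \near (0 : V), differentiable f (k + x).
  exact: near_translate df.
set P := [set k | differentiable f (k + x)] `&`
  [set k | `|'D_a f (k + x) - 'D_a f x - 'd ('D_a f) x k| <= e / C * `|k|].
have nP : nbhs (0 : V) P by apply: filterI; [exact: df0|exact: diff_near].
have n2 : \forall h \near 0^'+, forall c : R, 0 <= c <= h -> P (c *: a + h *: b) /\ P (c *: a).
  by apply: filterS (near_scaled a b nP) => h hh _.
have n3 : \forall h \near 0^'+, 0 < h :> R by exact: nbhs_right_gt.
apply: filterS2 n2 n3 => h hP h0.
pose G (r : R) := f (r *: a + (h *: b + x)) - f (r *: a + x).
have dG r : 0 <= r <= h -> is_derive r 1 G ('D_a f (r *: a + (h *: b + x)) - 'D_a f (r *: a + x)).
  move=> /hP[[/= d1 _] [/= d2 _]]; apply: is_deriveB.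
  - by apply: derive_line; apply: diff_derivable; rewrite addrA.
  - by apply: derive_line; apply: diff_derivable.
have [|||c cP] := @MVT R G (fun r => 'D_a f (r *: a + (h *: b + x)) - 'D_a f (r *: a + x)) 0 h.
- exact: h0.
- by move=> r; rewrite in_itv /= => /andP[r0 r1]; apply: dG; rewrite !ltW.
- apply: derivable_within_continuous => r; rewrite in_itv /= => rP.
  by have [] := dG r rP.
rewrite /G !scale0r !add0r subr0 => GE.
have -> : f (h *: a + (h *: b + x)) - f (h *: a + x) - f (h *: b + x) + f x =
    ('D_a f (c *: a + (h *: b + x)) - 'D_a f (c *: a + x)) * h.
  by rewrite -GE; ring.
move: cP; rewrite in_itv /= => /andP[c0 ch].
have cP : 0 <= c <= h by rewrite !ltW.
have [[_ /= h1] [_ /= h2]] := hP _ cP.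
have -> : 'D_b ('D_a f) x = 'd ('D_a f) x (h *: b) / h.
  by rewrite deriveE // linearZ /= [_ *: _]mulrC mulfK // gt_eqF.
rewrite expr2 invfM mulrA mulfK ?gt_eqF // -mulrBl normrM normfV (gtr0_norm h0).
rewrite ler_pdivrMr //.
have -> : 'd ('D_a f) x (h *: b) - ('D_a f (c *: a + (h *: b + x)) - 'D_a f (c *: a + x)) =
  ('D_a f (c *: a + x) - 'D_a f x - 'd ('D_a f) x (c *: a)) -
  ('D_a f (c *: a + h *: b + x) - 'D_a f x - 'd ('D_a f) x (c *: a + h *: b)).
  have -> : 'd ('D_a f) x (c *: a + h *: b) = 'd ('D_a f) x (c *: a) + 'd ('D_a f) x (h *: b).
    exact: linearD.
  by rewrite addrA; ring.
apply: le_trans (ler_normB _ _) _; apply: le_trans (lerD h2 h1) _.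
have h3 := ler_normD (c *: a) (h *: b).
have h4 : c * `|a| <= h * `|a| by rewrite ler_wpM2r // ltW.
have ca : `|c *: a| = c * `|a| by rewrite normrZ gtr0_norm.
have hb : `|h *: b| = h * `|b| by rewrite normrZ gtr0_norm.
have -> : e * h = e / C * (C * h) by rewrite mulrA divfK // gt_eqF.
by rewrite -mulrDr ler_pM2l // /C; lra.
Qed.

Lemma schwarz V (f : V -> R) x a b : (\forall y \near x, differentiable f y) ->
  differentiable ('D_a f) x -> differentiable ('D_b f) x ->
  'D_b ('D_a f) x = 'D_a ('D_b f) x.
Proof.
move=> df dfa dfb; have h1 := @second_difference _ f x a b df dfa; have h2 := @second_difference _ f x b a df dfb.
have e : (fun h : R => (f (h *: b + (h *: a + x)) - f (h *: b + x) - f (h *: a + x) + f x) / h ^+ 2) =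
    (fun h : R => (f (h *: a + (h *: b + x)) - f (h *: a + x) - f (h *: b + x) + f x) / h ^+ 2).
  apply/funext => h; congr (_ / _); rewrite [h *: b + (_ + _)]addrCA; congr (_ + _).
  by rewrite -!addrA; congr (_ + _); rewrite addrC.
by rewrite e in h2; exact: norm_cvg_unique h1 h2.
Qed.

End Calculus.

Section Smooth.
Variable R : realType.

Lemma Ck_on_sub m n k (A B : set 'rV[R]_m) (f : 'rV[R]_m -> 'rV[R]_n) :
  B `<=` A -> Ck_on k A f -> Ck_on k B f.
Proof.
move=> BA; elim: k f => [|k IH] f /=; first by move=> h x /BA; exact: h.
by move=> [h1 h2]; split=> [x /BA|v]; [exact: h1|exact: IH].
Qed.

Lemma Ck_on_ext m n k (A : set 'rV[R]_m) (f g : 'rV[R]_m -> 'rV[R]_n) : open A ->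
  (forall x, A x -> f x = g x) -> Ck_on k A f -> Ck_on k A g.
Proof.
move=> oA; have nA x : A x -> \forall y \near x, A y by move=> Ax; exact: open_nbhs_nbhs.
elim: k f g => [|k IH] f g fg /=.
  move=> h x Ax; have fgx : {near x, f =1 g} by apply: filterS (nA x Ax) => y /fg.
  change (g @ x --> g x); rewrite -(fg x Ax).
  have hx : f @ x --> f x by exact: h.
  exact: (@cvg_near_eq _ _ (nbhs x) _ f).
have nfg x : A x -> {near x, f =1 g} by move=> Ax; apply: filterS (nA x Ax) => y /fg.
move=> [h1 h2]; split=> [x Ax|v]; first exact: (near_eq_diff (nfg x Ax) (h1 x Ax)).1.
by apply: IH (h2 v) => x Ax; apply: near_eq_derive; exact: nfg.
Qed.

Lemma Ck_on_lin m n k (A : set 'rV[R]_m) (c : R) (f g : 'rV[R]_m -> 'rV[R]_n) : open A ->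
  Ck_on k A f -> Ck_on k A g -> Ck_on k A (c \*: f + g).
Proof.
move=> oA; elim: k f g => [|k IH] f g /=.
  move=> hf hg x Ax; apply: continuousD; last exact: hg.
  by have hx := hf x Ax; exact: cvgZl_tmp hx.
move=> [f1 f2] [g1 g2]; split=> [x Ax|v].
  by apply: differentiableD; [apply: differentiableZ; exact: f1|exact: g1].
apply: Ck_on_ext (IH _ _ (f2 v) (g2 v)) => // x Ax.
have h := @derive_lin _ _ _ c f g x v (f1 x Ax) (g1 x Ax); exact: (esym h).
Qed.

Lemma Ck_on0 m n k (A : set 'rV[R]_m) : Ck_on k A (0 : 'rV[R]_m -> 'rV[R]_n).
Proof.
elim: k => [|k IH] /=; first by move=> x _; exact: cst_continuous.
split=> [x _|v]; first exact: differentiable_cst.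
rewrite (_ : 'D_v _ = 0) //; apply/funext => x; exact: derive_cst.
Qed.

Lemma smooth_on_sum m n (A : set 'rV[R]_m) (I : Type) (r : seq I) (c : I -> R)
    (f : I -> 'rV[R]_m -> 'rV[R]_n) : open A -> (forall i, smooth_on A (f i)) ->
  smooth_on A (fun x => \sum_(i <- r) c i *: f i x).
Proof.
move=> oA hf k; elim: r => [|i r IH].
  by apply: Ck_on_ext oA _ (Ck_on0 n k A) => x _; rewrite big_nil.
apply: Ck_on_ext oA _ (Ck_on_lin (c i) oA (hf i k) IH) => x _.
by rewrite big_cons.
Qed.

Section SmoothOn.
Variables (m n : nat) (A : set 'rV[R]_m) (f : 'rV[R]_m -> 'rV[R]_n).
Hypothesis sf : smooth_on A f.

Lemma smooth_on_sub (B : set 'rV[R]_m) : B `<=` A -> smooth_on B f.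
Proof. by move=> BA k; exact: Ck_on_sub BA (sf k). Qed.

Lemma smooth_on_diff x : A x -> differentiable f x.
Proof. exact: (sf 1%N).1. Qed.

Lemma smooth_on_continuous x : A x -> f @ x --> f x.
Proof. exact: (sf 0%N). Qed.

Lemma smooth_on_derive v : smooth_on A ('D_v f).
Proof. by move=> k; exact: (sf k.+1).2. Qed.

End SmoothOn.

Lemma diffE_jacobian m n (f : 'rV[R]_m -> 'rV[R]_n) x v : 'd f x v = v *m jacobian f x.
Proof. by rewrite /jacobian mul_rV_lin1. Qed.

(** [smooth_on] controls derivatives in fixed directions only; basis directions give the rows of the
    whole differential. *)
Lemma cvg_jacobian m n (A : set 'rV[R]_m) (f : 'rV[R]_m -> 'rV[R]_n) x : open A ->
  smooth_on A f -> A x -> jacobian f @ x --> jacobian f x.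
Proof.
move=> oA sf Ax; apply: (@cvg_mx _ _ (nbhs x) _) => i j.
have e y : A y -> ('D_(delta_mx 0 i) f y) 0 j = jacobian f y i j.
  move=> Ay; rewrite deriveEjacobian; last exact: smooth_on_diff Ay.
  by have /rowP/(_ j) := rowE i (jacobian f y); rewrite mxE => ->.
have h : ('D_(delta_mx 0 i) f y) 0 j @[y --> x] --> ('D_(delta_mx 0 i) f x) 0 j.
  by apply: (@cvg_mxE _ _ (nbhs x) _); exact: smooth_on_continuous (smooth_on_derive sf _) _ Ax.
have {}e : {near x, (fun y => ('D_(delta_mx 0 i) f y) 0 j) =1 (fun y => jacobian f y i j)}.
  have nA : \forall y \near x, A y by exact: open_nbhs_nbhs.
  by apply: filterS nA => y /e.
have ex := nbhs_singleton e.
by apply: (@cvg_near_eq _ _ (nbhs x) _ _ _ _ e); rewrite -ex.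
Qed.

Lemma cvg_growth_rate (V W : normedModType R) (f : V -> W) x v : differentiable f x ->
  h^-1 *: (f (h *: v + x) - f x) @[h --> 0^'] --> 'd f x v.
Proof.
move=> df; rewrite -deriveE //.
by have := @diff_derivable _ _ _ f x v df.
Qed.

Lemma cvg_line (V : normedModType R) (v x : V) : (h *: v + x) @[h --> (0 : R)^'] --> x.
Proof.
have h : (h *: v + x) @[h --> (0 : R)] --> 0 *: v + x.
  by apply: cvgD; [apply: cvgZr_tmp; exact: cvg_id|exact: cvg_cst].
rewrite scale0r add0r in h; apply: cvg_trans h; apply: cvg_app; exact: cvg_within.
Qed.

Lemma near_line (V : normedModType R) (v x : V) (P : set V) : nbhs x P ->
  \forall h \near (0 : R)^', P (h *: v + x).
Proof. by move: P; exact: cvg_line. Qed.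

Lemma cvg_along_line (V W : normedModType R) (f : V -> W) v x : f @ x --> f x ->
  f (h *: v + x) @[h --> (0 : R)^'] --> f x.
Proof. by move=> cf P /cf; exact: cvg_line. Qed.

Lemma diff_chain (U V W : normedModType R) (f : U -> V) (g : V -> W) x z :
  differentiable f x -> differentiable g (f x) -> 'd g (f x) ('d f x z) = 'D_z (g \o f) x.
Proof.
move=> df dg; have dgf := differentiable_comp df dg.
rewrite (deriveE _ dgf); have /(congr1 (fun k => k z)) h := diff_comp df dg.
exact: (esym h).
Qed.

(** The Leibniz rule for a differential applied to a moving vector. The difference quotient is split
    so that only Y and the fixed-direction derivative ['D_(Y v) f] are differentiated. *)
Lemma derive_pushforward m n (A : set 'rV[R]_m) (f : 'rV[R]_m -> 'rV[R]_n)
    (Y : 'rV[R]_m -> 'rV[R]_m) v z : open A -> smooth_on A f -> A v -> differentiable Y v ->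
  'D_z (fun w => 'd f w (Y w)) v = 'd f v ('d Y v z) + 'D_z ('D_(Y v) f) v.
Proof.
move=> oA sf Av dY.
have h1 : (h^-1 *: (Y (h *: z + v) - Y v)) *m jacobian f (h *: z + v) @[h --> 0^'] -->
    'd Y v z *m jacobian f v.
  apply: cvg_mulmx; first exact: cvg_growth_rate.
  by apply: (@cvg_along_line _ _ (jacobian f)); exact: cvg_jacobian Av.
have dD : differentiable ('D_(Y v) f) v by exact: smooth_on_diff (smooth_on_derive sf (Y v)) _ Av.
have h2 : h^-1 *: ('D_(Y v) f (h *: z + v) - 'D_(Y v) f v) @[h --> 0^'] --> 'd ('D_(Y v) f) v z.
  exact: (@cvg_growth_rate _ _ ('D_(Y v) f) v z dD).
have e u w : 'd f u w = w *m jacobian f u by exact: diffE_jacobian.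
have eD w u : A u -> 'D_w f u = w *m jacobian f u.
  by move=> Au; apply: deriveEjacobian; exact: smooth_on_diff Au.
transitivity ('d Y v z *m jacobian f v + 'd ('D_(Y v) f) v z); last first.
  by congr (_ + _); [exact: esym (e _ _)|exact: esym (deriveE _ dD)].
apply: cvg_lim => //.
have h12 : (h^-1 *: (Y (h *: z + v) - Y v)) *m jacobian f (h *: z + v) +
   h^-1 *: ('D_(Y v) f (h *: z + v) - 'D_(Y v) f v) @[h --> 0^'] -->
   'd Y v z *m jacobian f v + 'd ('D_(Y v) f) v z by exact: cvgD.
apply: cvg_near_eq h12.
have nA : \forall h \near (0 : R)^', A (h *: z + v).
  by apply: near_line; exact: open_nbhs_nbhs.
apply: filterS nA => h Ah.
change ((h^-1 *: (Y (h *: z + v) - Y v)) *m jacobian f (h *: z + v) +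
   h^-1 *: ('D_(Y v) f (h *: z + v) - 'D_(Y v) f v) =
   h^-1 *: ('d f (h *: z + v) (Y (h *: z + v)) - 'd f v (Y v))).
have e1 := eD (Y v) _ Ah; have e2 := eD (Y v) _ Av.
have e3 := e (h *: z + v) (Y (h *: z + v)); have e4 := e v (Y v).
have alg (c : R) (a b : 'rV[R]_m) (J J0 : 'M[R]_(m, n)) (d d0 g g0 : 'rV[R]_n) :
    d = b *m J -> d0 = b *m J0 -> g = a *m J -> g0 = b *m J0 ->
    (c *: (a - b)) *m J + c *: (d - d0) = c *: (g - g0).
  by move=> -> -> -> ->; rewrite -scalemxAl -scalerDr mulmxBl addrA subrK.
exact: alg e1 e2 e3 e4.
Qed.

Lemma schwarz_rV m n (A : set 'rV[R]_m) (f : 'rV[R]_m -> 'rV[R]_n) v a b : open A ->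
  smooth_on A f -> A v -> 'D_a ('D_b f) v = 'D_b ('D_a f) v.
Proof.
move=> oA sf Av.
have nA : \forall w \near v, A w by exact: open_nbhs_nbhs.
have coord (g : 'rV[R]_m -> 'rV[R]_n) w c j : differentiable g w ->
    ('D_c g w) 0 j = 'D_c (fun t => g t 0 j) w.
  by move=> dg; rewrite derive_mx ?mxE //; exact: diff_derivable.
have dcoord (g : 'rV[R]_m -> 'rV[R]_n) w j : differentiable g w ->
    differentiable (fun t => g t 0 j) w.
  by move=> dg; apply: (@differentiable_comp _ _ _ _ g (fun M : 'rV_n => M 0 j));
    [exact: dg|exact: differentiable_coord].
have sD c := smooth_on_derive sf c.
have dD c : differentiable ('D_c f) v by exact: smooth_on_diff (sD c) _ Av.
apply/rowP => j.
have e c : {near v, (fun t => 'D_c f t 0 j) =1 'D_c (fun t => f t 0 j)}.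
  by apply: filterS nA => w Aw; apply: coord; exact: smooth_on_diff Aw.
have e2 c d : ('D_c ('D_d f) v) 0 j = 'D_c ('D_d (fun t => f t 0 j)) v.
  transitivity ('D_c (fun t => 'D_d f t 0 j) v); first exact: coord (dD d).
  exact: near_eq_derive (e d).
have dj c : differentiable ('D_c (fun t => f t 0 j)) v.
  apply: (near_eq_diff (e c) _).1; exact: dcoord (dD c).
have df : \forall w \near v, differentiable (fun t => f t 0 j) w.
  by apply: filterS nA => w Aw; apply: dcoord; exact: smooth_on_diff Aw.
transitivity ('D_a ('D_b (fun t => f t 0 j)) v); first exact: e2.
transitivity ('D_b ('D_a (fun t => f t 0 j)) v); last exact: esym (e2 _ _).
exact: schwarz.
Qed.

Definition chart_bracket n (Y Z : 'rV[R]_n -> 'rV[R]_n) u : 'rV[R]_n :=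
  'd Z u (Y u) - 'd Y u (Z u).

(** In the difference of the two pushed-forward derivatives the second derivatives of f cancel by
    their symmetry. *)
Lemma chart_bracket_pushforward n (A : set 'rV[R]_n) (f Y Z Y' Z' : 'rV[R]_n -> 'rV[R]_n) v :
  open A -> smooth_on A f -> A v -> differentiable Y v -> differentiable Z v ->
  differentiable Y' (f v) -> differentiable Z' (f v) ->
  (forall w, A w -> Y' (f w) = 'd f w (Y w)) -> (forall w, A w -> Z' (f w) = 'd f w (Z w)) ->
  chart_bracket Y' Z' (f v) = 'd f v (chart_bracket Y Z v).
Proof.
move=> oA sf Av dY dZ dY' dZ' eY eZ.
have nA : \forall w \near v, A w by exact: open_nbhs_nbhs.
have df : differentiable f v by exact: smooth_on_diff Av.
have key (T T' : 'rV[R]_n -> 'rV[R]_n) z : differentiable T v -> differentiable T' (f v) ->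
    (forall w, A w -> T' (f w) = 'd f w (T w)) ->
    'd T' (f v) ('d f v z) = 'd f v ('d T v z) + 'D_z ('D_(T v) f) v.
  move=> dT dT' eT; rewrite -(derive_pushforward z oA sf Av dT).
  transitivity ('D_z (T' \o f) v); first exact: diff_chain.
  by apply: near_eq_derive; apply: filterS nA => w /eT.
have eYv := eY v Av; have eZv := eZ v Av.
have k1 := key Z Z' (Y v) dZ dZ' eZ; have k2 := key Y Y' (Z v) dY dY' eY.
have sw := schwarz_rV (Y v) (Z v) oA sf Av.
transitivity ('d Z' (f v) ('d f v (Y v)) - 'd Y' (f v) ('d f v (Z v))).
  by rewrite /chart_bracket; congr ('d Z' (f v) _ - 'd Y' (f v) _).
have alg (V : zmodType) (a b x y s s' : V) :
    a = x + s -> b = y + s' -> s = s' -> a - b = x - y.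
  by move=> -> -> ->; rewrite opprD addrACA subrr addr0.
transitivity ('d f v ('d Z v (Y v)) - 'd f v ('d Y v (Z v))); first exact: alg k1 k2 sw.
exact: esym (linearB _ _ _).
Qed.

Lemma cvg_chart_bracket n (A : set 'rV[R]_n) (Y Z : 'rV[R]_n -> 'rV[R]_n) u : open A ->
  smooth_on A Y -> smooth_on A Z -> A u -> chart_bracket Y Z @ u --> chart_bracket Y Z u.
Proof.
move=> oA sY sZ Au.
have e w : chart_bracket Y Z w = Y w *m jacobian Z w - Z w *m jacobian Y w.
  by rewrite /chart_bracket; congr (_ - _); exact: diffE_jacobian.
rewrite e (_ : chart_bracket Y Z = fun w => Y w *m jacobian Z w - Z w *m jacobian Y w); last first.
  by apply/funext.
have aux T (F : set_system T) (FF : Filter F) (a b : T -> 'rV[R]_n) (c d : T -> 'M[R]_n)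
    (a0 b0 : 'rV[R]_n) (c0 d0 : 'M[R]_n) :
    a @ F --> a0 -> b @ F --> b0 -> c @ F --> c0 -> d @ F --> d0 ->
    a x *m c x - b x *m d x @[x --> F] --> (a0 *m c0 - b0 *m d0 : 'rV[R]_n).
  by move=> ha hb hc hd; apply: cvgB; exact: cvg_mulmx.
apply: (aux _ (nbhs u) _).
- exact: smooth_on_continuous Au.
- exact: smooth_on_continuous Au.
- exact: cvg_jacobian Au.
- exact: cvg_jacobian Au.
Qed.

(** Near the limit G x H is invertible, so the coefficients are given by r = y H (G H)^-1, which is
    continuous in the data. *)
Lemma cvg_linear_system T (F : set_system T) {FF : Filter F} m n (r : T -> 'rV[R]_m)
    (G : T -> 'M[R]_(m, n)) (y : T -> 'rV[R]_n)
    (G0 : 'M[R]_(m, n)) (y0 : 'rV[R]_n) (H : 'M[R]_(n, m)) :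
  (\forall x \near F, r x *m G x = y x) -> G @ F --> G0 -> y @ F --> y0 ->
  G0 *m H = 1%:M -> r @ F --> y0 *m H.
Proof.
move=> e cG cy GH.
have h1 : (G x *m H) @[x --> F] --> (1%:M : 'M[R]_m).
  by rewrite -GH; apply: cvg_mulmx => //; exact: cvg_cst.
have u1 : (1%:M : 'M[R]_m) \in unitmx by exact: unitmx1.
have h2 : invmx (G x *m H) @[x --> F] --> (1%:M : 'M[R]_m).
  by rewrite -[X in _ --> X]invmx1; exact: cvg_invmx.
have h3 : (y x *m H *m invmx (G x *m H)) @[x --> F] --> y0 *m H *m 1%:M.
  by apply: cvg_mulmx => //; apply: cvg_mulmx => //; exact: cvg_cst.
rewrite mulmx1 in h3; apply: cvg_trans h3; apply: near_eq_cvg.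
have n1 : \forall x \near F, G x *m H \in unitmx.
  have hd : \det (G x *m H) @[x --> F] --> \det (1%:M : 'M[R]_m) by exact: cvg_det.
  have : \forall x \near F, \det (G x *m H) != 0.
    by apply: (cvgr_neq0 (\det (1%:M : 'M[R]_m))) => //; rewrite det1 oner_neq0.
  by apply: filterS => x; rewrite unitmxE unitfE.
apply: filterS2 e n1 => x ex ux; rewrite -ex -[r x *m _ *m _]mulmxA mulmxK //.
Qed.

(* Modulo the span at [u] of the sections [E a], the differential of a combination of the
   [E a] only involves the values at [u] of the coefficients, which therefore need not be
   differentiable. *)
Lemma diff_section m n p q (Y : 'rV[R]_m -> 'rV[R]_n) (c : 'rV[R]_m -> 'rV[R]_p)
    (E : 'I_p -> 'rV[R]_m -> 'rV[R]_n) (P : 'M[R]_(n, q)) u v :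
  differentiable Y u -> (forall a, differentiable (E a) u) -> c @ u --> c u ->
  (\forall w \near u, Y w = \sum_a c w 0 a *: E a w) -> (forall a, E a u *m P = 0) ->
  'd Y u v *m P = \sum_a c u 0 a *: ('d (E a) u v *m P).
Proof.
move=> dY dE cc YE EP.
have Yu : Y u *m P = 0.
  rewrite (nbhs_singleton YE) mulmx_suml big1 // => a _.
  by rewrite -scalemxAl EP scaler0.
have h1 : (h^-1 *: (Y (h *: v + u) - Y u)) *m P @[h --> 0^'] --> 'd Y u v *m P.
  by apply: cvg_mulmx; [exact: cvg_growth_rate|exact: cvg_cst].
have h2 : \sum_a c (h *: v + u) 0 a *: ((h^-1 *: (E a (h *: v + u) - E a u)) *m P) @[h --> 0^']
    --> \sum_a c u 0 a *: ('d (E a) u v *m P).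
  apply: cvg_bigsum => a _; apply: cvgZ.
    have h : c (h *: v + u) @[h --> (0 : R)^'] --> c u by exact: (@cvg_along_line _ _ c).
    exact: cvg_mxE.
  by apply: cvg_mulmx; [exact: cvg_growth_rate|exact: cvg_cst].
apply: (norm_cvg_unique h1); apply: cvg_trans h2; apply: near_eq_cvg.
have n1 : \forall h \near (0 : R)^', Y (h *: v + u) = \sum_a c (h *: v + u) 0 a *: E a (h *: v + u).
  exact: near_line YE.
apply: filterS n1 => h Yh /=; rewrite -scalemxAl mulmxBl Yu subr0 Yh mulmx_suml scaler_sumr.
apply: eq_bigr => a _; rewrite -!scalemxAl mulmxBl EP subr0 !scalerA.
by congr (_ *: _); rewrite mulrC.
Qed.

End Smooth.

(** * The Levi bracket *)

Section Charts.
Variables (R : realType) (n : nat) (X : manifold R n).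
Implicit Types (i j k : mf_index X) (x : X) (A : set X) (Y Z : vfield X).

Lemma open_chart_image i A : open A -> open (mf_phi i @` (A `&` mf_dom i)).
Proof.
move=> oA; rewrite openE => _ [x [Ax ix] <-].
have n1 : \forall u \near mf_phi i x, (mf_phi i @` mf_dom i) u.
  by apply: open_nbhs_nbhs; split; [exact: mf_img_open|exists x].
have n2 : \forall u \near mf_phi i x, A (mf_psi i u).
  by apply: (mf_psi_cont ix); rewrite mf_phiK //; exact: open_nbhs_nbhs.
by apply: filterS2 n1 n2 => _ [y iy <-]; rewrite mf_phiK // => Ay; exists y.
Qed.

Lemma transition_smooth i j A : smooth_on (mf_phi i @` (A `&` mf_dom j `&` mf_dom i))
  (mf_phi j \o mf_psi i).
Proof.
have sf := @mf_smooth _ _ X i j.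
apply: (smooth_on_sub sf) => _ [x [[_ jx] ix] <-].
by exists x.
Qed.

Lemma transition_diff i j x : mf_dom i x -> mf_dom j x ->
  differentiable (mf_phi j \o mf_psi i) (mf_phi i x).
Proof.
move=> ix jx; apply: (smooth_on_diff (@mf_smooth _ _ X i j)).
by exists x.
Qed.

Lemma tchange_comp i j k x v : mf_dom i x -> mf_dom j x -> mf_dom k x ->
  tchange j k x (tchange i j x v) = tchange i k x v.
Proof.
move=> ix jx kx; rewrite /tchange.
have jE : (mf_phi j \o mf_psi i) (mf_phi i x) = mf_phi j x by rewrite /= mf_phiK.
have dij := transition_diff ix jx.
have djk : differentiable (mf_phi k \o mf_psi j) ((mf_phi j \o mf_psi i) (mf_phi i x)).
  by rewrite jE; exact: transition_diff.
have h := diff_chain v dij djk; rewrite jE in h.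
transitivity ('D_v ((mf_phi k \o mf_psi j) \o (mf_phi j \o mf_psi i)) (mf_phi i x)).
  exact: h.
transitivity ('D_v (mf_phi k \o mf_psi i) (mf_phi i x)); last first.
  exact: deriveE (transition_diff ix kx).
apply: near_eq_derive.
have nu : \forall u \near mf_phi i x, (mf_phi i @` (mf_dom j `&` mf_dom i)) u.
  by apply: open_nbhs_nbhs; split; [apply: open_chart_image; exact: mf_dom_open|exists x].
by apply: filterS nu => _ [y [jy iy] <-]; rewrite /= mf_phiK // mf_phiK.
Qed.

Lemma tchange_id i x v : mf_dom i x -> tchange i i x v = v.
Proof.
move=> ix; transitivity ('D_v (mf_phi i \o mf_psi i) (mf_phi i x)).
  exact: esym (deriveE _ (transition_diff ix ix)).
transitivity ('D_v (@id 'rV[R]_n) (mf_phi i x)); last exact: derive_id.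
apply: near_eq_derive.
have nu : \forall u \near mf_phi i x, (mf_phi i @` mf_dom i) u.
  by apply: open_nbhs_nbhs; split; [exact: mf_img_open|exists x].
by apply: filterS nu => _ [y iy <-]; rewrite /= mf_phiK.
Qed.

Lemma tchange_sum (I : finType) i j x (c : I -> R) (v : I -> 'rV[R]_n) :
  tchange i j x (\sum_a c a *: v a) = \sum_a c a *: tchange i j x (v a).
Proof.
rewrite /tchange; transitivity (\sum_a 'd (mf_phi j \o mf_psi i) (mf_phi i x) (c a *: v a)).
  exact: linear_sum.
by apply: eq_bigr => a _; exact: linearZ.
Qed.

Lemma vf_coordE i Y x : mf_dom i x -> vf_coord i Y (mf_phi i x) = tchange (mf_at x) i x (Y x).
Proof. by move=> ix; rewrite /vf_coord /= mf_phiK. Qed.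

Lemma vf_coord_at Y x : vf_coord (mf_at x) Y (mf_phi (mf_at x) x) = Y x.
Proof. by rewrite vf_coordE ?tchange_id //; exact: mf_atP. Qed.

Lemma vf_coord_tchange i j Y x : mf_dom i x -> mf_dom j x ->
  vf_coord j Y (mf_phi j x) = tchange i j x (vf_coord i Y (mf_phi i x)).
Proof. by move=> ix jx; rewrite !vf_coordE // tchange_comp //; exact: mf_atP. Qed.

Lemma smooth_vf_sum (I : finType) A (c : I -> R) (F : I -> vfield X) : open A ->
  (forall a, smooth_vf A (F a)) -> smooth_vf A (fun x => \sum_a c a *: F a x).
Proof.
move=> oA sF i.
have -> : vf_coord i (fun x => \sum_a c a *: F a x) = (fun u => \sum_a c a *: vf_coord i (F a) u).
  by apply/funext => u; exact: tchange_sum.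
by apply: smooth_on_sum => [|a]; [exact: open_chart_image|exact: sF].
Qed.

Lemma smooth_vf_diff A Y i x : smooth_vf A Y -> A x -> mf_dom i x ->
  differentiable (vf_coord i Y) (mf_phi i x).
Proof. by move=> sY Ax ix; apply: (smooth_on_diff (sY i)); exists x. Qed.

(** [lie_bracket] is computed in the preferred chart at x, which need not vary continuously with x;
    naturality under the transition map moves the computation to any fixed chart. *)
Lemma lie_bracketE A Y Z i x : open A -> smooth_vf A Y -> smooth_vf A Z -> A x -> mf_dom i x ->
  tchange (mf_at x) i x (lie_bracket Y Z x) =
  chart_bracket (vf_coord i Y) (vf_coord i Z) (mf_phi i x).
Proof.
move=> oA sY sZ Ax ix; set j := mf_at x; have jx : mf_dom j x by exact: mf_atP.
set f := mf_phi i \o mf_psi j.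
have fE y : mf_dom j y -> f (mf_phi j y) = mf_phi i y by move=> jy; rewrite /f /= mf_phiK.
have oB : open (mf_phi j @` (A `&` mf_dom i `&` mf_dom j)).
  by apply: open_chart_image; apply: openI => //; exact: mf_dom_open.
have push T w : (mf_phi j @` (A `&` mf_dom i `&` mf_dom j)) w ->
    vf_coord i T (f w) = 'd f w (vf_coord j T w).
  by move=> [y [[_ iy] jy] <-]; rewrite fE //; exact: vf_coord_tchange.
have Bx : (mf_phi j @` (A `&` mf_dom i `&` mf_dom j)) (mf_phi j x) by exists x.
have sf := @transition_smooth j i A.
have h u : f (mf_phi j x) = u ->
    differentiable (vf_coord i Y) u -> differentiable (vf_coord i Z) u ->
    chart_bracket (vf_coord i Y) (vf_coord i Z) u =
    'd f (mf_phi j x) (chart_bracket (vf_coord j Y) (vf_coord j Z) (mf_phi j x)).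
  move=> <- dY dZ; apply: (chart_bracket_pushforward oB sf Bx) dY dZ (push Y) (push Z).
    exact: smooth_vf_diff sY Ax jx.
  exact: smooth_vf_diff sZ Ax jx.
apply: esym; apply: h (fE x jx) _ _; first exact: smooth_vf_diff sY Ax ix.
exact: smooth_vf_diff sZ Ax ix.
Qed.

End Charts.

Section LinearAlgebra.
Variable R : realType.

(** Multiplication by P plays the role of the quotient map by U within matrix calculus. *)
Lemma vspace_equations n (U : {vspace 'rV[R]_n}) :
  exists P : 'M[R]_n, forall v, (v *m P == 0) = (v \in U).
Proof.
exists (1%:M - lin1_mx (projv U)) => v.
rewrite mulmxBr mulmx1 mul_rV_lin1 subr_eq0.
apply/eqP/idP => [e|vU]; last exact: esym (projv_id vU).
by rewrite e; exact: memv_proj.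
Qed.

Lemma mulmx_rows p n (r : 'rV[R]_p) (g : 'I_p -> 'rV[R]_n) :
  r *m \matrix_(a < p) g a = \sum_a r 0 a *: g a.
Proof. by rewrite mulmx_sum_row; apply: eq_bigr => a _; rewrite rowK. Qed.

End LinearAlgebra.

HB.instance Definition _ (R : realType) (V : vectType R) (U : {vspace V}) :=
  GRing.isLinear.Build R V (quotv U) *:%R (qproj U) (qproj_linear U).

Section Sections.
Variable R : realType.

Lemma cvg_linear_system_at (T : topologicalType) m n (r : T -> 'rV[R]_m)
    (G : T -> 'M[R]_(m, n)) (y : T -> 'rV[R]_n) (H : 'M[R]_(n, m)) x :
  (\forall z \near x, r z *m G z = y z) -> G @ x --> G x -> y @ x --> y x ->
  G x *m H = 1%:M -> r @ x --> r x.
Proof.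
move=> e cG cy GH.
have rx : r x = y x *m H by rewrite -(nbhs_singleton e) -mulmxA GH mulmx1.
by rewrite rx; exact: (@cvg_linear_system _ _ (nbhs x) _ _ _ r G y (G x)).
Qed.

Lemma right_inverse_rows p n (g : 'I_p -> 'rV[R]_n) :
  (forall r : 'rV[R]_p, \sum_a r 0 a *: g a = 0 -> r = 0) ->
  exists H, (\matrix_(a < p) g a) *m H = 1%:M.
Proof.
move=> inj; apply/row_freeP; apply: inj_row_free => r; rewrite mulmx_rows.
exact: inj.
Qed.

(** Tensoriality in a chart: by [diff_section] the differentials of Y and Z modulo the span see the
    coefficients only through their values at u, and the terms regroup into brackets of the E a. *)
Lemma chart_bracket_sections n p q (Y Z : 'rV[R]_n -> 'rV[R]_n) (c d : 'rV[R]_n -> 'rV[R]_p)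
    (E : 'I_p -> 'rV[R]_n -> 'rV[R]_n) (P : 'M[R]_(n, q)) u :
  differentiable Y u -> differentiable Z u -> (forall a, differentiable (E a) u) ->
  c @ u --> c u -> d @ u --> d u ->
  (\forall w \near u, Y w = \sum_a c w 0 a *: E a w) ->
  (\forall w \near u, Z w = \sum_a d w 0 a *: E a w) ->
  (forall a, E a u *m P = 0) ->
  chart_bracket Y Z u *m P =
  \sum_a \sum_b (c u 0 a * d u 0 b) *: (chart_bracket (E a) (E b) u *m P).
Proof.
move=> dY dZ dE cc cd YE ZE EP.
have hY := diff_section (Z u) dY dE cc YE EP; have hZ := diff_section (Y u) dZ dE cd ZE EP.
have Yu := nbhs_singleton YE; have Zu := nbhs_singleton ZE.
pose J a := jacobian (E a) u.
have eJ a v : 'd (E a) u v = v *m J a by exact: diffE_jacobian.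
have lhs : chart_bracket Y Z u *m P = \sum_a d u 0 a *: (Y u *m J a *m P) -
    \sum_a c u 0 a *: (Z u *m J a *m P).
  transitivity ('d Z u (Y u) *m P - 'd Y u (Z u) *m P); first exact: mulmxBl.
  rewrite hY hZ; congr (_ - _); apply: eq_bigr => a _; congr (_ *: (_ *m _)); exact: eJ.
have rhs a b : chart_bracket (E a) (E b) u *m P = E a u *m J b *m P - E b u *m J a *m P.
  transitivity (('d (E b) u (E a u) - 'd (E a) u (E b u)) *m P); first by [].
  have e1 := eJ b (E a u); have e2 := eJ a (E b u).
  have alg (x y x' y' : 'rV[R]_n) : x = x' -> y = y' -> (x - y) *m P = x' *m P - y' *m P.
    by move=> -> ->; rewrite mulmxBl.
  exact: alg e1 e2.
rewrite lhs.
transitivity (\sum_a \sum_b (c u 0 a * d u 0 b) *: (E a u *m J b *m P - E b u *m J a *m P)).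
  under [RHS]eq_bigr do under eq_bigr do rewrite scalerBr.
  under [RHS]eq_bigr do rewrite sumrB.
  rewrite sumrB; congr (_ - _).
    rewrite [RHS]exchange_big /=; apply: eq_bigr => b _.
    rewrite Yu !mulmx_suml scaler_sumr; apply: eq_bigr => a _.
    by rewrite -!scalemxAl scalerA mulrC.
  apply: eq_bigr => a _; rewrite Zu !mulmx_suml scaler_sumr; apply: eq_bigr => b _.
  by rewrite -!scalemxAl scalerA.
by apply: eq_bigr => a _; apply: eq_bigr => b _; rewrite rhs.
Qed.

End Sections.

(** * Tensoriality of the Levi bracket *)

Section LocalFrame.
Variables (R : realType) (n : nat) (X : manifold R n) (D : tangent_subspaces X) (p : nat).
Variables (A : set X) (F : 'I_p -> vfield X).
Hypothesis oA : open A.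
Hypothesis sF : forall a, smooth_vf A (F a).
Hypothesis dimD : forall x, \dim (D x) = p.
Hypothesis spanF : forall x, A x -> D x = <<[seq F a x | a : 'I_p]>>%VS.

Definition frame_values x : p.-tuple (tangent x) := [tuple F a x | a < p].

Lemma frame_values_basis x : A x -> basis_of (D x) (frame_values x).
Proof.
move=> Ax; rewrite basisEdim size_tuple dimD leqnn andbT (spanF Ax).
exact: subvv.
Qed.

Lemma frame_section a : vf_section A D (F a).
Proof.
split=> // x Ax; have := basis_mem (frame_values_basis Ax) (mem_tnth a (frame_values x)).
by rewrite tnth_mktuple.
Qed.

Lemma frame_expand x v : A x -> v \in D x ->
  v = \sum_a coord (frame_values x) a v *: (F a x : 'rV[R]_n) :> 'rV[R]_n.
Proof.
move=> Ax vD; rewrite {1}(coord_basis (frame_values_basis Ax) vD).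
by apply: eq_bigr => a _; rewrite -tnth_nth tnth_mktuple.
Qed.

Lemma frame_free x (r : 'rV[R]_p) : A x -> \sum_a r 0 a *: (F a x : 'rV[R]_n) = 0 -> r = 0.
Proof.
move=> Ax h; apply/rowP => a; rewrite mxE.
have /freeP := basis_free (frame_values_basis Ax); apply => //.
rewrite -[RHS]h; apply: eq_bigr => b _; congr (_ *: _).
by rewrite -tnth_nth tnth_mktuple.
Qed.

Definition section_coord (Y : vfield X) (x : X) : 'rV[R]_p :=
  \row_a coord (frame_values x) a (Y x).

Lemma chart_section B Y i x : vf_section B D Y -> A x -> B x -> mf_dom i x ->
  vf_coord i Y (mf_phi i x) =
  \sum_a section_coord Y x 0 a *: vf_coord i (F a) (mf_phi i x).
Proof.
move=> [_ DY] Ax Bx ix; rewrite vf_coordE //.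
transitivity (tchange (mf_at x) i x
  (\sum_a coord (frame_values x) a (Y x) *: (F a x : 'rV[R]_n))).
  by congr tchange; exact: frame_expand (DY x Bx).
rewrite tchange_sum; apply: eq_bigr => a _.
by rewrite mxE vf_coordE.
Qed.

Lemma near_chart i x (B : set X) : mf_dom i x -> open_nbhs x B ->
  \forall u \near mf_phi i x, exists y, [/\ B y, mf_dom i y & u = mf_phi i y].
Proof.
move=> ix [oB Bx].
have : nbhs (mf_phi i x) (mf_phi i @` (B `&` mf_dom i)).
  by apply: open_nbhs_nbhs; split; [exact: open_chart_image|exists x].
by apply: filterS => _ [y [By iy] <-]; exists y.
Qed.

(** Continuity is all that [diff_section] asks of the coefficients; they solve a linear system with
    continuous data, as the frame is independent at x. *)
Lemma cvg_section_coord B Y x : open_nbhs x B -> vf_section B D Y -> A x ->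
  (fun u => section_coord Y (mf_psi (mf_at x) u)) @ (mf_phi (mf_at x) x) -->
  section_coord Y (mf_psi (mf_at x) (mf_phi (mf_at x) x)).
Proof.
move=> xB sY Ax; set i := mf_at x; set u := mf_phi i x.
have ix : mf_dom i x by exact: mf_atP.
have [H HP] : exists H, (\matrix_(a < p) (F a x : 'rV[R]_n)) *m H = 1%:M.
  by apply: right_inverse_rows => r; exact: frame_free.
have cF a : vf_coord i (F a) @ u --> vf_coord i (F a) u.
  by apply: (smooth_on_continuous (sF a i)); exists x.
have cY : vf_coord i Y @ u --> vf_coord i Y u.
  by apply: (smooth_on_continuous (sY.1 i)); exists x => //; split=> //; exact: xB.2.
apply: (@cvg_linear_system_at _ _ _ _ (fun w => section_coord Y (mf_psi i w))
  (fun w => \matrix_(a < p) vf_coord i (F a) w) (vf_coord i Y) H u) => //.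
- have nAB : open_nbhs x (A `&` B).
    by split; [apply: openI => //; exact: xB.1|split=> //; exact: xB.2].
  apply: filterS (near_chart ix nAB) => _ [y [[Ay By] iy ->]].
  by rewrite mulmx_rows mf_phiK //; exact: esym (chart_section sY Ay By iy).
- apply: (@cvg_mx _ _ (nbhs u) _) => a j; under eq_fun do rewrite mxE.
  by rewrite mxE; apply: (@cvg_mxE _ _ (nbhs u) _); exact: cF.
- rewrite -HP; congr (_ *m _); apply/matrixP => a j; rewrite !mxE.
  by rewrite /u /i vf_coord_at.
Qed.

Lemma lie_bracket_sections B Y Z x : open_nbhs x B -> vf_section B D Y -> vf_section B D Z -> A x ->
  qproj (D x) (lie_bracket Y Z x) = \sum_a \sum_b
    (section_coord Y x 0 a * section_coord Z x 0 b) *: qproj (D x) (lie_bracket (F a) (F b) x).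
Proof.
move=> xB sY sZ Ax; set i := mf_at x; set u := mf_phi i x.
have ix : mf_dom i x by exact: mf_atP.
have ux : mf_psi i u = x by exact: mf_phiK.
have [P PP] := @vspace_equations R n (D x).
have nAB : open_nbhs x (A `&` B).
  by split; [apply: openI => //; exact: xB.1|split=> //; exact: xB.2].
have near_sum T : vf_section B D T -> \forall w \near u,
    vf_coord i T w = \sum_a section_coord T (mf_psi i w) 0 a *: vf_coord i (F a) w.
  move=> sT; apply: filterS (near_chart ix nAB) => _ [y [[Ay By] iy ->]].
  by rewrite mf_phiK //; exact: chart_section sT Ay By iy.
have FP a : vf_coord i (F a) u *m P = 0.
  apply/eqP; rewrite PP /u /i vf_coord_at; exact: (frame_section a).2.
have dF a : differentiable (vf_coord i (F a)) u by exact: smooth_vf_diff (sF a) Ax ix.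
have key := @chart_bracket_sections R n p n (vf_coord i Y) (vf_coord i Z)
  (fun w => section_coord Y (mf_psi i w)) (fun w => section_coord Z (mf_psi i w))
  (fun a => vf_coord i (F a)) P u (smooth_vf_diff sY.1 xB.2 ix) (smooth_vf_diff sZ.1 xB.2 ix)
  dF (cvg_section_coord xB sY Ax) (cvg_section_coord xB sZ Ax)
  (near_sum Y sY) (near_sum Z sZ) FP.
rewrite ux in key.
pose w : 'rV[R]_n := \sum_a \sum_b (section_coord Y x 0 a * section_coord Z x 0 b) *:
  (lie_bracket (F a) (F b) x : 'rV[R]_n).
transitivity (qproj (D x) w); last first.
  have qs (I : finType) (f : I -> tangent x) : qproj (D x) (\sum_a f a) = \sum_a qproj (D x) (f a).
    exact: linear_sum.
  transitivity (\sum_a qproj (D x) (\sum_b (section_coord Y x 0 a * section_coord Z x 0 b) *: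
    lie_bracket (F a) (F b) x)); first exact: qs.
  apply: eq_bigr => a _; rewrite qs; apply: eq_bigr => b _; exact: linearZ.
apply/eqP; rewrite -subr_eq0; apply/eqP.
transitivity (qproj (D x) (lie_bracket Y Z x - w)); first exact: esym (linearB _ _ _).
apply/eqP; rewrite qproj_eq0 -PP; apply/eqP.
transitivity ((lie_bracket Y Z x : 'rV[R]_n) *m P - w *m P); first exact: mulmxBl.
apply/eqP; rewrite subr_eq0; apply/eqP; rewrite /w mulmx_suml.
transitivity (chart_bracket (vf_coord i Y) (vf_coord i Z) u *m P); first by [].
rewrite key; apply: eq_bigr => a _; rewrite mulmx_suml; apply: eq_bigr => b _.
by rewrite -scalemxAl.
Qed.

Definition constant_section x (v : 'rV[R]_n) : vfield X :=
  fun y => \sum_a coord (frame_values x) a v *: F a y.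

Lemma constant_sectionP x v : A x -> v \in D x ->
  vf_section A D (constant_section x v) /\ constant_section x v x = v.
Proof.
move=> Ax vD; split; last exact: esym (frame_expand Ax vD).
split=> [|y Ay]; first exact: smooth_vf_sum.
by apply: memv_suml => a _; apply: memvZ; exact: (frame_section a).2.
Qed.

(** The set in the definition of [levi] is inhabited, by sections with constant coefficients in the
    local frame, and [lie_bracket_sections] gives all its elements the same value; hence the default
    of [xget] is never taken. *)
Lemma levi_frame x (u v : Dspace D x) : A x ->
  levi D x u v = \sum_a \sum_b
    (coord (frame_values x) a (vsval u) * coord (frame_values x) b (vsval v)) *:
    qproj (D x) (lie_bracket (F a) (F b) x).
Proof.
move=> Ax; have xA : open_nbhs x A by [].
have uniq w : (exists B Y Z, [/\ open_nbhs x B, vf_section B D Y /\ vf_section B D Z,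
    Y x = vsval u /\ Z x = vsval v & w = qproj (D x) (lie_bracket Y Z x)]) ->
  w = \sum_a \sum_b
    (coord (frame_values x) a (vsval u) * coord (frame_values x) b (vsval v)) *:
    qproj (D x) (lie_bracket (F a) (F b) x).
  move=> [B [Y [Z [xB [sY sZ] [Yx Zx] ->]]]]; rewrite (lie_bracket_sections xB sY sZ Ax).
  by apply: eq_bigr => a _; apply: eq_bigr => b _; rewrite !mxE Yx Zx.
apply: uniq; rewrite /levi; set S := [set w | _].
suff [w Sw] : exists w, S w by exact: (@xgetPex _ 0 S (ex_intro _ w Sw)).
have [sY Yx] := constant_sectionP Ax (subvsP u); have [sZ Zx] := constant_sectionP Ax (subvsP v).
by exists (qproj (D x) (lie_bracket (constant_section x (vsval u)) (constant_section x (vsval v)) x)),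
  A, (constant_section x (vsval u)), (constant_section x (vsval v)).
Qed.

End LocalFrame.

Section Levi.
Variables (R : realType) (n : nat) (X : manifold R n) (D : tangent_subspaces X) (p : nat).
Hypothesis hD : is_distribution p D.

Lemma levi_section x B Y Z (u v : Dspace D x) : open_nbhs x B -> vf_section B D Y ->
  vf_section B D Z -> Y x = vsval u -> Z x = vsval v ->
  levi D x u v = qproj (D x) (lie_bracket Y Z x).
Proof.
move=> xB sY sZ Yx Zx; have [dD fr] := hD; have [A [oA Ax] [F [sF spF]]] := fr x.
rewrite (levi_frame oA sF dD spF) // (lie_bracket_sections oA sF dD spF xB sY sZ Ax).
by apply: eq_bigr => a _; apply: eq_bigr => b _; rewrite !mxE Yx Zx.
Qed.

Lemma levi_bilinear x : is_bilinear (levi D x).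
Proof.
have [dD fr] := hD; have [A [oA Ax] [F [sF spF]]] := fr x.
have E u v := @levi_frame _ _ _ _ _ _ _ oA sF dD spF x u v Ax.
split=> [v|u] c w1 w2; rewrite !E scaler_sumr -big_split /=; apply: eq_bigr => a _;
  rewrite scaler_sumr -big_split /=; apply: eq_bigr => b _; rewrite scalerA -scalerDl;
  congr (_ *: _); rewrite !linearP /= ?mulrDl ?mulrDr ?mulrA //.
by congr (_ + _); rewrite mulrAC mulrC mulrA.
Qed.

Lemma levi_alt x u : levi D x u u = 0.
Proof.
have [dD fr] := hD; have [A [oA Ax] [F [sF spF]]] := fr x.
have [sY Yx] := constant_sectionP oA sF dD spF Ax (subvsP u).
have xA : open_nbhs x A by [].
rewrite (levi_section xA sY sY Yx Yx) /lie_bracket subrr; exact: linear0.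
Qed.

End Levi.

(** * Continuity of the Levi bracket in smooth frames *)

Section LeviContinuity.
Variables (R : realType) (n : nat) (X : manifold R n) (D : tangent_subspaces X) (p q : nat).
Hypothesis hD : is_distribution p D.
Variables (A : set X) (e : forall x, frame_at D p q x).
Hypothesis oA : open A.
Hypothesis se : smooth_frame A e.

Definition frame_field (a : 'I_p) : vfield X := fun x => vsval (tnth (e x).1 a).

Lemma frame_field_section a : vf_section A D (frame_field a).
Proof. by have [_ s1 _] := se; split=> [|x _]; [exact: s1|exact: subvsP]. Qed.

Lemma sum_frame_field x (c : 'I_p -> R) :
  \sum_a c a *: (frame_field a x : 'rV[R]_n) = vsval (\sum_a c a *: tnth (e x).1 a).
Proof.
symmetry; transitivity (\sum_a vsval (c a *: tnth (e x).1 a)); first exact: linear_sum.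
by apply: eq_bigr => a _; exact: linearZ.
Qed.

Lemma levi_frame_field x a b : A x -> levi D x (tnth (e x).1 a) (tnth (e x).1 b) =
  qproj (D x) (lie_bracket (frame_field a) (frame_field b) x).
Proof.
move=> Ax; apply: (levi_section hD (B := A)) => //; exact: frame_field_section.
Qed.

Section Complement.
Variable Z : 'I_q -> vfield X.
Hypothesis sZ : forall k, smooth_vf A (Z k).
Hypothesis ZE : forall k x, A x -> qproj (D x) (Z k x) = tnth (e x).2 k.

Lemma qproj_sum x (c : 'I_q -> R) : A x ->
  qproj (D x) (\sum_k c k *: (Z k x : tangent x)) = \sum_k c k *: tnth (e x).2 k.
Proof.
move=> Ax; transitivity (\sum_k qproj (D x) (c k *: Z k x)); first exact: linear_sum.
apply: eq_bigr => k _; rewrite -ZE //; exact: linearZ.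
Qed.

(** The frame of D completed by lifts Z of the frame of the quotient, all written in one chart i so
    that values at different points can be compared. *)
Definition adapted (i : mf_index X) (u : 'rV[R]_n) : 'M[R]_(p + q, n) :=
  col_mx (\matrix_a vf_coord i (frame_field a) u) (\matrix_k vf_coord i (Z k) u).

Lemma adapted_right_inverse x : A x ->
  exists H, adapted (mf_at x) (mf_phi (mf_at x) x) *m H = 1%:M.
Proof.
move=> Ax; have [fr _ _] := se; have [b1 b2] := fr x Ax.
apply/row_freeP; apply: inj_row_free => r.
rewrite -[r]hsubmxK; set r1 := lsubmx r; set r2 := rsubmx r.
rewrite /adapted mul_row_col !mulmx_rows => h.
have {}h : \sum_a r1 0 a *: (frame_field a x : 'rV[R]_n) +
    \sum_k r2 0 k *: (Z k x : 'rV[R]_n) = 0.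
  by rewrite -[RHS]h; congr (_ + _); apply: eq_bigr => a _; rewrite vf_coord_at.
have h2 : \sum_k r2 0 k *: tnth (e x).2 k = 0.
  rewrite -qproj_sum //; apply/eqP; rewrite qproj_eq0.
  have e2 : \sum_k r2 0 k *: (Z k x : 'rV[R]_n) = - \sum_a r1 0 a *: (frame_field a x : 'rV[R]_n).
    by apply/eqP; rewrite -addr_eq0 addrC h.
  by rewrite [X in X \in _]e2 sum_frame_field memvN subvsP.
have r20 : r2 = 0.
  by apply/rowP => k; rewrite [RHS]mxE -(coord_expand (fun k => r2 0 k) k b2) h2 linear0.
have h1 : \sum_a r1 0 a *: tnth (e x).1 a = 0.
  apply: val_inj; rewrite /= -sum_frame_field -[RHS]h.
  by rewrite [X in _ = _ + X]big1 ?addr0 // => k _; rewrite r20 mxE scale0r.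
have r10 : r1 = 0.
  by apply/rowP => k; rewrite [RHS]mxE -(coord_expand (fun k => r1 0 k) k b1) h1 linear0.
by rewrite r10 r20 row_mx0.
Qed.

(** The coordinates of a bracket of two frame fields in the adapted frame: the last q are the
    components of the Levi bracket, the first p those of the remainder, which lies in D. *)
Definition bracket_coords a b x : 'rV[R]_(p + q) :=
  let l := levi D x (tnth (e x).1 a) (tnth (e x).1 b) in
  let w := lie_bracket (frame_field a) (frame_field b) x -
    \sum_k coord (e x).2 k l *: (Z k x : tangent x) in
  row_mx (\row_c coord (e x).1 c (vsproj (D x) w)) (\row_k coord (e x).2 k l).

Lemma bracket_coordsP a b i x : A x -> mf_dom i x ->
  bracket_coords a b x *m adapted i (mf_phi i x) =
  chart_bracket (vf_coord i (frame_field a)) (vf_coord i (frame_field b)) (mf_phi i x).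
Proof.
move=> Ax ix; have [fr _ _] := se; have [b1 b2] := fr x Ax.
rewrite -(lie_bracketE oA (frame_field_section a).1 (frame_field_section b).1 Ax ix).
rewrite /bracket_coords; set l := levi _ _ _ _; set s := \sum_k _; set w := _ - s.
rewrite /adapted mul_row_col !mulmx_rows.
have wD : w \in D x.
  rewrite -qproj_eq0; apply/eqP.
  transitivity (qproj (D x) (lie_bracket (frame_field a) (frame_field b) x) - qproj (D x) s).
    exact: linearB.
  by rewrite -levi_frame_field // qproj_sum // -basis_expand // subrr.
have e1 : \sum_c coord (e x).1 c (vsproj (D x) w) *: (frame_field c x : 'rV[R]_n) = w.
  by rewrite sum_frame_field -basis_expand // vsprojK.
transitivity (tchange (mf_at x) i x
   (\sum_c coord (e x).1 c (vsproj (D x) w) *: (frame_field c x : 'rV[R]_n)) +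
  tchange (mf_at x) i x (\sum_k coord (e x).2 k l *: (Z k x : 'rV[R]_n))).
  rewrite !tchange_sum; congr (_ + _); apply: eq_bigr => c _; by rewrite mxE vf_coordE.
rewrite e1; transitivity (tchange (mf_at x) i x (w + s)); first exact: esym (linearD _ _ _).
by congr tchange; exact: subrK.
Qed.

Lemma cvg_vf_coord Y x : smooth_vf A Y -> A x ->
  vf_coord (mf_at x) Y (mf_phi (mf_at x) y) @[y --> x] --> vf_coord (mf_at x) Y (mf_phi (mf_at x) x).
Proof.
move=> sY Ax; have ix := mf_atP x.
have h1 : mf_phi (mf_at x) @ x --> mf_phi (mf_at x) x by exact: mf_phi_cont ix.
have h2 : vf_coord (mf_at x) Y @ (mf_phi (mf_at x) x) --> vf_coord (mf_at x) Y (mf_phi (mf_at x) x).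
  by apply: (smooth_on_continuous (sY (mf_at x))); exists x.
exact: continuous_comp h1 h2.
Qed.

(** In the fixed chart at x these coordinates solve a linear system with continuous data, whose
    matrix has a right inverse at x. *)
Lemma cvg_bracket_coords a b x : A x -> bracket_coords a b @ x --> bracket_coords a b x.
Proof.
move=> Ax; set i := mf_at x; have ix := mf_atP x.
have [H HP] := adapted_right_inverse Ax.
apply: (@cvg_linear_system_at _ _ _ _ _ (fun y => adapted i (mf_phi i y))
  (fun y => chart_bracket (vf_coord i (frame_field a)) (vf_coord i (frame_field b)) (mf_phi i y))
  H).
- have nA : \forall y \near x, (A `&` mf_dom i) y.
    by apply: open_nbhs_nbhs; split; [apply: openI => //; exact: mf_dom_open|].
  by apply: filterS nA => y [Ay iy]; exact: bracket_coordsP.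
- apply: (@cvg_mx _ _ (nbhs x) _) => k j; rewrite /adapted.
  rewrite -(splitK k); case: (fintype.split k) => k' /=.
    under eq_fun do rewrite col_mxEu mxE.
    rewrite col_mxEu mxE; apply: (@cvg_mxE _ _ (nbhs x) _).
    exact: cvg_vf_coord (frame_field_section k').1 Ax.
  under eq_fun do rewrite col_mxEd mxE.
  rewrite col_mxEd mxE; apply: (@cvg_mxE _ _ (nbhs x) _).
  exact: cvg_vf_coord (sZ k') Ax.
- have h1 : mf_phi i @ x --> mf_phi i x by exact: mf_phi_cont ix.
  have oB : open (mf_phi i @` (A `&` mf_dom i)) by exact: open_chart_image.
  have Bx : (mf_phi i @` (A `&` mf_dom i)) (mf_phi i x) by exists x.
  have h2 := cvg_chart_bracket oB ((frame_field_section a).1 i) ((frame_field_section b).1 i) Bx.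
  exact: continuous_comp h1 h2.
- exact: HP.
Qed.

End Complement.

Lemma cvg_levi x : A x ->
  read_bracket (e y) (levi D y) @[y --> x] --> read_bracket (e x) (levi D x).
Proof.
move=> Ax; have [_ _ cs] := se.
have [Z ZP] : {Z : 'I_q -> vfield X & forall k, smooth_vf A (Z k) /\
    forall x, A x -> qproj (D x) (Z k x) = tnth (e x).2 k}.
  have h k : {Zk : vfield X | smooth_vf A Zk /\ forall x, A x -> qproj (D x) (Zk x) = tnth (e x).2 k}.
    by apply: cid; have [Zk s1 s2] := cs k; exists Zk.
  by exists (fun k => projT1 (h k)) => k; exact: (projT2 (h k)).
have sZ k := (ZP k).1; have ZE k y Ay := (ZP k).2 y Ay.
apply: (@cvg_mx _ _ (nbhs x) _) => k c; case/mxvec_indexP: c => a b.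
have E y : read_bracket (e y) (levi D y) k (mxvec_index a b) =
    bracket_coords Z a b y 0 (rshift p k).
  by rewrite /bracket_coords row_mxEr [RHS]mxE -sliceE slice_read.
under eq_fun do rewrite E.
rewrite E; apply: (@cvg_mxE _ _ (nbhs x) _).
exact: cvg_bracket_coords.
Qed.

End LeviContinuity.

(** * Choice of the bracket *)

Section Selection.
Variables (R : realType) (p q : nat) (K : sconst R p q).

Lemma compat_closed T (F : set_system T) {FF : Filter F} (f : T -> sconst R p q)
    (M : sconst R p q) :
  f @ F --> M -> ~ compat K M -> \forall x \near F, ~ compat K (f x).
Proof.
move=> fM nc.
have neq a b (g h : T -> 'M[R]_(a, b)) (g0 h0 : 'M[R]_(a, b)) : g @ F --> g0 -> h @ F --> h0 -> g0 <> h0 ->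
    \forall x \near F, g x <> h x.
  move=> gg hh gh; have d : (g x - h x) @[x --> F] --> g0 - h0 by exact: cvgB.
  have d0 : g0 - h0 != 0 by rewrite subr_eq0; apply/eqP.
  by apply: filterS (cvg_mx_neq0 d d0) => x /eqP dx gx; apply: dx; rewrite gx subrr.
have cK : (fun _ : T => K) @ F --> K by exact: cvg_cst.
have cst m n (a : 'M[R]_(m, n)) : (fun _ : T => a) @ F --> a by exact: cvg_cst.
have a1 : alpha (f x) (f x) @[x --> F] --> alpha M M by exact: cvg_alpha.
have b1 : beta (f x) (f x) @[x --> F] --> beta M M by exact: cvg_beta.
have a2 : alpha K (f x) @[x --> F] --> alpha K M by exact: cvg_alpha.
have b2 : beta K (f x) @[x --> F] --> beta K M by exact: cvg_beta.
have a3 : (alpha K (f x))^T @[x --> F] --> (alpha K M)^T by exact: cvg_trmx.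
have b3 : (beta K (f x))^T @[x --> F] --> (beta K M)^T by exact: cvg_trmx.
have [h1|h1] := pselect (alpha M M = q%:R%:M); last first.
  by apply: filterS (neq _ _ _ _ _ _ a1 (cst _ _ _) h1) => x hx [[]].
have [h2|h2] := pselect (beta M M = p%:R%:M); last first.
  by apply: filterS (neq _ _ _ _ _ _ b1 (cst _ _ _) h2) => x hx [[]].
have [h3|h3] := pselect ((alpha K M)^T = alpha K M); last first.
  by apply: filterS (neq _ _ _ _ _ _ a3 a2 h3) => x hx [].
have [h4|h4] := pselect ((beta K M)^T = beta K M); last first.
  by apply: filterS (neq _ _ _ _ _ _ b3 b2 h4) => x hx [].
by case: nc.
Qed.

(** Limit points of the changes of frame x stay in the compact set [near_orth] and satisfy the
    closed conditions for l0, so by uniqueness they all define k0. The tube lemma expresses this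
    without subsequences. *)
Lemma cvg_selection T (F : set_system T) {FF : Filter F} (l k : T -> sconst R p q)
    (l0 k0 : sconst R p q) (e : R) :
  l @ F --> l0 ->
  (forall x, near_orth x -> compat K (act x.1 x.2 l0) -> `|act x.1 x.2 l0 - K| <= e ->
     k0 = act (invmx x.1) (invmx x.2) K) ->
  (\forall y \near F, exists2 x, near_orth x &
     [/\ compat K (act x.1 x.2 (l y)), `|act x.1 x.2 (l y) - K| <= e &
      k y = act (invmx x.1) (invmx x.2) K]) ->
  k @ F --> k0.
Proof.
move=> ll0 k0P kP; apply/cvgrPdist_le => d d0.
have tube : \forall y \near F, forall x, near_orth x -> compat K (act x.1 x.2 (l y)) ->
    `|act x.1 x.2 (l y) - K| <= e -> `|k0 - act (invmx x.1) (invmx x.2) K| <= d.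
  pose P y (x : 'M[R]_p * 'M[R]_q) := compat K (act x.1 x.2 (l y)) ->
    `|act x.1 x.2 (l y) - K| <= e -> `|k0 - act (invmx x.1) (invmx x.2) K| <= d.
  have h := @compact_tube _ T F FF (@near_orth R p q) P (@compact_near_orth R p q).
  apply: h; rewrite /P.
  case=> A B xG; have [/= uA uB] := near_orth_unit xG.
  have c1 : z.1.1 @[z --> (nbhs (A, B), F)] --> A.
    by apply: (@cvg_comp _ _ _ fst fst _ (nbhs (A, B))); exact: cvg_fst.
  have c2 : z.1.2 @[z --> (nbhs (A, B), F)] --> B.
    by apply: (@cvg_comp _ _ _ fst snd _ (nbhs (A, B))); [exact: cvg_fst|exact: cvg_snd].
  have c3 : l z.2 @[z --> (nbhs (A, B), F)] --> l0.
    by apply: (@cvg_comp _ _ _ snd l _ F); [exact: cvg_snd|exact: ll0].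
  have cM : act z.1.1 z.1.2 (l z.2) @[z --> (nbhs (A, B), F)] --> act A B l0 by exact: cvg_act.
  (* If (A, B) violates one of the closed conditions for l0, so do its neighbours, and there is
     nothing to prove there. *)
  have [cp|ncp] := pselect (compat K (act A B l0)); last first.
    by apply: filterS (compat_closed cM ncp) => z nz /nz.
  have [le|gt] := leP `|act A B l0 - K| e; last first.
    have cN : `|act z.1.1 z.1.2 (l z.2) - K| @[z --> (nbhs (A, B), F)] --> `|act A B l0 - K|.
      by apply: cvg_norm; apply: cvgB cM _; exact: cvg_cst.
    by apply: filterS (cvgr_gt _ cN _ gt) => z h _ h2; have := lt_le_trans h h2; rewrite ltxx.
  have i1 : invmx z.1.1 @[z --> (nbhs (A, B), F)] --> invmx A by exact: cvg_invmx.
  have i2 : invmx z.1.2 @[z --> (nbhs (A, B), F)] --> invmx B by exact: cvg_invmx.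
  have cK : (fun=> K) z @[z --> (nbhs (A, B), F)] --> K by exact: cvg_cst.
  have cI : act (invmx z.1.1) (invmx z.1.2) K @[z --> (nbhs (A, B), F)] -->
    act (invmx A) (invmx B) K by exact: cvg_act.
  apply: filterS (near_dist_lt cI d0) => z h _ _.
  by rewrite (k0P (A, B)) // distrC ltW.
by apply: filterS2 tube kP => y h [x xG [h1 h2 ->]]; exact: h.
Qed.

End Selection.

Section Brackets.
Variables (R : realType) (p q : nat) (A B : vectType R) (K0 : sconst R p q).
Implicit Types (e : frame p q A B) (K : alt_bracket A B) (L : A -> A -> B).

(** The bound on L picks out one compatible bracket ([selected_unique]); it is a weak inequality so
    that it survives limits. *)
Definition selected (r : R) K L : Prop := exists e,
  [/\ is_frame e, read_bracket e K = K0, compat K0 (read_bracket e L) &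
      `|read_bracket e L - K0| <= r].

Lemma selected_in_frame (r : R) e L M N : is_frame e -> is_bilinear L -> Wspace K0 ->
  M \in unitmx -> N \in unitmx -> compat K0 (act M N (read_bracket e L)) ->
  `|act M N (read_bracket e L) - K0| <= r ->
  exists2 K, selected r K L & read_bracket e K = act (invmx M) (invmx N) K0.
Proof.
move=> fe bL wK uM uN cp le; set e1 := change_frame e M N.
have fe1 : is_frame e1 by exact: change_frameP.
have rK : read_bracket e1 (alt_bracket_of e1 wK) = K0 by exact: read_bracket_of.
exists (alt_bracket_of e1 wK).
  by exists e1; split => //; rewrite read_change_frame.
rewrite -[X in act _ _ X]rK read_change_frame ?actK //.
exact: alt_bracket_bilinear.
Qed.

Definition rigid (eps : R) : Prop := forall M A B,
  A \in unitmx -> B \in unitmx -> Wspace M -> compat K0 M -> compat K0 (act A B M) ->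
  `|M - K0| < eps ->
  `|act A B M - K0| < eps \/ `|act (invmx A) (invmx B) K0 - K0| < eps ->
  act A B K0 = K0.

(** [rigid] applied to the transition from e1 to e2: it fixes K0, so K' has the same components in
    both frames. *)
Lemma rigid_frames eps e1 e2 K' L : rigid eps -> is_frame e1 -> is_frame e2 ->
  is_bilinear L -> (forall u, L u u = 0) ->
  compat K0 (read_bracket e1 L) -> `|read_bracket e1 L - K0| < eps ->
  read_bracket e2 K' = K0 -> compat K0 (read_bracket e2 L) ->
  `|read_bracket e2 L - K0| < eps \/ `|read_bracket e1 K' - K0| < eps ->
  read_bracket e1 K' = K0.
Proof.
move=> rg f1 f2 bL aL c1 n1 rK c2 n2; have [P [Q [uP uQ e2E]]] := frame_change f1 f2.
have bK := alt_bracket_bilinear K'.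
have r1 : act P Q (read_bracket e1 K') = K0 by rewrite -read_change_frame // -e2E.
have r2 : read_bracket e2 L = act P Q (read_bracket e1 L) by rewrite e2E read_change_frame.
have r3 : read_bracket e1 K' = act (invmx P) (invmx Q) K0 by rewrite -r1 actK.
rewrite r3 -[X in act _ _ X](rg (read_bracket e1 L) P Q) ?actK //; rewrite -?r2 -?r3 //.
exact: read_Wspace.
Qed.

Lemma selected_unique eps r K K' L : rigid eps -> r < eps -> is_bilinear L ->
  (forall u, L u u = 0) -> selected r K L -> selected r K' L -> forall u v, K' u v = K u v.
Proof.
move=> rg re bL aL [e1 [f1 rK c1 n1]] [e2 [f2 rK' c2 n2]].
apply: (read_inj f1 (alt_bracket_bilinear K') (alt_bracket_bilinear K)).
rewrite rK; apply: (rigid_frames rg f1 f2 bL aL c1 _ rK' c2); first exact: le_lt_trans n1 re.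
by left; exact: le_lt_trans n2 re.
Qed.

End Brackets.

Lemma selected_compatible (R : realType) (t : contact_type) (A B : vectType R) (r : R)
    (K : alt_bracket A B) (L : A -> A -> B) : clifford (kappa R t) -> is_bilinear L ->
  selected (kappa R t) r K L -> compatible t K L.
Proof.
move=> cK bL [e [fe rK cp _]]; apply/compatibleP => //; first exact: alt_bracket_bilinear.
by exists e.
Qed.

(** The frame e2 of a nearby compatible K' gives no bound on L, but K' read in the frame e1 of K is
    near kappa: this is the second alternative of [rigid]. *)
Lemma selected_locally_unique (R : realType) (t : contact_type) (A B : vectType R) (eps r : R)
    (K : alt_bracket A B) (L : A -> A -> B) : clifford (kappa R t) -> is_bilinear L ->
  (forall u, L u u = 0) -> rigid (kappa R t) eps -> r < eps -> 0 < eps ->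
  selected (kappa R t) r K L -> locally_unique t K L.
Proof.
move=> cK bL aL rg re e0 [e1 [f1 rK c1 n1]] e fe.
have [P [Q [uP uQ e1E]]] := frame_change fe f1.
have bK := alt_bracket_bilinear K.
have aK : act P Q (read_bracket e K) = kappa R t by rewrite -read_change_frame // -e1E.
have near_K : \forall w \near read_bracket e K, `|act P Q w - kappa R t| < eps.
  have aux T (F : set_system T) (FF : Filter F) (f : T -> sconst R _ _) w0 :
      f @ F --> w0 -> act P Q w0 = kappa R t -> \forall x \near F, `|act P Q (f x) - kappa R t| < eps.
    move=> fw <-; apply: near_dist_lt e0; apply: cvg_act => //; exact: cvg_cst.
  exact: (aux _ (nbhs (read_bracket e K)) _ id _ cvg_id aK).
apply: filterS near_K => w nw K' rK' /compatibleP.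
move=> /(_ (alt_bracket_bilinear K') bL cK) [e2 [f2 rK2 c2]].
have r1 : read_bracket e1 K' = act P Q w.
  by rewrite e1E read_change_frame ?rK' //; exact: alt_bracket_bilinear.
apply: (read_inj f1 (alt_bracket_bilinear K') bK).
rewrite rK; apply: (rigid_frames rg f1 f2 bL aL c1 _ rK2 c2); first exact: le_lt_trans n1 re.
by right; rewrite r1.
Qed.

Theorem theorem9 (R : realType) (t : contact_type) (ht : admissible t)
    (X : manifold R (rank_of t + corank_of t)) (D : tangent_subspaces X)
    (hD : is_distribution (rank_of t) D) :
  exists U : set (sconst R (rank_of t) (corank_of t)),
    [/\ open_in_W U, U (kappa R t) &
     exists K : forall x : X, alt_bracket (Dspace D x) (TDspace D x),
       (forall x, levi_locus D U x ->
          compatible t (K x) (levi D x) /\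
          locally_unique t (K x) (levi D x)) /\
       continuous_bracket (rank_of t) (corank_of t) (levi_locus D U) K].
Proof.
have cK := clifford_kappa R ht; have vK := unit_volume_kappa R ht.
have p0 := rank_gt0 ht; have oq := odd_corank t.
have wK : Wspace (kappa R t) by apply/WspaceE; exact: cK.1.
have [eps e0 rg] := compat_unique p0 oq cK vK.
have r0 : 0 < eps / 2 by rewrite divr_gt0.
have re : eps / 2 < eps by rewrite gtr_pMr // invf_lt1 // ltr1n.
(* [Wspace M] is a hypothesis inside Q so that Q is a neighbourhood in the space of all structure
   constants; its interior then gives a set open in W. *)
pose Q := [set M : sconst R (rank_of t) (corank_of t) | Wspace M -> exists2 x, near_orth x &
  compat (kappa R t) (act x.1 x.2 M) /\ `|act x.1 x.2 M - kappa R t| < eps / 2].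
have QK : nbhs (kappa R t) Q by exact: compat_exists.
pose U := interior Q `&` @Wspace R (rank_of t) (corank_of t).
have bL x := levi_bilinear hD x; have aL x := @levi_alt _ _ _ _ _ hD x.
have h x : exists K : alt_bracket (Dspace D x) (TDspace D x),
    levi_locus D U x -> selected (kappa R t) (eps / 2) K (levi D x).
  have [[e fe [Qe We]]|nS] := pselect (levi_locus D U x).
    have [z zG [cz nz]] := interior_subset Qe We; have [u1 u2] := near_orth_unit zG.
    have [K sK _] := selected_in_frame fe (bL x) wK u1 u2 cz (ltW nz).
    by exists K.
  (* Off the locus the value is arbitrary; tuples of zero vectors give the zero bracket. *)
  by exists (alt_bracket_of ([tuple 0 | _ < rank_of t], [tuple 0 | _ < corank_of t]) wK).
pose K x := projT1 (cid (h x)).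
have KP x (xS : levi_locus D U x) : selected (kappa R t) (eps / 2) (K x) (levi D x).
  exact: (projT2 (cid (h x)) xS).
exists U; split.
- by exists (interior Q) => //; exact: open_interior.
- by split.
exists K; split=> [x xS|A e oA se].
  split; first exact: selected_compatible cK (bL x) (KP x xS).
  exact: selected_locally_unique cK (bL x) (aL x) rg re e0 (KP x xS).
apply/subspace_continuousP => x0 [Ax0 Sx0].
have [fr _ _] := se; have [e1 f1 [Q1 W1]] := Sx0.
have [P [N [uP uN e1E]]] := frame_change (fr x0 Ax0) f1.
(* The constant change (P, N) carries the given frame at x0 to e1, where the Levi bracket lies in U;
   in the changed frames it then stays in [interior Q] for x near x0. *)
pose l x := act P N (read_bracket (e x) (levi D x)).
pose k x := act P N (read_bracket (e x) (K x)).
have lE x : A x -> l x = read_bracket (change_frame (e x) P N) (levi D x).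
  by move=> Ax; rewrite read_change_frame //; exact: fr.
have kE x : A x -> k x = read_bracket (change_frame (e x) P N) (K x).
  by move=> Ax; rewrite read_change_frame //; [exact: fr|exact: alt_bracket_bilinear].
have cl : l @ x0 --> l x0.
  have cL := cvg_levi hD oA se Ax0.
  have aux T (F : set_system T) (FF : Filter F) (f : T -> sconst R _ _) M :
      f @ F --> M -> (fun x => act P N (f x)) @ F --> act P N M.
    by move=> fM; apply: cvg_act => //; exact: cvg_cst.
  exact: (aux _ (nbhs x0) _ _ _ cL).
(* By uniqueness, every z in [near_orth] that makes l x compatible and close to kappa yields the
   bracket chosen by [cid]. *)
have key x : A x -> levi_locus D U x -> forall z, near_orth z ->
    compat (kappa R t) (act z.1 z.2 (l x)) -> `|act z.1 z.2 (l x) - kappa R t| <= eps / 2 ->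
    k x = act (invmx z.1) (invmx z.2) (kappa R t).
  move=> Ax xS z zG; rewrite lE // => cz nz; have [u1 u2] := near_orth_unit zG.
  have fe := change_frameP (fr x Ax) uP uN.
  have [K1 sK1 <-] := selected_in_frame fe (bL x) wK u1 u2 cz nz.
  have KK1 := selected_unique rg re (bL x) (aL x) sK1 (KP x xS).
  by rewrite kE // /read_bracket; congr mk_sc; apply/funext => c; apply/funext => i;
    apply/funext => j; rewrite KK1.
have ck : k @ within (A `&` levi_locus D U) (nbhs x0) --> k x0.
  have clw : l @ within (A `&` levi_locus D U) (nbhs x0) --> l x0.
    by apply: cvg_trans cl; apply: cvg_app; exact: cvg_within.
  apply: cvg_selection clw (key x0 Ax0 Sx0) _.
  have nQ : \forall x \near x0, interior Q (l x).
    have Q0 : interior Q (l x0) by rewrite (lE x0 Ax0) -e1E; exact: Q1.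
    apply: cl; apply: open_nbhs_nbhs; split; [exact: open_interior|exact: Q0].
  rewrite near_withinE; apply: filterS nQ => x Qx [Ax xS].
  have Wx : Wspace (l x) by apply: Wspace_act; apply: read_Wspace (bL x) (aL x).
  have [z zG [cz nz]] := interior_subset Qx Wx.
  by exists z => //; split => //; [exact: ltW|apply: key => //; exact: ltW].
have aux T (F : set_system T) (FF : Filter F) (f : T -> sconst R _ _) M :
    f @ F --> M -> (fun x => act (invmx P) (invmx N) (f x)) @ F --> act (invmx P) (invmx N) M.
  by move=> fM; apply: cvg_act => //; exact: cvg_cst.
have kK x : act (invmx P) (invmx N) (k x) = read_bracket (e x) (K x) by rewrite /k actK.
have H : (fun x => act (invmx P) (invmx N) (k x)) @ within (A `&` levi_locus D U) (nbhs x0) -->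
    act (invmx P) (invmx N) (k x0) by exact: aux ck.
have E : (fun x => act (invmx P) (invmx N) (k x)) = (fun x => read_bracket (e x) (K x)).
  exact: funext kK.
have E0 := kK x0; rewrite E E0 in H; exact: H.
Qed.
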